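(* Let $e(k)$ denote the number of distinct combinatorial types of $k$-equiprojective polytopes. Then $$e(k)\ \geq\ k^{k\left(\frac{3}{2}+O\left(\frac{1}{\log k}\right)\right)}$$ as $k\to\infty$; that is, there is a function $g$ with $g(k)=O(1/\log k)$ such that $e(k)\geq k^{k(3/2+g(k))}$ for all sufficiently large integers $k$.
   Context: A $3$-dimensional polytope $P\subset\mathbb{R}^3$ is $k$-equiprojective when its orthogonal projection onto any plane that is not orthogonal to a facet of $P$ is a polygon with exactly $k$ vertices. Two polytopes have the same combinatorial type when their face lattices (sets of faces ordered by inclusion) are isomorphic, i.e. there is a bijection between their faces preserving inclusion in both directions. *)

(* Defs.v *)
From HB Require Import structures.
From mathcomp Require Import all_boot all_order all_algebra.
From mathcomp Require Import boolp classical_sets reals exp.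
Set Implicit Arguments. Unset Strict Implicit. Unset Printing Implicit Defensive.
Import Order.TTheory GRing.Theory Num.Theory.
Local Open Scope ring_scope.
Local Open Scope classical_set_scope.

Section Polytopes.
Variable R : realType.
Notation pt := 'rV[R]_3.

Definition dot (u v : pt) : R := \sum_(i < 3) u 0 i * v 0 i.

Definition conv (V : seq pt) : set pt :=
  [set x | exists l : 'I_(size V) -> R,
     (forall i, 0 <= l i) /\ \sum_(i < size V) l i = 1 /\
     x = \sum_(i < size V) l i *: V`_i].

Definition aff_indep4 (a b c d : pt) : Prop :=
  \rank (col_mx (b - a) (col_mx (c - a) (d - a))) = 3%N.

Definition aff_indep3 (a b c : pt) : Prop :=
  \rank (col_mx (b - a) (c - a)) = 2%N.

Definition polytope3 (P : set pt) : Prop :=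
  exists V : seq pt, P = conv V /\
  exists a b c d, [/\ P a, P b, P c, P d & aff_indep4 a b c d].

(* face of P maximizing the linear functional c (c = 0 gives P itself) *)
Definition face_of_dir (P : set pt) (c : pt) : set pt :=
  [set x | P x /\ forall y, P y -> dot c y <= dot c x].

Definition face (P : set pt) (F : set pt) : Prop :=
  F = set0 \/ exists c, F = face_of_dir P c.

Definition facet_normal (P : set pt) (c : pt) : Prop :=
  c != 0 /\ exists a b d, [/\ face_of_dir P c a, face_of_dir P c b,
                              face_of_dir P c d & aff_indep3 a b d].

Definition proj (u x : pt) : pt := x - (dot x u / dot u u) *: u.

Definition extreme (S : set pt) (x : pt) : Prop :=
  S x /\ ~ exists y z t, [/\ S y, S z, y != z, 0 < t < 1 &
                            x = t *: y + (1 - t) *: z].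

Definition num_vertices_eq (S : set pt) (k : nat) : Prop :=
  exists s : seq pt, [/\ uniq s, size s = k & forall x, x \in s <-> extreme S x].

(* the plane with normal u is orthogonal to a facet of P *)
Definition plane_orth_facet (P : set pt) (u : pt) : Prop :=
  exists c, facet_normal P c /\ dot u c = 0.

Definition equiprojective (P : set pt) (k : nat) : Prop :=
  polytope3 P /\
  forall u : pt, u != 0 -> ~ plane_orth_facet P u ->
    num_vertices_eq (proj u @` P) k.

Definition same_comb_type (P Q : set pt) : Prop :=
  exists (f g : set pt -> set pt),
    [/\ forall F, face P F -> face Q (f F),
        forall G, face Q G -> face P (g G),
        forall F, face P F -> g (f F) = F,
        forall G, face Q G -> f (g G) = G &
        forall F F', face P F -> face P F' -> (F `<=` F' <-> f F `<=` f F')].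

(* e(k) >= N : there are at least N pairwise combinatorially distinct
   k-equiprojective polytopes *)
Definition at_least_types (k N : nat) : Prop :=
  exists Ps : 'I_N -> set pt,
    (forall i, equiprojective (Ps i) k) /\
    (forall i j, i != j -> ~ same_comb_type (Ps i) (Ps j)).

End Polytopes.

(* Main.v *)
Require Import Defs.
From mathcomp Require Import all_boot all_order all_algebra.
From mathcomp Require Import boolp classical_sets reals sequences exp.
From mathcomp Require Import fintype finset ring lra zify.
Set Implicit Arguments. Unset Strict Implicit. Unset Printing Implicit Defensive.
Import Order.TTheory GRing.Theory Num.Theory.
Local Open Scope ring_scope.

(* Take the Minkowski sum of n segments [0, g_i] in general position, plus a point (k = 2n) or a
   generic triangle (k = 2n + 3).  Projected along a direction not parallel to any facet, each
   segment contributes two edges and the triangle three, so the sum is k-equiprojective.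

   The faces correspond to the sign vectors of linear functionals on the g_i.  Inside a facet the
   parallel edges are exactly the disjoint ones, so an isomorphism of face lattices carries the
   zones (classes of parallel edges) to zones, and the two sides of a zone to the two sides; hence
   it is described by n pairs (zone, sign rule), and each combinatorial type arises from at most
   (4n)^n members of a family of configurations whose sets of sign vectors are pairwise distinct.

   Such a family is grown one vector at a time, as points of the projective plane.  Given m points,
   each crossing v of two lines joining disjoint pairs of points is the leftmost point of exactly
   one cell of the arrangement of all joining lines, so there are at least (m/4)^4 (roughly) cells
   in which to put the next point, and two choices are told apart by the side of some joining
   line.  This yields n^(4n) e^(-O(n)) configurations, hence n^(3n) e^(-O(n)) types. *)

(** * Vectors in dimension three *)


(** With [k = 2n + O(1)], the bound [n^(3n) e^(-O(n))] equals [k^(3k/2) e^(-O(k))], and a factor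
    [e^(-O(k))] changes the exponent of k by only [O(k / log k)]. Every count may therefore waste a
    factor exponential in n, which is why the constants below are crude.

    The triangle is there for parity: sums of segments alone give even k only. It is also the main
    complication, since its three zones must not be confused with zones of segments, and each of its
    edges is maximal on one side only.

    Segments and triangle are treated alike by encoding a face as the set of those vertices of the
    summands that maximise a functional. Inclusion of faces becomes inclusion of finite sets, and
    the dimension of a proper face is the number of vertices in excess of one per summand.
    Statements about a whole zone are proved by walking from one functional to another through
    comparable faces. *)

Section Vectors.
Variable R : realType.
Notation pt := 'rV[R]_3.
Implicit Types u v w x y z : pt.

Definition cx u : R := u 0 (@Ordinal 3 0 isT).
Definition cy u : R := u 0 (@Ordinal 3 1 isT).
Definition cz u : R := u 0 (@Ordinal 3 2 isT).
Definition mkv (a b c : R) : pt := \row_(i < 3) nth 0 [:: a; b; c] i.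

Lemma cx_mkv a b c : cx (mkv a b c) = a. Proof. by rewrite /cx mxE. Qed.
Lemma cy_mkv a b c : cy (mkv a b c) = b. Proof. by rewrite /cy mxE. Qed.
Lemma cz_mkv a b c : cz (mkv a b c) = c. Proof. by rewrite /cz mxE. Qed.
Lemma cxD u v : cx (u + v) = cx u + cx v. Proof. by rewrite /cx mxE. Qed.
Lemma cyD u v : cy (u + v) = cy u + cy v. Proof. by rewrite /cy mxE. Qed.
Lemma czD u v : cz (u + v) = cz u + cz v. Proof. by rewrite /cz mxE. Qed.
Lemma cxN u : cx (- u) = - cx u. Proof. by rewrite /cx mxE. Qed.
Lemma cyN u : cy (- u) = - cy u. Proof. by rewrite /cy mxE. Qed.
Lemma czN u : cz (- u) = - cz u. Proof. by rewrite /cz mxE. Qed.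
Lemma cxZ a u : cx (a *: u) = a * cx u. Proof. by rewrite /cx mxE. Qed.
Lemma cyZ a u : cy (a *: u) = a * cy u. Proof. by rewrite /cy mxE. Qed.
Lemma czZ a u : cz (a *: u) = a * cz u. Proof. by rewrite /cz mxE. Qed.
Lemma cx0 : cx 0 = 0. Proof. by rewrite /cx mxE. Qed.
Lemma cy0 : cy 0 = 0. Proof. by rewrite /cy mxE. Qed.
Lemma cz0 : cz 0 = 0. Proof. by rewrite /cz mxE. Qed.

Lemma dotE u v : dot u v = cx u * cx v + cy u * cy v + cz u * cz v.
Proof.
rewrite /dot !big_ord_recl big_ord0 addr0 addrA /cx /cy /cz.
by do ![congr (_ + _) | congr (_ * _)]; congr (fun_of_matrix _ _ _); apply: val_inj.
Qed.

Lemma vec_ext u v : cx u = cx v -> cy u = cy v -> cz u = cz v -> u = v.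
Proof.
move=> hx hy hz; apply/rowP => -[[|[|[|//]]] hi].
- by rewrite (_ : Ordinal hi = @Ordinal 3 0 isT); last exact: val_inj.
- by rewrite (_ : Ordinal hi = @Ordinal 3 1 isT); last exact: val_inj.
- by rewrite (_ : Ordinal hi = @Ordinal 3 2 isT); last exact: val_inj.
Qed.

Definition cross u v : pt :=
  mkv (cy u * cz v - cz u * cy v) (cz u * cx v - cx u * cz v)
      (cx u * cy v - cy u * cx v).
Definition det3 u v w : R := dot u (cross v w).

Definition vecE := (dotE, cx_mkv, cy_mkv, cz_mkv, cxD, cyD, czD, cxN, cyN, czN,
                    cxZ, cyZ, czZ, cx0, cy0, cz0).

Lemma dotC u v : dot u v = dot v u. Proof. by rewrite !vecE; ring. Qed.
Lemma dotDl u v w : dot (u + v) w = dot u w + dot v w.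
Proof. by rewrite !vecE; ring. Qed.
Lemma dotDr u v w : dot u (v + w) = dot u v + dot u w.
Proof. by rewrite !vecE; ring. Qed.
Lemma dotNl u v : dot (- u) v = - dot u v. Proof. by rewrite !vecE; ring. Qed.
Lemma dotBr u v w : dot u (v - w) = dot u v - dot u w.
Proof. by rewrite !vecE; ring. Qed.
Lemma dotBl u v w : dot (u - v) w = dot u w - dot v w.
Proof. by rewrite !vecE; ring. Qed.
Lemma dotZl a u v : dot (a *: u) v = a * dot u v. Proof. by rewrite !vecE; ring. Qed.
Lemma dotZr a u v : dot u (a *: v) = a * dot u v. Proof. by rewrite !vecE; ring. Qed.
Lemma dot0l v : dot 0 v = 0. Proof. by rewrite !vecE; ring. Qed.
Lemma dot0r v : dot v 0 = 0. Proof. by rewrite !vecE; ring. Qed.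

Lemma dot_sumr (I : Type) (r : seq I) (P : pred I) (F : I -> pt) u :
  dot u (\sum_(i <- r | P i) F i) = \sum_(i <- r | P i) dot u (F i).
Proof.
elim/big_rec2: _ => [|i y1 y2 _ <-]; first by rewrite dot0r.
by rewrite dotDr.
Qed.

Lemma dot_ge0 u : 0 <= dot u u.
Proof. by rewrite dotE -!expr2 !addr_ge0 ?sqr_ge0. Qed.

Lemma dot_eq0 u : (dot u u == 0) = (u == 0).
Proof.
apply/eqP/eqP => [|->]; last by rewrite dot0l.
rewrite dotE -!expr2 => h.
have hx := sqr_ge0 (cx u); have hy := sqr_ge0 (cy u); have hz := sqr_ge0 (cz u).
by apply: vec_ext; rewrite !vecE; apply/eqP; rewrite -sqrf_eq0; apply/eqP; lra.
Qed.

Lemma dot_gt0 u : u != 0 -> 0 < dot u u.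
Proof. by move=> h; rewrite lt_def dot_eq0 h dot_ge0. Qed.

Lemma crossN u v : cross u v = - cross v u.
Proof. by apply: vec_ext; rewrite !vecE; ring. Qed.
Lemma crossNr u v : cross u (- v) = - cross u v.
Proof. by apply: vec_ext; rewrite !vecE; ring. Qed.
Lemma crossZr a u v : cross u (a *: v) = a *: cross u v.
Proof. by apply: vec_ext; rewrite !vecE; ring. Qed.
Lemma crossvv u : cross u u = 0.
Proof. by apply: vec_ext; rewrite !vecE; ring. Qed.
Lemma cross0r u : cross u 0 = 0.
Proof. by apply: vec_ext; rewrite !vecE; ring. Qed.
Lemma cross0l u : cross 0 u = 0.
Proof. by apply: vec_ext; rewrite !vecE; ring. Qed.
Lemma dot_crossl u v : dot u (cross u v) = 0. Proof. by rewrite !vecE; ring. Qed.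
Lemma dot_crossr u v : dot v (cross u v) = 0. Proof. by rewrite !vecE; ring. Qed.

Lemma cross_cross u v w : cross u (cross v w) = dot u w *: v - dot u v *: w.
Proof. by apply: vec_ext; rewrite !vecE; ring. Qed.

Lemma det3C u v w : det3 u v w = det3 v w u.
Proof. by rewrite /det3 !vecE; ring. Qed.
Lemma det3N u v w : det3 u v w = - det3 u w v.
Proof. by rewrite /det3 !vecE; ring. Qed.
Lemma det3Nl u v w : det3 (- u) v w = - det3 u v w.
Proof. by rewrite /det3 !vecE; ring. Qed.

Lemma dot_cross_cross u v : dot (cross u v) (cross u v) = dot u u * dot v v - dot u v ^+ 2.
Proof. by rewrite !vecE; ring. Qed.

Lemma cross_neq0_l u v : cross u v != 0 -> u != 0.
Proof. by apply: contra_neq => ->; rewrite cross0l. Qed.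
Lemma cross_neq0_r u v : cross u v != 0 -> v != 0.
Proof. by apply: contra_neq => ->; rewrite cross0r. Qed.

Lemma cross0_parallel u v : u != 0 -> cross u v = 0 -> v = (dot u v / dot u u) *: u.
Proof.
move=> /dot_gt0 u0 huv; have h := cross_cross u u v.
rewrite huv cross0r in h.
have hv : dot u u *: v = dot u v *: u by apply/eqP; rewrite eq_sym -subr_eq0 -h.
by apply: (scalerI (lt0r_neq0 u0)); rewrite hv scalerA mulrC divfK // gt_eqF.
Qed.

Lemma orth_cross c u v : cross u v != 0 -> dot c u = 0 -> dot c v = 0 ->
  c = (dot (cross u v) c / dot (cross u v) (cross u v)) *: cross u v.
Proof.
move=> h hu hv; apply: cross0_parallel => //.
by rewrite crossN cross_cross hu hv !scale0r subrr oppr0.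
Qed.

Lemma det3_neq0_orth u v w c : det3 u v w != 0 ->
  dot u c = 0 -> dot v c = 0 -> dot w c = 0 -> c = 0.
Proof.
move=> h hu hv hw.
have e : det3 u v w *: c = dot u c *: cross v w + dot v c *: cross w u + dot w c *: cross u v.
  by apply: vec_ext; rewrite /det3 !vecE; ring.
move: e; rewrite hu hv hw !scale0r !addr0 => /eqP; rewrite scaler_eq0 (negPf h) /=.
by move/eqP.
Qed.

Lemma det3_neq0_crossl u v w : det3 u v w != 0 -> cross v w != 0.
Proof. by apply: contra_neq; rewrite /det3 => ->; rewrite dot0r. Qed.

Lemma aff_indep3_cross a b c : cross (b - a) (c - a) != 0 -> aff_indep3 a b c.
Proof.
move=> h; apply/eqP; rewrite -[_ == _]/(row_free (col_mx (b - a) (c - a))).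
apply: inj_row_free => v.
rewrite -[v]hsubmxK mul_row_col.
rewrite [lsubmx v]mx11_scalar [rsubmx v]mx11_scalar !mul_scalar_mx.
set s := lsubmx v 0 0; set t := rsubmx v 0 0 => hst.
have hs : s = 0.
  have : cross (s *: (b - a) + t *: (c - a)) (c - a) = s *: cross (b - a) (c - a).
    by apply: vec_ext; rewrite !vecE; ring.
  by rewrite hst cross0l => /esym/eqP; rewrite scaler_eq0 (negPf h) orbF => /eqP.
have ht : t = 0.
  move: hst; rewrite hs scale0r add0r => /eqP; rewrite scaler_eq0.
  by rewrite (negPf (cross_neq0_r h)) orbF => /eqP.
by rewrite hs ht !raddf0 row_mx0.
Qed.

Lemma det3_free (x y z : pt) (s t r : R) : det3 x y z != 0 ->
  s *: x + (t *: y + r *: z) = 0 -> [/\ s = 0, t = 0 & r = 0].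
Proof.
move=> h hst.
have key w : s * dot x w + (t * dot y w + r * dot z w) = 0.
  by rewrite -!dotZl -!dotDl hst dot0l.
have e a : a * det3 x y z = 0 -> a = 0.
  by move=> /eqP; rewrite mulf_eq0 (negPf h) orbF => /eqP.
split; apply: e.
- by have := key (cross y z); rewrite dot_crossl dot_crossr !mulr0 !addr0.
- have := key (cross z x); rewrite dot_crossl dot_crossr !mulr0 addr0 add0r.
  by rewrite -/(det3 y z x) -det3C.
- have := key (cross x y); rewrite dot_crossl dot_crossr !mulr0 !add0r.
  by rewrite -/(det3 z x y) det3C.
Qed.

Lemma aff_indep4_det a b c d : det3 (b - a) (c - a) (d - a) != 0 -> aff_indep4 a b c d.
Proof.
rewrite /aff_indep4.
move: (b - a) (c - a) (d - a) => x y z h; apply/eqP.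
change (row_free (col_mx x (col_mx y z))).
apply: inj_row_free => v.
rewrite -(hsubmxK v) mul_row_col -(hsubmxK (rsubmx v)) mul_row_col.
rewrite [lsubmx v]mx11_scalar [lsubmx (rsubmx v)]mx11_scalar [rsubmx (rsubmx v)]mx11_scalar.
rewrite !mul_scalar_mx => /(det3_free h) [-> -> ->].
by rewrite !raddf0 !row_mx0.
Qed.

Lemma dot_proj u c x : dot c u = 0 -> dot c (proj u x) = dot c x.
Proof. by move=> h; rewrite /proj dotBr dotZr h mulr0 subr0. Qed.

Lemma projD u x y : proj u (x + y) = proj u x + proj u y.
Proof.
rewrite /proj dotDl mulrDl scalerDl opprD addrACA //.
Qed.
Lemma projZ u a x : proj u (a *: x) = a *: proj u x.
Proof. by rewrite /proj dotZl -mulrA -scalerA scalerBr. Qed.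
Lemma projB u x y : proj u (x - y) = proj u x - proj u y.
Proof. by rewrite projD -scaleN1r projZ scaleN1r. Qed.
Lemma proj_self u : u != 0 -> proj u u = 0.
Proof. by move=> /dot_gt0 h; rewrite /proj divff ?gt_eqF // scale1r subrr. Qed.
Lemma proj_eq0 u x : proj u x = 0 -> cross u x = 0.
Proof. by move=> /eqP; rewrite subr_eq0 => /eqP ->; rewrite crossZr crossvv scaler0. Qed.

End Vectors.

(** * Faces of a Minkowski sum *)


Section SmallPositive.
Variable R : realType.

Definition small_pos (P : R -> Prop) :=
  exists2 e : R, 0 < e & forall t, 0 < t -> t <= e -> P t.

Lemma small_posT (P : R -> Prop) : (forall t, 0 < t -> P t) -> small_pos P.
Proof. by move=> h; exists 1; rewrite ?ltr01 // => t t0 _; apply: h. Qed.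

Lemma small_pos_and (P Q : R -> Prop) :
  small_pos P -> small_pos Q -> small_pos (fun t => P t /\ Q t).
Proof.
move=> [e e0 he] [f f0 hf]; exists (Num.min e f); first by rewrite lt_min e0.
by move=> t t0; rewrite le_min => /andP[h1 h2]; split; [apply: he | apply: hf].
Qed.

Lemma small_pos_seq (T : eqType) (s : seq T) (P : T -> R -> Prop) :
  (forall x, x \in s -> small_pos (P x)) ->
  small_pos (fun t => forall x, x \in s -> P x t).
Proof.
elim: s => [|x s ih] h; first exact: small_posT.
have hx := h x (mem_head _ _).
have hs : small_pos (fun t => forall y, y \in s -> P y t).
  by apply: ih => y ys; apply: h; rewrite inE ys orbT.
have [e e0 he] := small_pos_and hx hs; exists e => // t t0 te.
by have [h1 h2] := he t t0 te => y; rewrite inE => /orP[/eqP->|/h2].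
Qed.

Lemma small_pos_ex (P : R -> Prop) : small_pos P -> exists2 t, 0 < t & P t.
Proof. by move=> [e e0 he]; exists e => //; apply: he. Qed.

(** For [t <= 1] both perturbing terms together are at most [t * (|b| + |c|)] in size; the 1 in [M]
    keeps the denominator positive. *)
Lemma small_pos_quadratic (a b c : R) :
  0 < a -> small_pos (fun t => 0 < a + t * b + t ^+ 2 * c).
Proof.
move=> a0; set M := `|b| + `|c| + 1.
have M0 : 0 < M by rewrite /M; have := normr_ge0 b; have := normr_ge0 c; lra.
exists (Num.min 1 (a / (2 * M))).
  by rewrite lt_min ltr01 divr_gt0 // mulr_gt0.
move=> t t0; rewrite le_min => /andP[t1]; rewrite ler_pdivlMr ?mulr_gt0 // => tM.
have hb : - (t * `|b|) <= t * b by rewrite -mulrN ler_pM2l //; have := ler_norm (- b); rewrite normrN; lra.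
have hc : - (t * `|c|) <= t ^+ 2 * c.
  apply: (@le_trans _ _ (- (t ^+ 2 * `|c|))).
    by rewrite lerN2 ler_wpM2r // expr2 ler_piMl // ltW.
  by rewrite -mulrN ler_pM2l ?exprn_gt0 //; have := ler_norm (- c); rewrite normrN; lra.
have : t * M = t * `|b| + t * `|c| + t by rewrite /M; ring.
have : t * (2 * M) = 2 * (t * M) by ring.
nra.
Qed.

End SmallPositive.

(** * Maximisers of a functional on a convex hull *)

Section Convex.
Variable R : realType.
Notation pt := 'rV[R]_3.

Lemma conv_mem (V : seq pt) v : v \in V -> conv V v.
Proof.
rewrite -index_mem => hi; exists (fun j => (j == Ordinal hi)%:R); split => [i|].
  exact: ler0n.
split; first by rewrite (bigD1 (Ordinal hi)) //= eqxx big1 ?addr0 // => i /negPf ->.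
rewrite (bigD1 (Ordinal hi)) //= eqxx scale1r nth_index ?addr0 -?index_mem //.
by rewrite big1 ?addr0 // => i /negPf ->; rewrite scale0r.
Qed.

Lemma conv_dot_le (V : seq pt) c m x : conv V x ->
  (forall v, v \in V -> dot c v <= m) -> dot c x <= m.
Proof.
move=> [l [l0 [l1 ->]]] h; rewrite dot_sumr -[m]mul1r -l1 mulr_suml.
by apply: ler_sum => i _; rewrite dotZr ler_wpM2l // h // mem_nth.
Qed.

(** The gaps to the maximum [m], weighted by [l], are nonnegative and sum to zero, so each
    vanishes. *)
Lemma conv_face_support (V : seq pt) c m (l : 'I_(size V) -> R) :
  (forall v, v \in V -> dot c v <= m) ->
  (forall i, 0 <= l i) -> \sum_i l i = 1 -> dot c (\sum_i l i *: V`_i) = m ->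
  forall i, l i != 0 -> dot c V`_i = m.
Proof.
move=> h l0 l1 e i li.
have hz : \sum_i l i * (m - dot c V`_i) = 0.
  under eq_bigr do rewrite mulrBr -dotZr.
  by rewrite big_split /= sumrN -dot_sumr e -mulr_suml l1 mul1r subrr.
have := psumr_eq0P _ hz; move=> /(_ _ i isT) => H.
have : l i * (m - dot c V`_i) = 0.
  by apply: H => j _; rewrite mulr_ge0 // subr_ge0 h // mem_nth.
by move=> /eqP; rewrite mulf_eq0 (negPf li) /= subr_eq0 => /eqP.
Qed.

End Convex.

(** * Minkowski sums through the maximisers on each summand *)

Section Minkowski.
Variable R : realType.
(* [U] is the disjoint union of the vertex sets of the summands, indexed by [I]. *)
Variables (U I : finType) (own : U -> I).
Hypothesis own_surj : forall i, exists x, own x = i.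
Notation pt := 'rV[R]_3.
Implicit Types (pos : U -> pt) (c d : pt).

Section OnePos.
Variable pos : U -> pt.

(* [top c] encodes the face in direction [c]: its part in each summand is the face of that summand. *)
Definition top c : {set U} :=
  locked [set x | [forall y, (own y == own x) ==> (dot c (pos y) <= dot c (pos x))]].

Lemma topP c x :
  reflect (forall y, own y = own x -> dot c (pos y) <= dot c (pos x)) (x \in top c).
Proof.
rewrite /top -lock inE; apply: (iffP forallP) => h y; first by move=> e; have := h y; rewrite e eqxx.
by apply/implyP => /eqP; apply: h.
Qed.

Lemma top_ex c i : exists2 x, x \in top c & own x = i.
Proof.
have [x0 h0] := own_surj i.
have [x /eqP hx hm] := @arg_maxP _ _ _ x0 (fun x => own x == i) (fun x => dot c (pos x)) (introT eqP h0).
by exists x => //; apply/topP => y; rewrite hx => /eqP; apply: hm.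
Qed.

Lemma top_eq c x y : x \in top c -> y \in top c -> own x = own y ->
  dot c (pos x) = dot c (pos y).
Proof.
move=> /topP hx /topP hy e; apply/eqP; rewrite eq_le hx // hy //.
Qed.

Lemma top_tie c x y : x \in top c -> own x = own y -> dot c (pos x) = dot c (pos y) ->
  y \in top c.
Proof. by move=> /topP hx e e'; apply/topP => z hz; rewrite -e' hx // hz. Qed.

Lemma notin_top_lt c x y : x \in top c -> y \notin top c -> own x = own y ->
  dot c (pos y) < dot c (pos x).
Proof.
move=> hx hy e; rewrite lt_neqAle; move/topP: (hx) => -> //; rewrite andbT.
by apply: contraNneq hy => h; apply: top_tie hx e _.
Qed.

Lemma top0 : top 0 = setT.
Proof. by apply/setP => x; rewrite inE; apply/topP => y _; rewrite !dot0l. Qed.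

Lemma topZ (a : R) c : 0 < a -> top (a *: c) = top c.
Proof.
move=> a0; apply/setP => x; apply/topP/topP => h y /h; by rewrite !dotZl ler_pM2l.
Qed.

Lemma top_card c : (#|I| <= #|top c|)%N.
Proof.
have -> : #|I| = #|[set own x | x in top c]|.
  rewrite -cardsT; congr #|pred_of_set _|; apply/setP => i; rewrite inE.
  by have [x xt <-] := top_ex c i; rewrite imset_f.
exact: leq_imset_card.
Qed.

Lemma top_card_fiber c x y : #|top c| = #|I| -> x \in top c -> y \in top c ->
  own x = own y -> x = y.
Proof.
move=> h xt yt; suff inj : {in top c &, injective own} by apply: inj.
apply/imset_injP; rewrite eqn_leq leq_imset_card h -cardsT.
apply: subset_leq_card; apply/subsetP => i _.
by have [z zt <-] := top_ex c i; rewrite imset_f.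
Qed.

(** A small tilt refines [top c] lexicographically: strict inequalities for [c] survive it, and ties
    are decided by [d]. Later proofs find subfaces by a suitable choice of [d]. *)
Lemma top_perturb c d : exists2 e, 0 < e &
  top (c + e *: d) = [set x in top c |
    [forall y in top c, (own y == own x) ==> (dot d (pos y) <= dot d (pos x))]].
Proof.
have : small_pos (fun e : R => forall p : U * U, p \in enum [set: U * U] ->
   dot c (pos p.1) < dot c (pos p.2) ->
   dot (c + e *: d) (pos p.1) < dot (c + e *: d) (pos p.2)).
  apply: small_pos_seq => -[x y] _ /=.
  have [h|h] := boolP (dot c (pos x) < dot c (pos y)); last exact: small_posT.
  have h0 : 0 < dot c (pos y) - dot c (pos x) by rewrite subr_gt0.
  have [e e0 he] := small_pos_quadratic (dot d (pos y) - dot d (pos x)) 0 h0.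
  exists e => // t t0 te _; have := he t t0 te.
  rewrite !dotDl !dotZl; lra.
move=> /small_pos_ex[e e0 he]; exists e => //.
have {}he x y : dot c (pos x) < dot c (pos y) ->
   dot (c + e *: d) (pos x) < dot (c + e *: d) (pos y).
  by apply: (he (x, y)); rewrite mem_enum inE.
apply/setP => x; rewrite inE; apply/idP/andP => [/topP hx | [xt hy]].
  have xt : x \in top c.
    apply/topP => y /hx; rewrite leNgt => h; rewrite leNgt; apply: contra h; exact: he.
  split=> //; apply/forallP => y; apply/implyP => yt; apply/implyP => /eqP eo.
  by have := hx _ eo; rewrite !dotDl !dotZl (top_eq yt xt eo) lerD2l ler_pM2l.
apply/topP => y eo; have [yt|yt] := boolP (y \in top c).
  move/forallP/(_ y): hy; rewrite yt eo eqxx /= => hd.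
  by rewrite !dotDl !dotZl (top_eq yt xt eo) lerD2l ler_pM2l.
by apply/ltW/he; apply: notin_top_lt.
Qed.

Lemma top_add c d : (forall i, exists x, [/\ x \in top c, x \in top d & own x = i]) ->
  top (c + d) = top c :&: top d.
Proof.
move=> h; apply/setP => x; rewrite inE; apply/idP/andP => [/topP hx | [/topP hc /topP hd]].
  have [y [yc yd eo]] := h (own x).
  have h1 := hx y eo; rewrite !dotDl in h1.
  move/topP/(_ x (esym eo)): (yc) => h2; move/topP/(_ x (esym eo)): (yd) => h3.
  have e1 : dot c (pos y) = dot c (pos x) by lra.
  have e2 : dot d (pos y) = dot d (pos x) by lra.
  by split; [apply: top_tie yc eo e1 | apply: top_tie yd eo e2].
by apply/topP => y e; rewrite !dotDl lerD // ?hc ?hd.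
Qed.

Definition in_cone c d z :=
  exists a b : R, [/\ 0 <= a, 0 <= b, 0 < a + b & z = a *: c + b *: d].

Lemma in_cone_l c d : in_cone c d c.
Proof. by exists 1, 0; rewrite scale1r scale0r !addr0; split. Qed.
Lemma in_cone_r c d : in_cone c d d.
Proof. by exists 0, 1; rewrite scale1r scale0r !add0r; split. Qed.

Lemma in_cone_trans c d c' d' z :
  in_cone c d c' -> in_cone c d d' -> in_cone c' d' z -> in_cone c d z.
Proof.
move=> [a [b [a0 b0 ab ->]]] [a' [b' [a0' b0' ab' ->]]] [p [q [p0 q0 pq ->]]].
exists (p * a + q * a'), (p * b + q * b'); split.
- by rewrite addr_ge0 ?mulr_ge0.
- by rewrite addr_ge0 ?mulr_ge0.
- have -> : p * a + q * a' + (p * b + q * b') = p * (a + b) + q * (a' + b') by ring.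
  have [p1|p1] := ltP 0 p.
    by rewrite ltr_wpDr ?mulr_gt0 ?mulr_ge0 // ltW.
  by rewrite ltr_wpDl ?mulr_gt0 ?mulr_ge0 ?(ltW ab) //; lra.
- by rewrite !scalerDr !scalerDl !scalerA addrACA.
Qed.

(** Pairs whose wall, the plane of functionals on which they tie, lies strictly between [c] and [d];
    their number is the induction measure of [top_path]. *)
Definition separated c d : {set U * U} :=
  [set p | (own p.1 == own p.2) &&
           (dot c (pos p.1 - pos p.2) * dot d (pos p.1 - pos p.2) < 0)].

(** A discrete walk from [c] to [d] through comparable faces. If no wall separates them, the face of
    [c + d] lies in both faces; otherwise a functional [z] of the cone on one of the walls splits
    the walk into two walks with fewer walls. *)
Lemma top_path (Q : pt -> Prop) c d :
  (forall z z', in_cone c d z -> in_cone c d z' -> top z \subset top z' -> (Q z <-> Q z')) ->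
  Q c <-> Q d.
Proof.
move: {2}#|_| (leqnn #|separated c d|) => m; elim: m c d => [|m ih] c d hm hQ.
  have hsum e f : separated e f = set0 -> top (e + f) \subset top e.
    move=> h0; apply/subsetP => x /topP hx; apply/topP => y hy.
    rewrite leNgt; apply/negP => hlt.
    have := in_set0 (x, y); rewrite -h0 inE /= hy eqxx /= => /negP; apply.
    have := hx y hy; rewrite !dotDl !dotBr => h; nra.
  have h0 : separated c d = set0 by apply/eqP; rewrite -cards_eq0 -leqn0.
  have h0' : separated d c = set0.
    by rewrite -h0; apply/setP => p; rewrite !inE mulrC.
  have hz : in_cone c d (c + d) by exists 1, 1; rewrite !scale1r; split => //; lra.
  have h1 := hQ _ _ hz (in_cone_l _ _) (hsum _ _ h0).
  have h2 := hQ _ _ hz (in_cone_r _ _).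
  rewrite addrC in h2 hz *; have {}h2 := h2 (hsum _ _ h0').
  by move: h1; rewrite addrC => h1; split => h; [apply/h2/h1 | apply/h1/h2].
have [h0|[[x y]]] := set_0Vmem (separated c d).
  by apply: ih => //; rewrite h0 cards0.
rewrite inE /= => /andP[/eqP eo hlt].
set a := dot c _ in hlt *; set b := dot d _ in hlt *.
have ha : 0 < `|a| by rewrite normr_gt0; apply: contraTneq hlt => ->; rewrite mul0r ltxx.
have hb : 0 < `|b| by rewrite normr_gt0; apply: contraTneq hlt => ->; rewrite mulr0 ltxx.
(* These weights make [x] and [y] tie, since [a] and [b] have opposite signs. *)
pose z := `|b| *: c + `|a| *: d.
have zc : in_cone c d z.
  by exists `|b|, `|a|; split => //; try exact: ltW; apply: addr_gt0.
have z0 : dot z (pos x - pos y) = 0.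
  rewrite dotDl !dotZl -/a -/b.
  have [a0|a0] := leP 0 a.
    have b0 : b < 0 by nra.
    by rewrite (ltr0_norm b0) (ger0_norm a0); ring.
  have b0 : 0 < b by nra.
  by rewrite (ltr0_norm a0) (gtr0_norm b0); ring.
have xy : (x, y) \in separated c d by rewrite inE /= eo eqxx.
have ltm (S : {set U * U}) : S \subset separated c d -> (x, y) \notin S -> (#|S| <= m)%N.
  move=> hS hn; rewrite -ltnS; apply: leq_trans hm; apply: proper_card.
  by apply/properP; split => //; exists (x, y).
have h1 : (#|separated c z| <= m)%N.
  apply: ltm; last by rewrite inE /= z0 mulr0 ltxx andbF.
  apply/subsetP => p; rewrite !inE => /andP[-> /=].
  by rewrite dotDl !dotZl => h; have := sqr_ge0 (dot c (pos p.1 - pos p.2)); nra.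
have h2 : (#|separated z d| <= m)%N.
  apply: ltm; last by rewrite inE /= z0 mul0r ltxx andbF.
  apply/subsetP => p; rewrite !inE => /andP[-> /=].
  by rewrite dotDl !dotZl => h; have := sqr_ge0 (dot d (pos p.1 - pos p.2)); nra.
have q1 : Q c <-> Q z.
  apply: ih h1 _ => v w hv hw; apply: hQ.
    exact: in_cone_trans (in_cone_l _ _) zc hv.
  exact: in_cone_trans (in_cone_l _ _) zc hw.
have q2 : Q z <-> Q d.
  apply: ih h2 _ => v w hv hw; apply: hQ.
    exact: in_cone_trans zc (in_cone_r _ _) hv.
  exact: in_cone_trans zc (in_cone_r _ _) hw.
by split => h; [apply/q2/q1 | apply/q1/q2].
Qed.

Definition sel (s : {ffun I -> U}) := [forall i, own (s i) == i].
Definition vsum (s : {ffun I -> U}) : pt := \sum_i pos (s i).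
Definition minkowski_vertices : seq pt := [seq vsum s | s <- enum sel].
Definition minkowski : set pt := conv minkowski_vertices.

Lemma selP (s : {ffun I -> U}) : reflect (forall i, own (s i) = i) (sel s).
Proof. by apply: (iffP forallP) => h i; apply/eqP. Qed.

Lemma minkowski_vertex (j : 'I_(size minkowski_vertices)) :
  exists2 s, sel s & minkowski_vertices`_j = vsum s.
Proof.
have : minkowski_vertices`_j \in minkowski_vertices by apply: mem_nth.
by move=> /mapP[s]; rewrite mem_enum => hs ->; exists s.
Qed.

Lemma minkowski_vsum s : sel s -> minkowski (vsum s).
Proof. by move=> hs; apply: conv_mem; apply: map_f; rewrite mem_enum. Qed.

Lemma sel_through c x : x \in top c ->
  exists s, [/\ sel s, forall i, s i \in top c & s (own x) = x].
Proof.
move=> xt; have hE i : exists y, (y \in top c) && (own y == i).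
  by have [y yt /eqP e] := top_ex c i; exists y; rewrite yt.
pose f i := if own x == i then x else xchoose (hE i).
have hf i : (f i \in top c) /\ own (f i) = i.
  rewrite /f; case: eqP => [//|_].
  by have /andP[h1 /eqP h2] := xchooseP (hE i).
exists [ffun i => f i]; split.
- by apply/selP => i; rewrite ffunE; case: (hf i).
- by move=> i; rewrite ffunE; case: (hf i).
- by rewrite ffunE /f eqxx.
Qed.

Lemma sel_top c : exists2 s, sel s & forall i, s i \in top c.
Proof.
have [i|h] := pickP (fun _ : I => true).
  by have [x xt _] := top_ex c i => _; have [s [h1 h2 _]] := sel_through xt; exists s.
(* Without summands the selection is the empty function. *)
have hE : forall i : I, exists x : U, false by move=> i; have := h i.
exists [ffun i => xchoose (hE i)]; first by apply/selP => i; have := h i.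
by move=> i; have := h i.
Qed.

Lemma dot_vsum_le c s s' : sel s -> sel s' -> (forall i, s' i \in top c) ->
  dot c (vsum s) <= dot c (vsum s').
Proof.
move=> /selP hs /selP hs' ht; rewrite !dot_sumr; apply: ler_sum => i _.
by move/topP: (ht i); apply; rewrite hs hs'.
Qed.

Lemma dot_vsum_eq c s s' : sel s -> sel s' -> (forall i, s' i \in top c) ->
  dot c (vsum s) = dot c (vsum s') -> forall i, s i \in top c.
Proof.
move=> hs hs' ht e i.
have /selP hs1 := hs; have /selP hs1' := hs'.
apply: top_tie (ht i) _ _; first by rewrite hs1 hs1'.
apply/eqP; rewrite eq_le; apply/andP; split; last by move/topP: (ht i); apply; rewrite hs1 hs1'.
rewrite -subr_le0.
have : \sum_j (dot c (pos (s' j)) - dot c (pos (s j))) = 0.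
  by rewrite big_split /= sumrN -!dot_sumr -/(vsum s) -/(vsum s') e subrr.
rewrite (bigD1 i) //=; set S := \sum_(_ | _) _.
have : 0 <= S.
  apply: sumr_ge0 => j _; rewrite subr_ge0; move/topP: (ht j); apply.
  by rewrite hs1 hs1'.
lra.
Qed.

Lemma minkowski_dot_le c s x : sel s -> (forall i, s i \in top c) -> minkowski x ->
  dot c x <= dot c (vsum s).
Proof.
move=> hs ht hx; apply: conv_dot_le hx _ => v /mapP[s']; rewrite mem_enum => hs' ->.
exact: dot_vsum_le.
Qed.

Lemma face_dirP c s x : sel s -> (forall i, s i \in top c) ->
  face_of_dir minkowski c x <-> minkowski x /\ dot c x = dot c (vsum s).
Proof.
move=> hs ht; split=> [[hx h]|[hx h]]; split=> //.
  by apply/eqP; rewrite eq_le h ?minkowski_dot_le //; apply: minkowski_vsum.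
by move=> y hy; rewrite h; apply: minkowski_dot_le.
Qed.

Lemma face_dir_vsum c s : sel s ->
  face_of_dir minkowski c (vsum s) <-> forall i, s i \in top c.
Proof.
move=> hs; have [s' hs' ht'] := sel_top c; rewrite (face_dirP _ hs' ht'); split.
  by move=> [_ e]; apply: dot_vsum_eq hs hs' ht' e.
move=> ht; split; first exact: minkowski_vsum.
by apply/eqP; rewrite eq_le !dot_vsum_le.
Qed.

Lemma face_dir_support c x : face_of_dir minkowski c x ->
  exists l : 'I_(size minkowski_vertices) -> R,
   [/\ forall i, 0 <= l i, \sum_i l i = 1, x = \sum_i l i *: minkowski_vertices`_i &
   forall i s, l i != 0 -> sel s -> minkowski_vertices`_i = vsum s ->
     forall j, s j \in top c].
Proof.
have [s' hs' ht'] := sel_top c; rewrite (face_dirP _ hs' ht').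
move=> [[l [l0 [l1 ex]]] e]; exists l; split => // i s li hs hi.
apply: (dot_vsum_eq hs hs' ht'); rewrite -hi.
have hV v : v \in minkowski_vertices -> dot c v <= dot c (vsum s').
  by move=> /mapP[s1]; rewrite mem_enum => h1 ->; exact: (dot_vsum_le h1 hs' ht').
by apply: (conv_face_support hV l0 l1 _ li); rewrite -ex.
Qed.

(** This replaces the face lattice by finite sets. An element of [top c] extends to a selection
    inside [top c], whose sum lies in the face; conversely, a point of the face is a combination of
    selections inside [top c] only. *)
Lemma face_dir_subset c d :
  (face_of_dir minkowski c `<=` face_of_dir minkowski d)%classic <-> top c \subset top d.
Proof.
split=> h.
  apply/subsetP => x /sel_through[s [hs ht <-]].
  by have /h/(face_dir_vsum _ hs) := (face_dir_vsum c hs).2 ht.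
move=> x hx; have [l [l0 l1 ex hl]] := face_dir_support hx.
have [s' hs' ht'] := sel_top d; apply/(face_dirP _ hs' ht').
split; first by exists l.
rewrite ex dot_sumr -[RHS]mul1r -l1 mulr_suml; apply: eq_bigr => i _.
rewrite dotZr; have [->|li] := eqVneq (l i) 0; first by rewrite !mul0r.
have [s hs es] := minkowski_vertex i; rewrite es; congr (_ * _).
have hd j : s j \in top d by apply: (subsetP h); apply: hl es j.
by apply/eqP; rewrite eq_le !dot_vsum_le.
Qed.

Lemma face_dir_single c s x : #|top c| = #|I| -> sel s -> (forall i, s i \in top c) ->
  face_of_dir minkowski c x -> x = vsum s.
Proof.
move=> hc hs ht /face_dir_support[l [l0 l1 -> hl]].
rewrite -[RHS]scale1r -l1 scaler_suml; apply: eq_bigr => i _.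
have [->|li] := eqVneq (l i) 0; first by rewrite !scale0r.
have [s' hs' es] := minkowski_vertex i; rewrite es; congr (_ *: vsum _).
apply/ffunP => j; apply: (top_card_fiber hc) => //; first exact: (hl i).
by move/selP: (hs') => ->; move/selP: hs => ->.
Qed.

Lemma face_dir_nonempty c : exists x, face_of_dir minkowski c x.
Proof.
by have [s hs ht] := sel_top c; exists (vsum s); apply/face_dir_vsum.
Qed.

End OnePos.
End Minkowski.

(** * Generic summands: edges and zones *)


Section Generic.
Variable R : realType.
Variables (U I : finType) (own : U -> I).
Hypothesis own_surj : forall i, exists x, own x = i.
Notation pt := 'rV[R]_3.
Notation top := (top own).
Implicit Types c d e : pt.

(* [pos x - pos y] is then an edge direction, and [[set x; y]] labels its zone. *)
Definition lab x y := (own x == own y) && (x != y).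

(** For nonzero [c] the excess of [#|top pos c|] over [#|I|] is the dimension of the face: 0 for a
    vertex, 1 for an edge, 2 for a facet, which is then a parallelogram or a triangle. The sign of
    [a] in [generic_facet] matters because an edge of a triangle is maximal on one side only. *)
Record generic (pos : U -> pt) : Prop := Generic {
  generic_full : forall c, top pos c = setT -> c = 0;
  generic_card : forall c, c != 0 -> (#|top pos c| <= #|I|.+2)%N;
  generic_lab : forall x y, lab x y -> exists z w, lab z w /\ [set x; y] != [set z; w];
  generic_cross : forall x y z w, lab x y -> lab z w -> [set x; y] != [set z; w] ->
    cross (pos x - pos y) (pos z - pos w) != 0;
  generic_facet : forall x y z w, lab x y -> lab z w -> [set x; y] != [set z; w] ->
    exists2 a : R, a != 0 & [set x; y; z; w] \subset
      top pos (a *: cross (pos x - pos y) (pos z - pos w)) }.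

Lemma lab_sym x y : lab x y = lab y x.
Proof. by rewrite /lab eq_sym [x == y]eq_sym. Qed.

Lemma collision (S : {set U}) : (#|[set own x | x in S]| < #|S|)%N ->
  exists x y, [/\ lab x y, x \in S & y \in S].
Proof.
move=> h; apply: contrapT => hn.
have /imset_injP : {in S &, injective own}.
  move=> x y xS yS e; apply: contrapT => /eqP xy; apply: hn; exists x, y.
  by rewrite /lab e eqxx xy.
by move=> /eqP e; rewrite e ltnn in h.
Qed.

Section OnePos.
Variable pos : U -> pt.
Hypothesis gen : generic pos.
Notation T := (top pos).

Lemma proper_neq0 c : (T c != setT) = (c != 0).
Proof.
congr (~~ _); apply/eqP/eqP => [/(generic_full gen) //|->]; exact: top0.
Qed.

(** A lower bound for the excess: when each vertex of [D] has a substitute outside [D], the rest of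
    [T c] still meets every summand. *)
Lemma top_card_removed c (D : {set U}) : D \subset T c ->
  (forall v, v \in D -> exists2 v', v' \in T c :\: D & own v' = own v) ->
  (#|I| + #|D| <= #|T c|)%N.
Proof.
move=> DT hD; rewrite -(cardsID D (T c)) (setIidPr DT) addnC leq_add2l.
have -> : #|I| = #|[set own x | x in T c :\: D]|.
  rewrite -cardsT; congr #|pred_of_set _|; apply/setP => i; rewrite inE; symmetry.
  have [x xt <-] := top_ex own_surj pos c i.
  have [/hD[v' hv' <-]|xD] := boolP (x \in D); first exact: imset_f.
  by apply: imset_f; rewrite inE xD xt.
exact: leq_imset_card.
Qed.

Lemma top_card_lab c x y : lab x y -> x \in T c -> y \in T c -> (#|I| < #|T c|)%N.
Proof.
move=> /andP[/eqP eo xy] xt yt; rewrite -addn1 -(cards1 y); apply: top_card_removed.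
  by rewrite sub1set.
by move=> v /set1P ->; exists x => //; rewrite !inE xy.
Qed.

Lemma top_card_two_lab c x y z w : lab x y -> lab z w -> [set x; y] != [set z; w] ->
  x \in T c -> y \in T c -> z \in T c -> w \in T c -> (#|I|.+2 <= #|T c|)%N.
Proof.
wlog zn : z w / z \notin [set x; y].
  move=> hw lxy lzw ne xt yt zt wt.
  have [zi|zn] := boolP (z \in [set x; y]); last exact: (hw z w).
  have [wi|wn] := boolP (w \in [set x; y]).
    case/negP: ne; rewrite eq_sym eqEcard; apply/andP; split.
      by apply/subsetP => v /set2P[] ->.
    by rewrite !cards2; case/andP: lzw => _ ->; case/andP: lxy => _ ->.
  by apply: (hw w z) => //; rewrite 1?lab_sym // [in [set w; z]]setUC.
move=> /andP[/eqP exy xy] /andP[/eqP ezw zw] ne xt yt zt wt.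
move: zn; rewrite !inE negb_or => /andP[zx zy].
rewrite -addn2 (_ : 2%N = #|[set y; z]|); last by rewrite cards2 eq_sym zy.
apply: top_card_removed; first by apply/subsetP => v /set2P[] ->.
have hx : x \in T c :\: [set y; z] by rewrite !inE negb_or xy eq_sym zx xt.
move=> v /set2P[] ->; first by exists x.
have [wy|wy] := eqVneq w y; first by exists x; rewrite // exy -wy.
by exists w => //; rewrite !inE negb_or wy eq_sym zw wt.
Qed.

Definition edge c := #|T c| == #|I|.+1.

Lemma edge_neq0 c : edge c -> c != 0.
Proof.
move=> /eqP h; apply/eqP => c0; move: h; rewrite c0 top0 => h.
have [x [y [lxy _ _]]] : exists x y, [/\ lab x y, x \in [set: U] & y \in [set: U]].
  by apply: collision; rewrite h ltnS max_card.
have [z [w [lzw ne]]] := generic_lab gen lxy.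
have := @top_card_two_lab 0 x y z w lxy lzw ne.
by rewrite top0 !inE h ltnn => /(_ isT isT isT isT).
Qed.

Lemma edge_lab_uniq c x y z w : edge c -> lab x y -> lab z w ->
  x \in T c -> y \in T c -> z \in T c -> w \in T c -> [set x; y] = [set z; w].
Proof.
move=> /eqP h lxy lzw xt yt zt wt; apply: contrapT => /eqP ne.
by have := top_card_two_lab lxy lzw ne xt yt zt wt; rewrite h ltnn.
Qed.

Lemma edge_lab c : edge c -> exists x y, [/\ lab x y, x \in T c & y \in T c].
Proof. by move=> /eqP h; apply: collision; rewrite h ltnS max_card. Qed.

Lemma lab_pos_neq x y : lab x y -> pos x - pos y != 0.
Proof.
move=> lxy; have [z [w [lzw ne]]] := generic_lab gen lxy.
exact: cross_neq0_l (generic_cross gen lxy lzw ne).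
Qed.

Lemma edge_vertex c : edge c -> exists2 d, T d \proper T c & d != 0.
Proof.
move=> he; have [x [y [lxy xt yt]]] := edge_lab he.
have [e e0 h] := top_perturb own pos c (pos x - pos y).
have hs : T (c + e *: (pos x - pos y)) \proper T c.
  apply/properP; split; first by rewrite h; apply/subsetP => v; rewrite inE => /andP[].
  exists y => //; rewrite h inE yt /=; apply/negP => /forallP/(_ x).
  rewrite xt /=; case/andP: (lxy) => /eqP -> _; rewrite eqxx /= => hle.
  by have := dot_gt0 (lab_pos_neq lxy); rewrite dotBr; lra.
exists (c + e *: (pos x - pos y)) => //; rewrite -proper_neq0.
by apply: contraTneq hs => ->; rewrite properE subsetT andbF.
Qed.

Lemma facet_remove c x y z w : c != 0 -> lab x y -> lab z w ->
  x \in T c -> y \in T c -> z \in T c -> w \in T c -> z \notin [set x; y] ->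
  exists2 e, T e = T c :\ z & edge e.
Proof.
move=> c0 lxy lzw xt yt zt wt zn.
have ne : [set x; y] != [set z; w] by apply: contraNneq zn => ->; rewrite set21.
have hT : #|T c| = #|I|.+2.
  by apply/eqP; rewrite eqn_leq generic_card //= (top_card_two_lab lxy lzw).
have /andP[/eqP exy xy] := lxy; have /andP[/eqP ezw zw] := lzw.
move: (zn); rewrite !inE negb_or => /andP[zx zy].
(* A further vertex [u] in this summand would raise the excess to three. *)
have hfib u : u \in T c -> own u = own x -> u \notin [set x; y] -> u = z.
  move=> ut eu; rewrite !inE negb_or => /andP[ux uy]; apply: contrapT => /eqP uz.
  have hc : #|u |: [set y; z]| = 3%N.
    by rewrite cardsU1 cards2 !inE (negPf uy) (negPf uz) eq_sym zy.
  have hx : x \in T c :\: (u |: [set y; z]).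
    by rewrite !inE !negb_or eq_sym ux xy eq_sym zx xt.
  have : (#|I| + #|u |: [set y; z]| <= #|T c|)%N.
    apply: top_card_removed => [|v]; first by apply/subsetP => v; rewrite !inE => /or3P[] /eqP ->.
    rewrite !inE => /or3P[] /eqP ->; [by exists x | by exists x |].
    have [eo|eo] := eqVneq (own z) (own x); first by exists x.
    exists w => //; rewrite !inE !negb_or wt andbT [w == z]eq_sym zw andbT.
    by apply/andP; split; apply: contraNneq eo => ew; rewrite ezw ew ?eu ?exy.
  by rewrite hT hc addn3 ltnn.
pose p := pos x - pos y; pose q := pos w - pos z.
have pq : 0 < dot p p * dot q q - dot p q ^+ 2.
  rewrite -dot_cross_cross; apply: dot_gt0; rewrite /q -opprB crossNr oppr_eq0.
  exact: (generic_cross gen).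
(* Up to scaling this is the part of [q] orthogonal to [p]: the tilt keeps [x] and [y] tied and puts
   [z] below [w]. *)
pose d := dot p p *: q - dot p q *: p.
have dp : dot d (pos x) = dot d (pos y).
  apply/eqP; rewrite -subr_eq0 -dotBr -/p dotBl !dotZl [dot q p]dotC; apply/eqP; ring.
have dq : dot d (pos z) < dot d (pos w).
  by rewrite -subr_gt0 -dotBr -/q dotBl !dotZl; move: pq; rewrite expr2; lra.
have [e e0 h] := top_perturb own pos c d.
have hS v : v \in [set x; y] -> v \in T (c + e *: d).
  move=> hv; have vt : v \in T c by case/set2P: hv => ->.
  have ov : own v = own x by case/set2P: hv => ->.
  have dv : dot d (pos v) = dot d (pos x) by case/set2P: hv => ->.
  rewrite h inE vt /=; apply/forallP => u; apply/implyP => ut; apply/implyP => /eqP eu.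
  rewrite dv; have [/set2P[] -> //|un] := boolP (u \in [set x; y]); first by rewrite dp.
  have uz := hfib _ ut (etrans eu ov) un.
  have [/set2P[]wx|wn] := boolP (w \in [set x; y]).
  - by rewrite uz -wx ltW.
  - by rewrite uz dp -wx ltW.
  - by have wz := hfib _ wt (etrans (esym ezw) (etrans (congr1 own (esym uz)) (etrans eu ov))) wn; rewrite wz eqxx in zw.
have zS : z \notin T (c + e *: d).
  rewrite h inE zt /=; apply/negP => /forallP/(_ w); rewrite wt ezw eqxx /=.
  by rewrite leNgt dq.
have sub : T (c + e *: d) \subset T c :\ z.
  apply/subsetP => v vS; rewrite !inE; apply/andP; split.
    by apply: contraNneq zS => <-.
  by move: vS; rewrite h inE => /andP[].
have cz : #|T c :\ z| = #|I|.+1 by move: hT; rewrite (cardsD1 z) zt => -[].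
have ce : (#|I| < #|T (c + e *: d)|)%N.
  by apply: (top_card_lab lxy); apply: hS; rewrite ?set21 ?set22.
have eS : T (c + e *: d) = T c :\ z by apply/eqP; rewrite eqEcard sub cz.
by exists (c + e *: d) => //; rewrite /edge eS cz.
Qed.

Lemma facet_other_lab c x y : #|T c| = #|I|.+2 -> lab x y -> x \in T c -> y \in T c ->
  exists z w, [/\ lab z w, z \in T c, w \in T c & z \notin [set x; y]].
Proof.
move=> hT lxy xt yt.
have [z [w [lzw]]] : exists z w, [/\ lab z w, z \in T c :\ y & w \in T c :\ y].
  have hD : #|T c :\ y| = #|I|.+1 by move: hT; rewrite (cardsD1 y) yt add1n => -[].
  by apply: collision; rewrite hD ltnS max_card.
rewrite !inE => /andP[zy zt] /andP[wy wt].
have [zx|zx] := eqVneq z x; last by exists z, w; rewrite !inE negb_or zx.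
exists w, z; rewrite lab_sym !inE negb_or wy wt zt andbT; split=> //.
by rewrite -zx eq_sym; case/andP: lzw.
Qed.

Lemma lab_edge c x y : c != 0 -> lab x y -> x \in T c -> y \in T c ->
  exists e, [/\ edge e, T e \subset T c, x \in T e & y \in T e].
Proof.
move=> c0 lxy xt yt; have [he|he] := boolP (edge c); first by exists c.
have hT : #|T c| = #|I|.+2.
  apply/eqP; rewrite eqn_leq generic_card //=.
  by have := top_card_lab lxy xt yt; rewrite leq_eqVlt eq_sym -/(edge c) (negPf he).
have [z [w [lzw zt wt zn]]] := facet_other_lab hT lxy xt yt.
have [e eS ee] := facet_remove c0 lxy lzw xt yt zt wt zn.
exists e; rewrite eS subD1set !inE xt yt !andbT; split=> //.
  by apply: contraNneq zn => ->; rewrite set21.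
by apply: contraNneq zn => ->; rewrite set22.
Qed.

(** A common vertex would supply one common element per summand, and the shared label one more; then
    the two sets of size [#|I|.+1] would coincide. *)
Lemma common_lab_no_vertex e1 e2 x y : edge e1 -> edge e2 -> T e1 <> T e2 ->
  lab x y -> x \in T e1 -> y \in T e1 -> x \in T e2 -> y \in T e2 ->
  forall v, T v \subset T e1 -> T v \subset T e2 -> False.
Proof.
move=> /eqP h1 /eqP h2 ne lxy x1 y1 x2 y2 v v1 v2.
have hI : (#|I| < #|T e1 :&: T e2|)%N.
  rewrite (cardsD1 y) !inE y1 y2 /= ltnS.
  have -> : #|I| = #|[set own u | u in (T e1 :&: T e2) :\ y]|.
    rewrite -cardsT; congr #|pred_of_set _|; apply/setP => i; rewrite inE; symmetry.
    have [u ut <-] := top_ex own_surj pos v i; case/andP: lxy => /eqP eo xy.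
    have [->|uy] := eqVneq u y; first by rewrite -eo; apply: imset_f; rewrite !inE xy x1.
    by apply: imset_f; rewrite !inE uy (subsetP v1) // (subsetP v2).
  exact: leq_imset_card.
apply: ne; apply/eqP; rewrite eqEcard h1 h2 leqnn andbT.
have : T e1 :&: T e2 == T e1 by rewrite eqEcard subsetIl h1.
by move=> /eqP/setIidPl.
Qed.

(** By counting inside the facet, the two sets share at least [#|I|] elements. If these had distinct
    owners, the functional [e1 + e2] would select exactly them and define a common vertex. *)
Lemma no_vertex_common_lab c e1 e2 : c != 0 -> edge e1 -> edge e2 ->
  T e1 \subset T c -> T e2 \subset T c ->
  (forall v, T v \subset T e1 -> T v \subset T e2 -> False) ->
  exists x y, [/\ lab x y, x \in T e1 :&: T e2 & y \in T e1 :&: T e2].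
Proof.
move=> c0 /eqP h1 /eqP h2 s1 s2 hv; apply: collision.
have hU : (#|T e1 :|: T e2| <= #|I|.+2)%N.
  by apply: leq_trans (generic_card gen c0); apply: subset_leq_card; rewrite subUset s1.
have hI : (#|I| <= #|T e1 :&: T e2|)%N.
  by have := cardsUI (T e1) (T e2); rewrite h1 h2; move: hU; clear; lia.
apply: leq_trans hI; rewrite ltnNge; apply/negP => hge.
have hfull : [set own u | u in T e1 :&: T e2] = setT.
  by apply/eqP; rewrite eqEcard subsetT cardsT.
have eI : T (e1 + e2) = T e1 :&: T e2.
  apply: top_add => i; have : i \in [set: I] by rewrite inE.
  by rewrite -hfull => /imsetP[u]; rewrite inE => /andP[u1 u2] ->; exists u.
by apply: (hv (e1 + e2)); rewrite eI ?subsetIl ?subsetIr.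
Qed.

Lemma cone_top c d z x : in_cone c d z -> x \in T c -> x \in T d -> x \in T z.
Proof.
move=> [a [b [a0 b0 _ ->]]] /topP xc /topP xd; apply/topP => y e.
by rewrite !dotDl !dotZl lerD // ler_wpM2l // ?xc ?xd.
Qed.

(** [top_path] applies in the cone of [e1] and [e2], unless [e2] is a negative multiple of [e1] and
    the cone contains 0. In that case [x] and [y] make up their whole summand, and the walk goes
    through a functional orthogonal to [e1] and to the edge. *)
Lemma zone_connected (Q : pt -> Prop) x y e1 e2 : lab x y -> edge e1 -> edge e2 ->
  x \in T e1 -> y \in T e1 -> x \in T e2 -> y \in T e2 ->
  (forall z z', z != 0 -> z' != 0 -> x \in T z -> y \in T z ->
     T z \subset T z' -> (Q z <-> Q z')) ->
  Q e1 <-> Q e2.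
Proof.
move=> lxy h1 h2 x1 y1 x2 y2 hQ.
have indep c d : cross c d != 0 -> x \in T c -> y \in T c -> x \in T d -> y \in T d ->
    Q c <-> Q d.
  move=> hcd xc yc xd yd.
  have nz z : in_cone c d z -> z != 0.
    move=> [a [b [a0 b0 ab ez]]]; apply/eqP => z0; move: ez; rewrite z0 => ez.
    have ha : cross (a *: c + b *: d) d = a *: cross c d.
      by apply: vec_ext; rewrite !vecE; ring.
    have hb : cross c (a *: c + b *: d) = b *: cross c d.
      by apply: vec_ext; rewrite !vecE; ring.
    move: ha hb; rewrite -ez cross0l cross0r => /esym/eqP; rewrite scaler_eq0 (negPf hcd) orbF.
    move=> /eqP a1 /esym/eqP; rewrite scaler_eq0 (negPf hcd) orbF => /eqP b1.
    by rewrite a1 b1 addr0 ltxx in ab.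
  apply: (top_path (own := own) (pos := pos)) => z z' hz hz'.
  by apply: hQ; [exact: nz | exact: nz | apply: cone_top hz _ _ | apply: cone_top hz _ _].
have [hc|hc] := boolP (cross e1 e2 == 0); last exact: indep.
have e10 := edge_neq0 h1; have e20 := edge_neq0 h2.
have e2E := cross0_parallel e10 (eqP hc); set s := _ / _ in e2E.
have [s0|s0|s0] := ltgtP s 0; last by rewrite s0 scale0r in e2E; rewrite e2E eqxx in e20.
  (* A third vertex of the summand would lie below [x] for [e1], hence above it for [e2]. *)
  have fib z : own z = own x -> z \in [set x; y].
    move=> ez; apply: contraTT (x2) => zn.
    have zn1 : z \notin T e1.
      apply: contra zn => z1; have zx : lab z x || (z == x).
        by rewrite /lab ez eqxx /=; case: eqVneq.
      case/orP: zx => [lzx|/eqP ->]; last by rewrite set21.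
      by rewrite (edge_lab_uniq h1 lxy lzx) // set21.
    apply/negP => /topP/(_ z ez); rewrite e2E !dotZl.
    by have := notin_top_lt x1 zn1 (esym ez); nra.
  pose d := cross e1 (pos x - pos y).
  have op : dot e1 (pos x - pos y) = 0.
    by rewrite dotBr (top_eq x1 y1) ?subrr //; case/andP: lxy => /eqP.
  have d0 : d != 0.
    rewrite -dot_eq0 dot_cross_cross op expr0n /= subr0 mulf_neq0 ?dot_eq0 //.
    exact: lab_pos_neq.
  have hd : cross e1 d != 0.
    by rewrite -dot_eq0 dot_cross_cross /d dot_crossl expr0n /= subr0 mulf_neq0 ?dot_eq0.
  have dxy : dot d (pos x) = dot d (pos y).
    by apply/eqP; rewrite -subr_eq0 -dotBr dotC /d dot_crossr.
  have xd : x \in T d by apply/topP => z /fib /set2P[] ->; rewrite // dxy.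
  have yd : y \in T d by apply: top_tie xd _ dxy; case/andP: lxy => /eqP.
  have q1 := indep _ _ hd x1 y1 xd yd.
  have hd2 : cross d e2 != 0.
    by rewrite e2E crossZr scaler_eq0 negb_or lt_eqF //= crossN oppr_eq0.
  by have q2 := indep _ _ hd2 xd yd x2 y2; split => h; [apply/q2/q1 | apply/q1/q2].
by apply: hQ => //; rewrite e2E topZ.
Qed.

End OnePos.
End Generic.

(** * Isomorphisms of face lattices *)


Section Isomorphism.
Variable R : realType.
Variables (U I : finType) (own : U -> I).
Hypothesis own_surj : forall i, exists x, own x = i.
Notation pt := 'rV[R]_3.
Notation top := (top own).
Notation lab := (lab own).
Notation generic := (@generic R U I own).
Notation edge := (edge own).
Implicit Types (pos : U -> pt) (r : pt -> pt -> Prop) (c e : pt).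

(** Functionals stand for the nonempty faces. Many functionals define the same face, so an
    isomorphism becomes a relation rather than a function. *)
Record face_rel pos pos' r : Prop := FaceRel {
  rel_total : forall c, exists c', r c c';
  rel_onto : forall c', exists c, r c c';
  rel_sub : forall c1 c1' c2 c2', r c1 c1' -> r c2 c2' ->
    (top pos c1 \subset top pos c2) = (top pos' c1' \subset top pos' c2') }.

Lemma face_rel_sym pos pos' r : face_rel pos pos' r -> face_rel pos' pos (fun a b => r b a).
Proof. by move=> [h1 h2 h3]; split=> // *; symmetry; apply: h3. Qed.

Lemma rel_neq0 pos pos' r c c' : generic pos -> generic pos' -> face_rel pos pos' r ->
  r c c' -> (c != 0) = (c' != 0).
Proof.
have half p p' q a a' : generic p -> face_rel p p' q -> q a a' -> a' = 0 -> a = 0.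
  move=> gp fq qa a0; apply: (generic_full gp); apply/eqP; rewrite -subTset.
  have [z' hz] := rel_total fq 0.
  by rewrite -(top0 own p) (rel_sub fq hz qa) a0 top0 subsetT.
move=> gp gp' fr rc; congr (~~ _); apply/eqP/eqP; last exact: half gp fr rc.
exact: half gp' (face_rel_sym fr) rc.
Qed.

Section TwoPos.
Variables (pos pos' : U -> pt) (r : pt -> pt -> Prop).
Hypotheses (gen : generic pos) (fr : face_rel pos pos' r).
Notation T := (top pos).
Notation T' := (top pos').

Lemma rel_eq c1 c1' c2 c2' : r c1 c1' -> r c2 c2' -> T c1 = T c2 <-> T' c1' = T' c2'.
Proof.
move=> h1 h2; split=> /eqP; rewrite eqEsubset => /andP[s1 s2]; apply/eqP; rewrite eqEsubset.
  by rewrite -(rel_sub fr h1 h2) -(rel_sub fr h2 h1) s1.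
by rewrite (rel_sub fr h1 h2) (rel_sub fr h2 h1) s1.
Qed.

Lemma rel_proper c1 c1' c2 c2' : r c1 c1' -> r c2 c2' ->
  (T c1 \proper T c2) = (T' c1' \proper T' c2').
Proof. by move=> h1 h2; rewrite !properE (rel_sub fr h1 h2) (rel_sub fr h2 h1). Qed.

(** Dimension as length of chains: a facet properly contains an edge and an edge a vertex, and each
    proper inclusion costs at least one element on the other side as well. *)
Lemma rel_card_le c c' : c != 0 -> r c c' -> (#|T c| <= #|T' c'|)%N.
Proof.
move=> c0 rc.
have edge_gt e e' : edge pos e -> r e e' -> (#|I| < #|T' e'|)%N.
  move=> ee re; have [d dp d0] := edge_vertex gen ee.
  have [d' rd] := rel_total fr d.
  move: dp; rewrite (rel_proper rd re) => /proper_card; apply: leq_trans.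
  by rewrite ltnS; apply: top_card.
have := generic_card gen c0; rewrite leq_eqVlt => /orP[/eqP h2|].
  have [x [y [lxy xt yt]]] : exists x y, [/\ lab x y, x \in T c & y \in T c].
    by apply: collision; rewrite h2; apply: leq_trans (max_card _) _.
  have [e [ee es _ _]] := lab_edge own_surj gen c0 lxy xt yt.
  have [e' re] := rel_total fr e.
  have ep : T e \proper T c.
    by rewrite properEcard es (eqP ee) h2 /=.
  move: ep; rewrite (rel_proper re rc) => /proper_card; rewrite h2; apply: leq_trans.
  by rewrite ltnS (edge_gt e).
rewrite ltnS leq_eqVlt => /orP[/eqP h1|]; first by rewrite h1 (edge_gt c) // /edge h1.
by rewrite ltnS => h; apply: leq_trans h _; apply: top_card.
Qed.

End TwoPos.

Lemma rel_card pos pos' r c c' : generic pos -> generic pos' -> face_rel pos pos' r ->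
  c != 0 -> r c c' -> #|top pos c| = #|top pos' c'|.
Proof.
move=> g g' fr c0 rc; apply/eqP; rewrite eqn_leq (rel_card_le g fr) //=.
by apply: (rel_card_le g' (face_rel_sym fr)) => //; rewrite -(rel_neq0 g g' fr rc).
Qed.

Lemma rel_edge pos pos' r c c' : generic pos -> generic pos' -> face_rel pos pos' r ->
  r c c' -> edge pos c -> edge pos' c'.
Proof.
move=> g g' fr rc h; rewrite /edge -(rel_card g g' fr _ rc) //.
exact: edge_neq0 h.
Qed.

(* Inside a facet, parallel edges are the disjoint ones, and a zone is connected
   through facets; so an isomorphism carries zones to zones. *)
Lemma rel_zone pos pos' r x y x' y' e1 e1' e2 e2' :
  generic pos -> generic pos' -> face_rel pos pos' r ->
  r e1 e1' -> r e2 e2' -> edge pos e1 -> edge pos e2 -> lab x y -> lab x' y' ->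
  [set x; y] \subset top pos e1 -> [set x; y] \subset top pos e2 ->
  [set x'; y'] \subset top pos' e1' -> [set x'; y'] \subset top pos' e2'.
Proof.
move=> g g' fr r1 r2 h1 h2 lxy lxy' s1 s2 s1'.
have inT p q : ([set x; y] \subset top p q) = (x \in top p q) && (y \in top p q).
  by rewrite subUset !sub1set.
have inT' p q : ([set x'; y'] \subset top p q) = (x' \in top p q) && (y' \in top p q).
  by rewrite subUset !sub1set.
(* Quantifying over all edges of [z] in the zone gives [Q] a meaning for facets too, which the walk
   has to traverse. *)
pose Q z := forall e e', r e e' -> edge pos e -> top pos e \subset top pos z ->
  [set x; y] \subset top pos e -> [set x'; y'] \subset top pos' e'.
have q1 : Q e1.
  move=> e e' re ee se _.
  have eqT : top pos e = top pos e1 by apply/eqP; rewrite eqEcard se (eqP ee) (eqP h1) leqnn.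
  by move/(rel_eq fr re r1): eqT => ->.
move: (s1) (s2); rewrite !inT => /andP[x1 y1] /andP[x2 y2].
suff q2 : Q e2 by apply: q2 r2 h2 _ s2.
apply: (zone_connected own_surj g lxy h1 h2 x1 y1 x2 y2 _).1 q1.
move=> z z' z0 z0' xz yz sz; split=> [qz|qz' e e' re ee se sxy]; last first.
  by apply: qz' re ee _ sxy; apply: subset_trans se sz.
move=> e e' re ee se sxy.
have [hz|hz] := boolP (edge pos z); last first.
  apply: qz re ee _ sxy; rewrite (_ : top pos z = top pos z') //.
  apply/eqP; rewrite eqEcard sz; apply: leq_trans (generic_card g z0') _.
  by have := top_card_lab own_surj lxy xz yz; rewrite leq_eqVlt eq_sym -/(edge pos z) (negPf hz).
have [zt rz] := rel_total fr z; have [zt' rz'] := rel_total fr z'.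
have [eqT|ne] := eqVneq (top pos e) (top pos z); first by apply: qz re ee _ sxy; rewrite eqT.
have lz : [set x'; y'] \subset top pos' zt by apply: qz rz hz _ _ => //; rewrite inT xz.
move: (sxy); rewrite inT => /andP[xe ye].
(* Here [e] and [z] are opposite edges of the facet [z']. Their images are disjoint edges of one
   facet and so share a label. *)
have nov : forall v, top pos' v \subset top pos' e' -> top pos' v \subset top pos' zt -> False.
  move=> v' v1 v2; have [v rv] := rel_onto fr v'.
  apply: (common_lab_no_vertex own_surj ee hz (elimN eqP ne) lxy xe ye xz yz (v := v)).
    by rewrite (rel_sub fr rv re).
  by rewrite (rel_sub fr rv rz).
have zt0 : zt' != 0 by rewrite -(rel_neq0 g g' fr rz').
have ee' := rel_edge g g' fr re ee; have hz' := rel_edge g g' fr rz hz.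
have se' : top pos' e' \subset top pos' zt' by rewrite -(rel_sub fr re rz').
have sz' : top pos' zt \subset top pos' zt' by rewrite -(rel_sub fr rz rz').
have [a [b [lab_ab]]] := no_vertex_common_lab g' zt0 ee' hz' se' sz' nov.
rewrite !inE => /andP[ae az] /andP[be bz].
move: (lz); rewrite inT' => /andP[xz' yz'].
rewrite (edge_lab_uniq own_surj hz' lxy' lab_ab) //.
by rewrite subUset !sub1set ae.
Qed.

Definition segment x y := lab x y /\ forall z, own z = own x -> z \in [set x; y].

Lemma zone_edge_exists pos x y : generic pos -> lab x y ->
  exists2 e, edge pos e & [set x; y] \subset top pos e.
Proof.
move=> g lxy; have [z [w [lzw ne]]] := generic_lab g lxy.
have [a a0 hs] := generic_facet g lxy lzw ne.
have c0 : a *: cross (pos x - pos y) (pos z - pos w) != 0.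
  by rewrite scaler_eq0 negb_or a0 (generic_cross g).
have xt : x \in top pos (a *: cross (pos x - pos y) (pos z - pos w)).
  by apply: (subsetP hs); rewrite !inE eqxx.
have yt : y \in top pos (a *: cross (pos x - pos y) (pos z - pos w)).
  by apply: (subsetP hs); rewrite !inE eqxx orbT.
have [e [ee _ xe ye]] := lab_edge own_surj g c0 lxy xt yt.
by exists e => //; rewrite subUset !sub1set xe.
Qed.

(* A zone with a three-vertex summand ends at a facet without disjoint edges,
   whereas every facet of a segment zone is a parallelogram. *)
Lemma rel_segment pos pos' r x y x' y' e e' : generic pos -> generic pos' ->
  face_rel pos pos' r -> r e e' -> edge pos e -> lab x y -> segment x' y' ->
  [set x; y] \subset top pos e -> [set x'; y'] \subset top pos' e' -> segment x y.
Proof.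
move=> g g' fr re ee lxy [lxy' fib'] se se'; split=> // z ez; apply: contrapT => /negP zn.
move: (zn); rewrite !inE negb_or => /andP[zx zy].
have /andP[/eqP exy xy] := lxy.
have lxz : lab x z by rewrite /lab ez eqxx eq_sym.
have ne : [set x; y] != [set x; z].
  by apply/negP => /eqP eqS; move: zn; rewrite eqS set22.
have [a a0 hs] := generic_facet g lxy lxz ne.
set c := _ *: _ in hs.
have c0 : c != 0 by rewrite scaler_eq0 negb_or a0 (generic_cross g).
have xt : x \in top pos c by apply: (subsetP hs); rewrite !inE eqxx.
have yt : y \in top pos c by apply: (subsetP hs); rewrite !inE eqxx !orbT.
have zt : z \in top pos c by apply: (subsetP hs); rewrite !inE eqxx !orbT.
have [e1 [h1 s1 x1 y1]] := lab_edge own_surj g c0 lxy xt yt.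
have [e1' r1] := rel_total fr e1; have [c' rc] := rel_total fr c.
have sxy1 : [set x; y] \subset top pos e1 by rewrite subUset !sub1set x1.
have s1' : [set x'; y'] \subset top pos' e1'.
  exact: (rel_zone g g' fr re r1 ee h1 lxy lxy' se sxy1 se').
have h1' := rel_edge g g' fr r1 h1.
have c0' : c' != 0 by rewrite -(rel_neq0 g g' fr rc).
have sc' : top pos' e1' \subset top pos' c' by rewrite -(rel_sub fr r1 rc).
have hT : #|top pos c| = #|I|.+2.
  apply/eqP; rewrite eqn_leq generic_card //=.
  exact: (top_card_two_lab own_surj lxy lxz ne xt yt xt zt).
have hT' : #|top pos' c'| = #|I|.+2 by rewrite -(rel_card g g' fr c0 rc).
have xt' : x' \in top pos' c' by apply: (subsetP sc'); apply: (subsetP s1'); rewrite set21.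
have yt' : y' \in top pos' c' by apply: (subsetP sc'); apply: (subsetP s1'); rewrite set22.
have [z' [w' [lzw' zt' wt' zn']]] := facet_other_lab hT' lxy' xt' yt'.
have wn' : w' \notin [set x'; y'].
  apply: contra zn' => wi; apply: fib'; case/andP: lzw' => /eqP -> _.
  by case/set2P: wi => -> //; case/andP: lxy' => /eqP ->.
have [f1 f1T f1e] := facet_remove own_surj g' c0' lxy' lzw' xt' yt' zt' wt' zn'.
have lwz' : lab w' z' by rewrite lab_sym.
have [f2 f2T f2e] := facet_remove own_surj g' c0' lxy' lwz' xt' yt' wt' zt' wn'.
have memD u v : u \notin [set x'; y'] -> v \in [set x'; y'] -> v \in top pos' c' :\ u.
  move=> un vi; rewrite !inE; apply/andP; split; first by apply: contraNneq un => <-.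
  by case/set2P: vi => ->.
(* The facet [c'] has two edges along [x'], [y'], one omitting [z'] and one omitting [w']; [f] is
   one that differs from [e1']. *)
have [f [fe fs fx fy fne]] : exists f, [/\ edge pos' f, top pos' f \subset top pos' c',
    x' \in top pos' f, y' \in top pos' f & top pos' f <> top pos' e1'].
  have [eqT|neT] := eqVneq (top pos' f1) (top pos' e1'); last first.
    exists f1; rewrite f1T subD1set; split => //; rewrite ?memD ?set21 ?set22 //.
    by rewrite -f1T; apply/eqP.
  exists f2; rewrite f2T subD1set; split => //; rewrite ?memD ?set21 ?set22 // -eqT f1T.
  move=> /setP/(_ z'); rewrite !inE eqxx zt' andbT /=.
  by case/andP: lzw' => _ ->.
have nov' := common_lab_no_vertex own_surj fe h1' fne lxy' fx fy.
have [e2 r2] := rel_onto fr f.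
have h2 := rel_edge g' g (face_rel_sym fr) r2 fe.
have s2 : top pos e2 \subset top pos c by rewrite (rel_sub fr r2 rc).
have ne12 : top pos e2 <> top pos e1 by move=> /(rel_eq fr r2 r1).
have [p [q [lpq]]] : exists p q, [/\ lab p q, p \in top pos e2 :&: top pos e1 & q \in top pos e2 :&: top pos e1].
  apply: (no_vertex_common_lab g c0 h2 h1 s2 s1) => v v2 v1.
  have [v' rv] := rel_total fr v.
  apply: (nov' _ _ v'); rewrite -?(rel_sub fr rv r1) -?(rel_sub fr rv r2) //.
  - by apply: (subsetP s1'); rewrite set21.
  - by apply: (subsetP s1'); rewrite set22.
rewrite !inE => /andP[p2 p1] /andP[q2 q1].
have pqE := edge_lab_uniq own_surj h1 lxy lpq x1 y1 p1 q1.
(* On the summand of [x] the facet [c] is the triangle [x], [y], [z], so it has only one edge along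
   [x], [y]; but [e1] and [e2] would be two. *)
have z12 f' : edge pos f' -> top pos f' \subset top pos c -> x \in top pos f' -> y \in top pos f' ->
    top pos f' = top pos c :\ z.
  move=> hf sf xf yf; apply/eqP; rewrite eqEcard; apply/andP; split.
    apply/subsetP => v vf; rewrite !inE (subsetP sf) // andbT; apply/eqP => vz.
    have := edge_lab_uniq own_surj hf lxy lxz xf yf xf; rewrite -vz vf => /(_ isT) eqS.
    by rewrite vz in eqS; rewrite eqS eqxx in ne.
  by move: hT; rewrite (cardsD1 z) zt add1n => -[->]; rewrite (eqP hf).
apply: ne12; rewrite (z12 _ h1) // (z12 _ h2) //.
  by have : x \in [set p; q]; [rewrite -pqE set21 | case/set2P => ->].
by have : y \in [set p; q]; [rewrite -pqE set22 | case/set2P => ->].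
Qed.

(* The pairs record whether 0 and g_i belong to the face; the value at [(false, false)] is junk. *)
Definition sign_rule (t : bool * bool) (p : bool * bool) : bool * bool :=
  match p with
  | (true, true) => (true, true)
  | (true, false) => (t.1, ~~ t.1)
  | (false, _) => (t.2, ~~ t.2)
  end.

Lemma segment_or pos c x y : segment x y -> (x \in top pos c) || (y \in top pos c).
Proof.
move=> [_ fib]; have [z zt /fib] := top_ex own_surj pos c (own x).
by rewrite !inE => /orP[] /eqP <-; rewrite zt ?orbT.
Qed.

(** The functionals for which [x] beats [y] form a convex set, so no face on the walk from [c1] to
    [c2] contains both. Hence no image contains both [x'] and [y'], and passing between comparable
    faces cannot exchange one for the other. *)
Lemma rel_side pos pos' r x y x' y' c1 c1' c2 c2' : face_rel pos pos' r ->
  lab x y -> segment x' y' ->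
  (forall c c', r c c' -> c != 0 ->
     ([set x; y] \subset top pos c) = ([set x'; y'] \subset top pos' c')) ->
  r c1 c1' -> r c2 c2' ->
  x \in top pos c1 -> y \notin top pos c1 -> x \in top pos c2 -> y \notin top pos c2 ->
  x' \in top pos' c1' -> x' \in top pos' c2'.
Proof.
move=> fr lxy sg' hz r1 r2 x1 y1 x2 y2 h1.
have exy : own x = own y by case/andP: lxy => /eqP.
pose Q z := forall z', r z z' -> x' \in top pos' z'.
suff [H _] : Q c1 <-> Q c2.
  apply: (H _ c2' r2) => z' rz'.
  by have <- := (rel_eq fr r1 rz').1 erefl.
have side (z : pt) : in_cone c1 c2 z -> x \in top pos z /\ y \notin top pos z.
  move=> hz'; have xz := cone_top hz' x1 x2; split=> //.
  move: hz' xz => [a [b [a0 b0 ab ->]]] xz; apply/negP => /(fun h => top_eq xz h exy).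
  rewrite !dotDl !dotZl.
  have := notin_top_lt x1 y1 exy; have := notin_top_lt x2 y2 exy => k2 k1 e.
  have p1 : 0 < dot c1 (pos x) - dot c1 (pos y) by lra.
  have p2 : 0 < dot c2 (pos x) - dot c2 (pos y) by lra.
  have [a1|a1] := ltP 0 a.
    by have := mulr_gt0 a1 p1; have := mulr_ge0 b0 (ltW p2); lra.
  have b1 : 0 < b by lra.
  by have := mulr_ge0 a0 (ltW p1); have := mulr_gt0 b1 p2; lra.
have ne z z' : r z z' -> in_cone c1 c2 z -> ~~ ([set x'; y'] \subset top pos' z').
  move=> rz /side[xz yz]; rewrite -(hz z z') //; first by rewrite subUset !sub1set (negPf yz) andbF.
  by apply: contraNneq yz => ->; rewrite top0.
apply: (top_path (own := own) (pos := pos)) => z w zc wc szw; split=> [qz w' rw|qw z' rz].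
  have [z' rz] := rel_total fr z.
  by apply: (subsetP (_ : top pos' z' \subset _)); rewrite -?(rel_sub fr rz rw) // qz.
have [w' rw] := rel_total fr w; have xw := qw _ rw.
have := ne _ _ rw wc; rewrite subUset !sub1set xw /= => yw.
have szw' : top pos' z' \subset top pos' w' by rewrite -(rel_sub fr rz rw).
have /orP[//|yz] := segment_or pos' z' sg'.
by rewrite (subsetP szw') in yw.
Qed.

Theorem rel_signs pos pos' r x' y' : generic pos -> generic pos' -> face_rel pos pos' r ->
  segment x' y' -> exists x y t, segment x y /\ forall c c', r c c' ->
    (x' \in top pos' c', y' \in top pos' c') = sign_rule t (x \in top pos c, y \in top pos c).
Proof.
move=> g g' fr sg'; have lxy' := sg'.1.
have [e0' h0' s0'] := zone_edge_exists g' lxy'.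
have [e0 r0] := rel_onto fr e0'.
have h0 := rel_edge g' g (face_rel_sym fr) r0 h0'.
have [x [y [lxy x0 y0]]] := edge_lab h0.
have s0 : [set x; y] \subset top pos e0 by rewrite subUset !sub1set x0.
have sg := rel_segment g g' fr r0 h0 lxy sg' s0 s0'.
have hz c c' : r c c' -> c != 0 ->
     ([set x; y] \subset top pos c) = ([set x'; y'] \subset top pos' c').
  move=> rc c0; apply/idP/idP; rewrite subUset !sub1set => /andP[xt yt].
    have [e [ee es xe ye]] := lab_edge own_surj g c0 lxy xt yt.
    have [e' re] := rel_total fr e.
    have sxy : [set x; y] \subset top pos e by rewrite subUset !sub1set xe.
    apply: subset_trans (rel_zone g g' fr r0 re h0 ee lxy lxy' s0 sxy s0') _.
    by rewrite -(rel_sub fr re rc).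
  have c0' : c' != 0 by rewrite -(rel_neq0 g g' fr rc).
  have [e' [ee es xe ye]] := lab_edge own_surj g' c0' lxy' xt yt.
  have [e re] := rel_onto fr e'.
  have sxy : [set x'; y'] \subset top pos' e' by rewrite subUset !sub1set xe.
  apply: subset_trans (rel_zone g' g (face_rel_sym fr) r0 re h0' ee lxy' lxy s0' sxy s0) _.
  by rewrite (rel_sub fr re rc).
have lyx : lab y x by rewrite lab_sym.
have hz2 c c' : r c c' -> c != 0 ->
     ([set y; x] \subset top pos c) = ([set x'; y'] \subset top pos' c').
  by rewrite setUC; apply: hz.
(* By [rel_side] a single witness decides for all faces on that side. The two sides are recorded
   separately, so a zone carries four possible rules. *)
pose t1 := `[< exists c c', [/\ r c c', x \in top pos c, y \notin top pos c & x' \in top pos' c'] >].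
pose t2 := `[< exists c c', [/\ r c c', y \in top pos c, x \notin top pos c & x' \in top pos' c'] >].
exists x, y, (t1, t2); split=> // c c' rc.
have yE : ~~ ((x' \in top pos' c') && (y' \in top pos' c')) -> (y' \in top pos' c') = ~~ (x' \in top pos' c').
  by have := segment_or pos' c' sg'; case: (x' \in _); case: (y' \in _).
have := segment_or pos c sg.
case xt: (x \in top pos c); case yt: (y \in top pos c) => //= _.
- have [c0|c0] := eqVneq c 0.
    have c0' : c' = 0 by apply/eqP; rewrite -[_ == _]negbK -(rel_neq0 g g' fr rc) c0 eqxx.
    by rewrite c0' top0 !inE.
  have : [set x; y] \subset top pos c by rewrite subUset !sub1set xt.
  by rewrite (hz _ _ rc c0) subUset !sub1set => /andP[-> ->].
- have c0 : c != 0 by apply: contraFneq yt => ->; rewrite top0.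
  have nb : ~~ ((x' \in top pos' c') && (y' \in top pos' c')).
    by have := hz _ _ rc c0; rewrite !subUset !sub1set yt andbF => <-.
  have -> : t1 = (x' \in top pos' c'); last by rewrite -yE.
  apply/asboolP/idP => [[d [d' [rd xd yd hx]]]|hx]; last by exists c, c'; rewrite xt yt hx.
  by apply: (rel_side fr lxy sg' hz rd rc) => //; rewrite yt.
- have c0 : c != 0 by apply: contraFneq xt => ->; rewrite top0.
  have nb : ~~ ((x' \in top pos' c') && (y' \in top pos' c')).
    by have := hz _ _ rc c0; rewrite !subUset !sub1set xt => <-.
  have -> : t2 = (x' \in top pos' c'); last by rewrite -yE.
  apply/asboolP/idP => [[d [d' [rd xd yd hx]]]|hx]; last by exists c, c'; rewrite xt yt hx.
  by apply: (rel_side fr lyx sg' hz2 rd rc) => //; rewrite xt.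
Qed.

End Isomorphism.

(** * Projections *)


(** For vectors in a plane with [D] their determinant: either one vector has all others on one
    closed side, or three of them surround the origin. In the second case [D p2 p3], [D p3 p1],
    [D p1 p2] are the weights of a vanishing combination. *)
Lemma most_ccw (R : realType) (T : eqType) (D : T -> T -> R) (L : seq T) :
  (forall p q, D p q = - D q p) -> L != [::] ->
  (exists2 p0, p0 \in L & forall p, p \in L -> 0 <= D p p0) \/
  (exists p1 p2 p3, [/\ p1 \in L, p2 \in L & p3 \in L] /\
     [/\ 0 < D p2 p3, 0 < D p3 p1 & 0 <= D p1 p2]).
Proof.
move=> anti; elim: L => // q L ih _.
have D0 p : D p p = 0 by have := anti p p; lra.
have [->|/ih [[p0 h0 hp]|[p1 [p2 [p3 [[h1 h2 h3] h]]]]]] := eqVneq L [::].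
- by left; exists q; rewrite ?mem_head // => p; rewrite inE => /eqP ->; rewrite D0.
- have [hq|hq] := leP 0 (D q p0).
    by left; exists p0; rewrite ?inE ?h0 ?orbT // => p; rewrite inE => /orP[/eqP ->|/hp].
  have [hall|/allPn[p pL hpq]] := boolP (all (fun p => 0 <= D p q) L).
    left; exists q; rewrite ?mem_head // => p; rewrite inE => /orP[/eqP ->|]; first by rewrite D0.
    exact: (allP hall).
  right; exists p, p0, q; rewrite !inE pL h0 eqxx !orbT; split=> //.
  rewrite -ltNge in hpq; split; [|rewrite anti; lra | exact: hp].
  by rewrite anti; lra.
- by right; exists p1, p2, p3; rewrite !inE h1 h2 h3 !orbT.
Qed.

Section Projection.
Variable R : realType.
Notation pt := 'rV[R]_3.

Lemma conv_convex (V : seq pt) x y t : conv V x -> conv V y -> 0 <= t -> t <= 1 ->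
  conv V (t *: x + (1 - t) *: y).
Proof.
move=> [l [l0 [l1 ->]]] [m [m0 [m1 ->]]] t0 t1.
exists (fun i => t * l i + (1 - t) * m i); split=> [i|].
  by rewrite addr_ge0 ?mulr_ge0 // subr_ge0.
split; first by rewrite big_split /= -!mulr_sumr l1 m1; ring.
rewrite !scaler_sumr -big_split /=; apply: eq_bigr => i _.
by rewrite !scalerA scalerDl.
Qed.

(** Split off a vertex of positive weight from a convex combination projecting to [z]: extremality
    forces its projection to agree with that of the rest, hence with [z]. *)
Lemma extreme_proj_conv (V : seq pt) u z :
  extreme (proj u @` conv V)%classic z -> exists2 v, v \in V & z = proj u v.
Proof.
move=> [[x [l [l0 [l1 ->]]] <-] hz].
have [j lj] : exists j, l j != 0.
  apply: contrapT => hn; have : \sum_i l i = 0.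
    by apply: big1 => i _; apply: contrapT => /eqP li; apply: hn; exists i.
  by rewrite l1 => /eqP; rewrite oner_eq0.
have lj0 : 0 < l j by rewrite lt_def lj l0.
exists V`_j; first exact: mem_nth.
have hs : l j + \sum_(i | i != j) l i = 1 by rewrite -l1 [RHS](bigD1 j).
set S := \sum_(i | i != j) l i in hs.
have S0 : 0 <= S by apply: sumr_ge0 => i _.
rewrite (bigD1 j) //=; set W := \sum_(i | i != j) l i *: V`_i.
have [Sz|Sn] := eqVneq S 0.
  have -> : W = 0.
    apply: big1 => i ij; suff -> : l i = 0 by rewrite scale0r.
    by apply: (psumr_eq0P _ Sz) => // k _.
  have -> : l j = 1 by lra.
  by rewrite scale1r addr0.
have Sp : 0 < S by rewrite lt_def Sn.
have hy : conv V (S^-1 *: W).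
  exists (fun i => if i == j then 0 else S^-1 * l i); split=> [i|].
    by case: ifP => // _; rewrite mulr_ge0 // invr_ge0.
  split.
    rewrite (bigD1 j) //= eqxx add0r -[RHS](mulVf Sn) mulr_sumr.
    by apply: eq_bigr => i /negPf ->.
  rewrite [RHS](bigD1 j) //= eqxx scale0r add0r scaler_sumr.
  by apply: eq_bigr => i /negPf ->; rewrite scalerA.
have split_x : l j *: V`_j + W = l j *: V`_j + (1 - l j) *: (S^-1 *: W).
  by rewrite (_ : 1 - l j = S) ?scalerA ?divff ?scale1r //; lra.
apply: contrapT => hne; apply: hz.
exists (proj u V`_j), (proj u (S^-1 *: W)), (l j); split.
- by exists V`_j => //; apply/conv_mem/mem_nth.
- by exists (S^-1 *: W).
- apply/eqP => e; apply: hne; rewrite split_x projD (projZ u (l j)) (projZ u (1 - l j)) -e -scalerDl.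
  by rewrite (_ : l j + (1 - l j) = 1) ?scale1r //; ring.
- by rewrite lj0 /=; lra.
- by rewrite (bigD1 j) //= -/W split_x projD !projZ.
Qed.

Variables (U I : finType) (own : U -> I).
Hypothesis own_surj : forall i, exists x, own x = i.
Variable pos : U -> pt.
Hypothesis gen : generic own pos.
Notation T := (top own pos).
Notation lab := (lab own).
Notation sel := (sel own).
Local Notation vsum := (vsum pos).
Notation M := (minkowski own pos).

Definition upd (s : {ffun I -> U}) (x : U) : {ffun I -> U} :=
  [ffun i => if i == own x then x else s i].

Lemma sel_upd s x : sel s -> sel (upd s x).
Proof. by move=> /selP h; apply/selP => i; rewrite ffunE; case: eqP. Qed.

Lemma vsum_upd s x : vsum (upd s x) = vsum s + (pos x - pos (s (own x))).
Proof.
rewrite /vsum (bigD1 (own x)) //= [in RHS](bigD1 (own x)) //= ffunE eqxx.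
rewrite [in RHS]addrAC [in RHS](addrC (pos x)) addrA addrN add0r; congr (_ + _).
by apply: eq_bigr => i /negPf h; rewrite ffunE h.
Qed.

Lemma upd_top c (s : {ffun I -> U}) x : (forall i, s i \in T c) -> x \in T c -> forall i, upd s x i \in T c.
Proof. by move=> h xt i; rewrite ffunE; case: eqP. Qed.

(** Exchanging single vertices in one selection gives three vertices of the face whose differences
    are two edge directions, independent by [generic_cross]. *)
Lemma facet_normal_two_lab c x y z w : c != 0 -> lab x y -> lab z w ->
  z \notin [set x; y] -> x \in T c -> y \in T c -> z \in T c -> w \in T c ->
  facet_normal M c.
Proof.
move=> c0 lxy lzw zn xt yt zt wt; split=> //.
have /andP[/eqP exy xy] := lxy; have /andP[/eqP ezw zw] := lzw.
have lyx : lab y x by rewrite lab_sym.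
have [s0 [hs0 ts0 s0x]] := sel_through own_surj xt.
have face_upd (s : {ffun I -> U}) v : sel s -> (forall i, s i \in T c) -> v \in T c ->
    face_of_dir M c (vsum (upd s v)).
  by move=> hs ts vt; apply/(face_dir_vsum own_surj _ _ (sel_upd _ hs)); apply: upd_top.
have face0 (s : {ffun I -> U}) : sel s -> (forall i, s i \in T c) -> face_of_dir M c (vsum s).
  by move=> hs ts; apply/(face_dir_vsum own_surj _ _ hs).
have dif s v : vsum (upd s v) - vsum s = pos v - pos (s (own v)).
  by rewrite vsum_upd addrC addKr.
have [eo|eo] := eqVneq (own z) (own x).
  exists (vsum s0), (vsum (upd s0 y)), (vsum (upd s0 z)); split; try exact: face_upd.
    exact: face0.
  apply: aff_indep3_cross; rewrite !dif eo -exy s0x; apply: (generic_cross gen) => //.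
    by rewrite /lab eo eqxx; apply: contraNneq zn => ->; rewrite set21.
  by apply: contraNneq zn => e; rewrite setUC e set21.
have hs1 := sel_upd z hs0; have ts1 := upd_top ts0 zt.
exists (vsum (upd s0 z)), (vsum (upd (upd s0 z) y)), (vsum (upd (upd s0 z) w)).
split; try exact: face_upd.
apply: aff_indep3_cross; rewrite !dif -exy -ezw !ffunE eqxx.
rewrite (eq_sym (own x)) (negPf eo) s0x; apply: (generic_cross gen) => //; first by rewrite lab_sym.
by apply: contraNneq zn => e; rewrite setUC e set22.
Qed.

Lemma facet_normal_lab c x y z w : c != 0 -> lab x y -> lab z w ->
  [set x; y] != [set z; w] -> x \in T c -> y \in T c -> z \in T c -> w \in T c ->
  facet_normal M c.
Proof.
move=> c0 lxy lzw ne xt yt zt wt.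
have [zi|zn] := boolP (z \in [set x; y]); last exact: (facet_normal_two_lab c0 lxy lzw).
have [wi|wn] := boolP (w \in [set x; y]); last first.
  by apply: (facet_normal_two_lab c0 lxy _ wn _ _ wt zt) => //; rewrite lab_sym.
case/negP: ne; rewrite eq_sym eqEcard; apply/andP; split.
  by apply/subsetP => v /set2P[] ->.
by rewrite !cards2; case/andP: lzw => _ ->; case/andP: lxy => _ ->.
Qed.

(** * Projection along a direction parallel to no facet *)

Section Direction.
Variable u : pt.
Hypotheses (u0 : u != 0) (hu : ~ plane_orth_facet M u).

Lemma orth_card c : c != 0 -> dot u c = 0 -> (#|T c| <= #|I|.+1)%N.
Proof.
move=> c0 uc; have := generic_card gen c0; rewrite leq_eqVlt => /orP[/eqP h2|] //.
exfalso; have [x [y [lxy xt yt]]] : exists x y, [/\ lab x y, x \in T c & y \in T c].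
  by apply: collision; rewrite h2; apply: leq_trans (max_card _) _.
have [z [w [lzw zt wt zn]]] := facet_other_lab h2 lxy xt yt.
by apply: hu; exists c; split=> //; apply: (facet_normal_two_lab c0 lxy lzw zn).
Qed.

(** If two projected edge directions were parallel, their cross product would be orthogonal to [u];
    but up to sign it is an outward normal of a facet. *)
Lemma lab_det x y z w : lab x y -> lab z w -> [set x; y] != [set z; w] ->
  det3 u (pos x - pos y) (pos z - pos w) != 0.
Proof.
move=> lxy lzw ne; apply/eqP => h; apply: hu.
have [a a0 hs] := generic_facet gen lxy lzw ne.
exists (a *: cross (pos x - pos y) (pos z - pos w)); split; last by rewrite dotZr [dot _ _]h mulr0.
apply: (facet_normal_lab _ lxy lzw ne); try by apply: (subsetP hs); rewrite !inE eqxx ?orbT.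
by rewrite scaler_eq0 negb_or a0 (generic_cross gen).
Qed.

Lemma lab_cross x y : lab x y -> cross u (pos x - pos y) != 0.
Proof.
move=> lxy; have [z [w [lzw ne]]] := generic_lab gen lxy.
apply: contra_neq (lab_det lxy lzw ne) => h.
by rewrite det3C det3C /det3 h dot0r.
Qed.

(* [ray p] is normal, within the plane of projection, to the edge joining the endpoints of [p];
   the condition [p.1 \in T (ray p)] selects its outward orientation. *)
Definition ray (p : U * U) : pt := cross u (pos p.1 - pos p.2).
Definition good_pairs : {set U * U} := [set p | lab p.1 p.2 && (p.1 \in T (ray p))].

Lemma ray_orth p : dot u (ray p) = 0.
Proof. exact: dot_crossl. Qed.

Lemma ray_tie p : dot (ray p) (pos p.1) = dot (ray p) (pos p.2).
Proof. by apply/eqP; rewrite -subr_eq0 -dotBr dotC dot_crossr. Qed.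

Lemma ray_neq0 p : p \in good_pairs -> ray p != 0.
Proof. by rewrite inE => /andP[/lab_cross]. Qed.

Lemma ray_top p : p \in good_pairs ->
  [/\ p.1 \in T (ray p), p.2 \in T (ray p) & #|T (ray p)| = #|I|.+1].
Proof.
move=> hp; move: (hp); rewrite inE => /andP[lp h1].
have h2 : p.2 \in T (ray p).
  by apply: top_tie h1 _ (ray_tie p); case/andP: lp => /eqP.
split=> //; apply/eqP; rewrite eqn_leq orth_card ?ray_orth ?ray_neq0 //=.
exact: (top_card_lab own_surj lp).
Qed.

Lemma ray_vertex p : p \in good_pairs ->
  exists c, [/\ dot c u = 0, T c = T (ray p) :\ p.1 & #|T c| = #|I|].
Proof.
move=> hp; have [h1 h2 hc] := ray_top hp; move: (hp); rewrite inE => /andP[lp _].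
(* Up to scaling, [d] is the part of [q] orthogonal to [u]: the tilted functional stays in the plane
   of projection and prefers [p.2] to [p.1]. *)
pose q := pos p.2 - pos p.1; pose d := dot u u *: q - dot u q *: u.
have [e e0 h] := top_perturb own pos (ray p) d.
have du : dot d u = 0 by rewrite /d dotBl !dotZl (dotC q) mulrC subrr.
have dq : dot d (pos p.1) < dot d (pos p.2).
  rewrite -subr_gt0 -dotBr -/q /d dotBl !dotZl.
  have : 0 < dot (cross u q) (cross u q).
    by apply: dot_gt0; apply: lab_cross; rewrite lab_sym.
  by rewrite dot_cross_cross expr2.
have n1 : p.1 \notin T (ray p + e *: d).
  rewrite h inE h1 /=; apply/negP => /forallP/(_ p.2); rewrite h2.
  by case/andP: lp => /eqP -> _; rewrite eqxx /= leNgt dq.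
have cD : #|T (ray p) :\ p.1| = #|I|.
  by move: hc; rewrite (cardsD1 p.1) h1 add1n => -[].
have eT : T (ray p + e *: d) = T (ray p) :\ p.1.
  apply/eqP; rewrite eqEcard cD top_card // andbT; apply/subsetP => v vt.
  rewrite !inE; apply/andP; split; first by apply: contraNneq n1 => <-.
  by move: vt; rewrite h inE => /andP[].
exists (ray p + e *: d); rewrite eT; split=> //.
by rewrite dotDl dotZl du mulr0 addr0 dotC ray_orth.
Qed.

(** Each edge of the projected polygon is matched with its end at [p.2], so that counting vertices
    becomes counting oriented edges. *)
Lemma exists_ray_sel : exists f : U * U -> {ffun I -> U}, forall p, p \in good_pairs ->
  [/\ sel (f p), forall i, f p i \in T (ray p) :\ p.1 & f p (own p.1) = p.2].
Proof.
have /choice[f hf] : forall p, exists s : {ffun I -> U}, p \in good_pairs ->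
    [/\ sel s, forall i, s i \in T (ray p) :\ p.1 & s (own p.1) = p.2].
  move=> p; have [hp|hp] := boolP (p \in good_pairs); last first.
    by have [s _ _] := sel_top own_surj pos 0; exists s.
  have [c [_ cT cc]] := ray_vertex hp.
  have [s hs ts] := sel_top own_surj pos c.
  exists s => _; split=> //; first by rewrite -cT.
  have [h1 h2 _] := ray_top hp; move: (hp); rewrite inE => /andP[/andP[/eqP eo ne] _].
  apply: (top_card_fiber own_surj cc) => //; first by rewrite cT !inE eq_sym ne.
  by move/selP: hs => ->.
by exists f.
Qed.

Lemma ray_sel_uniq p s s' : p \in good_pairs -> sel s -> sel s' ->
  (forall i, s i \in T (ray p) :\ p.1) -> (forall i, s' i \in T (ray p) :\ p.1) -> s = s'.
Proof.
move=> hp /selP hs /selP hs' ts ts'; have [c [_ cT cc]] := ray_vertex hp.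
apply/ffunP => i; apply: (top_card_fiber own_surj cc); rewrite ?cT //.
by rewrite hs hs'.
Qed.

(** If two edges were matched with the same vertex, the determinant of their directions would be
    nonnegative in both orders, hence zero, and their labels equal. Opposite orientations would make
    [ray p] constant on the polytope. *)
Lemma ray_sel_inj f p q : (forall p, p \in good_pairs ->
    [/\ sel (f p), forall i, f p i \in T (ray p) :\ p.1 & f p (own p.1) = p.2]) ->
  p \in good_pairs -> q \in good_pairs ->
  proj u (vsum (f p)) = proj u (vsum (f q)) -> p = q.
Proof.
move=> hf hp hq e.
have max a c x : c \in good_pairs -> a \in good_pairs -> M x ->
    proj u (vsum (f a)) = proj u (vsum (f c)) -> dot (ray c) x <= dot (ray c) (vsum (f a)).
  move=> hc ha hx eac; have [sc tc _] := hf _ hc.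
  have ou : dot (ray c) u = 0 by rewrite dotC ray_orth.
  have -> : dot (ray c) (vsum (f a)) = dot (ray c) (vsum (f c)).
    by rewrite -[LHS](dot_proj _ ou) eac dot_proj.
  apply: (minkowski_dot_le sc) => // i.
  by have := tc i; rewrite inE => /andP[].
have half a c : a \in good_pairs -> c \in good_pairs ->
    proj u (vsum (f a)) = proj u (vsum (f c)) -> det3 u (pos a.1 - pos a.2) (pos c.1 - pos c.2) >= 0.
  move=> ha hc eac; have [sa ta fa] := hf _ ha.
  have := max a c (vsum (upd (f a) a.1)) hc ha (minkowski_vsum pos (sel_upd _ sa)) eac.
  rewrite vsum_upd fa dotDr gerDl /ray dotC -/(det3 _ _ _).
  by rewrite det3C det3N -det3C oppr_le0.
have h1 := half _ _ hp hq e; have h2 := half _ _ hq hp (esym e).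
have h0 : det3 u (pos p.1 - pos p.2) (pos q.1 - pos q.2) = 0.
  by apply/eqP; rewrite eq_le h1 andbT det3N oppr_le0.
move: (hp) (hq); rewrite !inE => /andP[lp tp] /andP[lq tq].
have eS : [set p.1; p.2] = [set q.1; q.2].
  by apply: contrapT => /eqP ne; have := lab_det lp lq ne; rewrite h0 eqxx.
have : q.1 \in [set p.1; p.2] by rewrite eS set21.
have : q.2 \in [set p.1; p.2] by rewrite eS set22.
have nq : q.1 != q.2 by case/andP: lq.
case/set2P=> e2; case/set2P=> e1; rewrite ?e1 ?e2 ?eqxx // in nq; last first.
  by case: (p) (q) e1 e2 => [a b] [a' b'] /= -> ->.
exfalso; have rq : ray q = - ray p by rewrite /ray e1 e2 -crossNr opprB.
have const x : M x -> dot (ray p) x = dot (ray p) (vsum (f p)).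
  move=> hx; apply/eqP; rewrite eq_le (max p p) //=.
  by have := max p q x hq hp hx e; rewrite rq !dotNl lerN2.
have := ray_neq0 hp; rewrite -(proper_neq0 gen) => /eqP; apply; apply/setP => x; rewrite inE.
have x0 : x \in T 0 by rewrite top0.
have [s [hs _ <-]] := sel_through own_surj x0.
have [sp tp' _] := hf _ hp.
apply: (dot_vsum_eq (s' := f p)) => //; last by rewrite const //; apply: minkowski_vsum.
by move=> i; have := tp' i; rewrite inE => /andP[].
Qed.

Lemma vertex_extreme c s : dot c u = 0 -> #|T c| = #|I| -> sel s ->
  (forall i, s i \in T c) -> extreme (proj u @` M)%classic (proj u (vsum s)).
Proof.
move=> cu cc hs ts; split; first by exists (vsum s) => //; apply: minkowski_vsum.
move=> [_ [_ [t [[y hy <-] [z hz <-] ne /andP[t0 t1] e]]]].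
have hd : dot c (vsum s) = t * dot c y + (1 - t) * dot c z.
  by rewrite -(dot_proj _ cu) e dotDr !dotZr !dot_proj.
have ly := minkowski_dot_le hs ts hy; have lz := minkowski_dot_le hs ts hz.
have ey : dot c y = dot c (vsum s) by nra.
have ez : dot c z = dot c (vsum s) by nra.
have single x : M x -> dot c x = dot c (vsum s) -> x = vsum s.
  move=> hx ex; apply: (face_dir_single own_surj cc hs ts).
  by apply/(face_dirP _ hs ts).
by rewrite (single y) // (single z) // eqxx in ne.
Qed.

Lemma extreme_ray f z : (forall p, p \in good_pairs ->
    [/\ sel (f p), forall i, f p i \in T (ray p) :\ p.1 & f p (own p.1) = p.2]) ->
  extreme (proj u @` M)%classic z -> exists2 p, p \in good_pairs & z = proj u (vsum (f p)).
Proof.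
move=> hf hz; have [v hv zv] := extreme_proj_conv hz.
move: hv zv => /mapP[s]; rewrite mem_enum => hs ->{v} zs.
have /selP os : sel s by [].
(* The vertices not selected by [s]. Selecting [p] instead changes the sum by [- e p]. *)
pose L := [seq p <- enum U | s (own p) != p].
pose e p := pos (s (own p)) - pos p.
pose D p q := det3 u (e p) (e q).
have anti p q : D p q = - D q p by rewrite /D det3N.
have labL p : p \in L -> lab (s (own p)) p.
  by rewrite mem_filter => /andP[h _]; rewrite /lab os eqxx.
have L0 : L != [::].
  apply/negP => /eqP LE.
  have inj x y : own x = own y -> x = y.
    have sE w : s (own w) = w.
      by apply: contrapT => /eqP h; have := in_nil w; rewrite -LE mem_filter h mem_enum.
    by move=> h; rewrite -(sE x) h sE.
  have ec : (#|U| <= #|I|)%N by apply: (leq_card own) => x y; apply: inj.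
  have c0 : (mkv 1 0 0 : pt) != 0.
    by apply/eqP => h; have := congr1 (@cx R) h; rewrite !vecE => /eqP; rewrite oner_eq0.
  move: c0; rewrite -(proper_neq0 gen); apply/negP; rewrite negbK.
  by rewrite eqEcard subsetT cardsT (leq_trans ec) // top_card.
(* An extremal [e x] gives a supporting line of the projection, with outward normal [ray p]. *)
case: (most_ccw anti L0) => [[x xL hx]|].
  pose y := s (own x); pose p := (x, y).
  have lxy : lab x y by rewrite lab_sym; apply: labL.
  have dE q : dot (ray p) (e q) = D q x.
    rewrite /D /ray /e /= -/y /det3; move: (pos _ - pos q) => w.
    by rewrite !vecE; ring.
  have st i : s i \in T (ray p).
    apply/topP => q; rewrite os => eo; have [->//|ne] := eqVneq q (s i).
    have qL : q \in L by rewrite mem_filter mem_enum andbT eo eq_sym.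
    by have := hx _ qL; rewrite -dE /e eo dotBr subr_ge0.
  have xt : x \in T (ray p).
    apply: (top_tie (st (own x))); first by rewrite os.
    by rewrite (ray_tie p).
  have hp : p \in good_pairs by rewrite inE /= lxy xt.
  exists p => //; rewrite zs; congr (proj u (vsum _)).
  have [sp tp _] := hf _ hp; apply: (ray_sel_uniq hp) => // i; rewrite !inE st andbT /=.
  apply/negP => /eqP sx; move: lxy; rewrite /lab /y -sx os sx.
  by rewrite eqxx andbF.
move=> [p1 [p2 [p3 [[h1 h2 h3] [d1 d2 d3]]]]]; exfalso.
pose a := D p2 p3; pose b := D p3 p1; pose c := D p1 p2.
(* Cramer's rule for four vectors in dimension three. After projection, [z] becomes a convex
   combination of the points reached by exchanging [p1], [p2], [p3], against extremality. *)
have rel : a *: e p1 + b *: e p2 + c *: e p3 = det3 (e p1) (e p2) (e p3) *: u.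
  apply/eqP; rewrite -subr_eq0; apply/eqP; rewrite /a /b /c /D.
  by apply: vec_ext; rewrite /det3 !vecE; ring.
have prel : a *: proj u (e p1) + b *: proj u (e p2) + c *: proj u (e p3) = 0.
  by rewrite -!projZ -!projD rel projZ proj_self // scaler0.
have yE p : proj u (vsum (upd s p)) = z - proj u (e p).
  by rewrite vsum_upd -[pos p - _]opprB -/(e p) projB zs.
have hM p : M (vsum (upd s p)) by apply: minkowski_vsum; apply: sel_upd.
have bc : 0 < b + c by rewrite /b /c; lra.
have S0 : 0 < a + b + c by rewrite /a; lra.
pose t := a / (a + b + c); pose t' := b / (b + c).
have t01 : 0 < t < 1.
  by rewrite divr_gt0 //= ltr_pdivrMr // mul1r; lra.
have t01' : 0 <= t' <= 1.
  by rewrite divr_ge0 ?(ltW d2) ?(ltW bc) //= ler_pdivrMr // mul1r lerDl.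
pose w := t' *: vsum (upd s p2) + (1 - t') *: vsum (upd s p3).
have hw : M w by case/andP: t01' => q0 q1; exact: (conv_convex (hM p2) (hM p3) q0 q1).
have zE : z = t *: proj u (vsum (upd s p1)) + (1 - t) *: proj u w.
  rewrite /w projD !projZ !yE.
  move: prel; move: (proj u (e p1)) (proj u (e p2)) (proj u (e p3)) => f1 f2 f3 prel.
  transitivity (z - (a + b + c)^-1 *: (a *: f1 + b *: f2 + c *: f3)).
    by rewrite prel scaler0 subr0.
  by apply: vec_ext; rewrite !vecE /t /t'; field; rewrite !gt_eqF.
have [_ hn] := hz; apply: hn.
exists (proj u (vsum (upd s p1))), (proj u w), t.
split; [by exists (vsum (upd s p1)) | by exists w | | exact: t01 | exact: zE].
apply/eqP => ew; have : proj u (e p1) = 0.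
  have : z = proj u (vsum (upd s p1)).
    by rewrite {1}zE -ew -scalerDl addrC subrK scale1r.
  by rewrite yE => /eqP; rewrite -subr_eq0 opprB addrC subrK => /eqP.
move=> /proj_eq0 h; have := lab_cross (labL _ h1); rewrite [cross _ _]h eqxx //.
Qed.

Lemma num_vertices_proj : num_vertices_eq (proj u @` M)%classic #|good_pairs|.
Proof.
have [f hf] := exists_ray_sel.
exists [seq proj u (vsum (f p)) | p <- enum good_pairs]; split.
- rewrite map_inj_in_uniq ?enum_uniq // => p q; rewrite !mem_enum; exact: ray_sel_inj.
- by rewrite size_map -cardE.
move=> x; split.
  move=> /mapP[p]; rewrite mem_enum => hp ->.
  have [sp tp _] := hf _ hp; have [c [cu cT cc]] := ray_vertex hp.
  by apply: (vertex_extreme cu cc sp) => i; rewrite cT.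
by move=> /(extreme_ray hf)[p hp ->]; apply: map_f; rewrite mem_enum.
Qed.

End Direction.
End Projection.

(** * Segments and a triangle *)


Section Summands.
Variable R : realType.
Notation pt := 'rV[R]_3.
Variables n m : nat.
Hypotheses (n3 : (3 <= n)%N) (m13 : m = 1%N \/ m = 3%N).

Definition vtx := (('I_n * bool) + 'I_m)%type.
Definition vown (x : vtx) : option 'I_n :=
  match x with inl (i, _) => Some i | inr _ => None end.
Definition vpos (g : 'I_n -> pt) (t : 'I_m -> pt) (x : vtx) : pt :=
  match x with inl (i, b) => if b then g i else 0 | inr j => t j end.

Record generic_config (g : 'I_n -> pt) (t : 'I_m -> pt) : Prop := GenericConfig {
  config_ggg : forall i j k, uniq [:: i; j; k] -> det3 (g i) (g j) (g k) != 0;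
  config_ggt : forall i j a b, i != j -> a != b -> det3 (g i) (g j) (t a - t b) != 0;
  config_gtt : forall i a b a' b', a != b -> a' != b' -> [set a; b] != [set a'; b'] ->
    det3 (g i) (t a - t b) (t a' - t b') != 0 }.

Lemma m_gt0 : (0 < m)%N. Proof. by case: m13 => ->. Qed.
Lemma m_le3 : (m <= 3)%N. Proof. by case: m13 => ->. Qed.

Lemma ord_m3 (a b : 'I_m) : a != b -> m = 3%N.
Proof.
case: m13 => // m1; move: a b; rewrite m1 => a b.
by rewrite [a]ord1 [b]ord1 eqxx.
Qed.

Lemma vown_surj i : exists x : vtx, vown x = i.
Proof.
case: i => [i|]; first by exists (inl (i, true)).
by exists (inr (Ordinal m_gt0)).
Qed.

Notation lab := (lab vown).

Lemma third_index (a b : option 'I_n) : exists i, (Some i != a) && (Some i != b).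
Proof.
have : (0 < #|~: [set i | (Some i == a) || (Some i == b)]|)%N.
  rewrite cardsCs setCK card_ord subn_gt0.
  apply: (@leq_ltn_trans #|[set a; b]|); last first.
    by rewrite cards2; apply: leq_ltn_trans n3; case: eqP.
  rewrite -(card_imset (mem [set i | _]) (@Some_inj _)).
  apply: subset_leq_card; apply/subsetP => o /imsetP[i]; rewrite !inE => h ->.
  exact: h.
by rewrite card_gt0 => /set0Pn[i]; rewrite !inE negb_or; exists i.
Qed.

Lemma lab_cases (g : 'I_n -> pt) t x y : lab x y ->
  (exists i b, [/\ x = inl (i, b), y = inl (i, ~~ b) &
      vpos g t x - vpos g t y = (-1) ^+ (~~ b) *: g i]) \/
  (exists a b, [/\ x = inr a, y = inr b, a != b & vpos g t x - vpos g t y = t a - t b]).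
Proof.
case: x y => [[i b]|a] [[j c]|a'] //= /andP[/eqP //= eo ne].
  case: eo => ij; subst j; left; exists i, b.
  have -> : c = ~~ b by case: b c ne => [] [] //; rewrite eqxx.
  by split=> //; case: b {ne} => /=; rewrite ?expr0 ?expr1 ?scale1r ?scaleN1r ?subr0 ?sub0r.
by right; exists a, a'; split=> //; apply: contraNneq ne => ->.
Qed.

Lemma fiber_inl i b (z : vtx) : vown z = Some i -> z \in [set inl (i, b); inl (i, ~~ b)].
Proof.
by case: z => [[j c]|//] /= [->]; rewrite !inE; case: b c => [] []; rewrite eqxx ?orbT.
Qed.

Lemma segment_inl i b : segment vown (inl (i, b)) (inl (i, ~~ b)).
Proof.
split; last by move=> z; apply: fiber_inl.
by apply/andP; split=> //; apply/eqP => -[]; case: b.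
Qed.

Section OneConfig.
Variables (g : 'I_n -> pt) (t : 'I_m -> pt).
Hypothesis gc : generic_config g t.
Notation pos := (vpos g t).

Lemma sign_scale_neq0 (b : bool) (v w x : pt) : det3 v w x != 0 -> det3 ((-1) ^+ b *: v) w x != 0.
Proof. by move=> h; rewrite /det3 dotZl mulf_neq0 // signr_eq0. Qed.

(** The last hypothesis excludes the three edges of the triangle, which are coplanar. Every other
    triple falls under a clause of [generic_config], up to signs and order. *)
Lemma lab_det3 x1 y1 x2 y2 x3 y3 : lab x1 y1 -> lab x2 y2 -> lab x3 y3 ->
  [set x1; y1] != [set x2; y2] -> [set x1; y1] != [set x3; y3] ->
  [set x2; y2] != [set x3; y3] ->
  ~~ [&& vown x1 == None, vown x2 == None & vown x3 == None] ->
  det3 (pos x1 - pos y1) (pos x2 - pos y2) (pos x3 - pos y3) != 0.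
Proof.
have nij i j b c : [set (inl (i, b) : vtx); inl (i, ~~ b)] != [set inl (j, c); inl (j, ~~ c)] -> i != j.
  apply: contraNneq => ->; apply/eqP/setP => z.
  by rewrite !inE; case: b; case: c => //=; rewrite orbC.
have nab (a b a' b' : 'I_m) : [set (inr a : vtx); inr b] != [set inr a'; inr b'] -> [set a; b] != [set a'; b'].
  apply: contraNneq => h; apply/eqP/setP => -[z|z]; rewrite !inE //.
  by have := congr1 (fun S : {set 'I_m} => z \in S) h; rewrite !inE.
have cyc u v w : det3 u v w != 0 -> det3 v w u != 0 by rewrite det3C.
move=> l1 l2 l3.
case: (lab_cases g t l1) => [[i [b [-> -> ->]]]|[a [a' [-> -> na ->]]]];
case: (lab_cases g t l2) => [[j [c [-> -> ->]]]|[d [d' [-> -> nd ->]]]];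
case: (lab_cases g t l3) => [[k [e [-> -> ->]]]|[f [f' [-> -> nf ->]]]] //= h12 h13 h23 _.
- do 3 (apply: sign_scale_neq0; apply/cyc); apply: (config_ggg gc).
  by rewrite /= !inE negb_or (nij _ _ _ _ h12) (nij _ _ _ _ h13) (nij _ _ _ _ h23).
- apply: sign_scale_neq0; do 2 apply: (cyc _ _ _); apply: sign_scale_neq0; apply: (cyc _ _ _).
  by apply: (config_ggt gc) => //; apply: nij h12.
- apply: sign_scale_neq0; apply: (cyc _ _ _); apply: sign_scale_neq0.
  by apply: (config_ggt gc) => //; rewrite eq_sym; apply: nij h13.
- by apply: sign_scale_neq0; apply: (config_gtt gc) => //; apply: (nab _ _ _ _).
- apply: (cyc _ _ _); apply: sign_scale_neq0; apply: (cyc _ _ _); apply: sign_scale_neq0.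
  by apply: (config_ggt gc) => //; apply: nij h23.
- do 2 apply: (cyc _ _ _); apply: sign_scale_neq0; apply: (config_gtt gc) => //.
  by rewrite eq_sym; apply: (nab _ _ _ _).
- by apply: (cyc _ _ _); apply: sign_scale_neq0; apply: (config_gtt gc) => //; apply: (nab _ _ _ _).
Qed.

Lemma lab_segment i : lab (inl (i, true)) (inl (i, false)).
Proof. by case: (segment_inl i true). Qed.

Lemma vtx_fiber_card (S : {set vtx}) : (forall z, z \in S -> vown z = None) -> (#|S| <= 3)%N.
Proof.
move=> h; apply: leq_trans m_le3; rewrite -[X in (_ <= X)%N]card_ord.
rewrite -(card_imset (mem 'I_m) (@inr_inj ('I_n * bool) 'I_m)).
apply: subset_leq_card; apply/subsetP => -[[j b]|j] hz; first by have := h _ hz.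
by rewrite imset_f.
Qed.

Lemma vtx_generic : generic vown pos.
Proof.
have segdet i j k c : uniq [:: i; j; k] -> dot c (g i) = 0 -> dot c (g j) = 0 ->
    dot c (g k) = 0 -> c = 0.
  by move=> /(config_ggg gc) h *; apply: (det3_neq0_orth h); rewrite dotC.
have neqset x y z w : lab x y -> lab z w -> vown x != vown z -> [set x; y] != [set z; w].
  move=> /andP[/eqP exy _] _; apply: contraNneq => eS.
  have : z \in [set x; y] by rewrite eS set21.
  by case/set2P => ->; rewrite ?exy.
have hcross x y z w : lab x y -> lab z w -> [set x; y] != [set z; w] ->
    cross (pos x - pos y) (pos z - pos w) != 0.
  move=> l1 l2 ne; have [i /andP[ix iz]] := third_index (vown x) (vown z).
  apply: (@det3_neq0_crossl _ (pos (inl (i, true)) - pos (inl (i, false)))).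
  have ls := lab_segment i.
  by apply: (lab_det3 ls l1 l2) => //; [apply: (neqset _ _ _ _ ls l1) | apply: (neqset _ _ _ _ ls l2)].
split=> //.
- move=> c hT; pose i0 := @Ordinal n 0 (ltn_trans (isT : (0 < 2)%N) n3).
  have n2 : (1 < n)%N by apply: ltn_trans n3.
  have hz i : dot c (g i) = 0.
    have := @top_eq _ _ _ vown pos c (inl (i, true)) (inl (i, false)).
    by rewrite hT !inE /= dot0r => /(_ isT isT erefl).
  exact: (@segdet i0 (Ordinal n2) (Ordinal n3)).
(* An excess of three yields three labels, one vertex being removed after each. All three in the
   triangle would need four vertices there, so their directions are independent; but [c] is
   orthogonal to them. *)
- move=> c c0; rewrite leqNgt; apply/negP => hgt; set S := top vown pos c in hgt.
  have cI (S' : {set vtx}) : (#|[set vown x | x in S']| <= #|{: option 'I_n}|)%N by apply: max_card.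
  have [x1 [y1 [l1 x1S y1S]]] : exists x y, [/\ lab x y, x \in S & y \in S].
    by apply: collision; apply: leq_ltn_trans (cI _) _; apply: ltn_trans hgt; apply: ltnW.
  have c1 : (#|{: option 'I_n}|.+1 < #|S :\ y1|)%N by move: hgt; rewrite (cardsD1 y1 S) y1S add1n ltnS.
  have [x2 [y2 [l2 x2S y2S]]] : exists x y, [/\ lab x y, x \in S :\ y1 & y \in S :\ y1].
    by apply: collision; apply: leq_ltn_trans (cI _) _; apply: ltn_trans c1.
  have c2 : (#|{: option 'I_n}| < #|S :\ y1 :\ y2|)%N by move: c1; rewrite (cardsD1 y2 (S :\ y1)) y2S add1n ltnS.
  have [x3 [y3 [l3 x3S y3S]]] : exists x y, [/\ lab x y, x \in S :\ y1 :\ y2 & y \in S :\ y1 :\ y2].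
    by apply: collision; apply: leq_ltn_trans (cI _) _.
  have notin (y a b : vtx) (A : {set vtx}) x : a \in A :\ y -> b \in A :\ y -> [set x; y] != [set a; b].
    move=> ha hb; apply/negP => /eqP e; have : y \in [set a; b] by rewrite -e set22.
    by case/set2P => ey; [move: ha | move: hb]; rewrite ey !inE eqxx.
  have sub2 (a : vtx) : a \in S :\ y1 :\ y2 -> a \in S :\ y1 by rewrite !inE => /and3P[_ -> ->].
  have n12 := notin _ _ _ _ x1 x2S y2S.
  have n13 := notin _ _ _ _ x1 (sub2 _ x3S) (sub2 _ y3S).
  have n23 := notin _ _ _ _ x2 x3S y3S.
  have inS (a : vtx) : a \in S :\ y1 -> a \in S by rewrite inE => /andP[].
  have orth x y : lab x y -> x \in S -> y \in S -> dot (pos x - pos y) c = 0.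
    by move=> /andP[/eqP eo _] xS yS; rewrite dotC dotBr (top_eq xS yS eo) subrr.
  have hn : ~~ [&& vown x1 == None, vown x2 == None & vown x3 == None].
    apply/negP => /and3P[/eqP o1 /eqP o2 /eqP o3].
    have : (#|[set x3; y3] :|: [set y1; y2]| <= 3)%N.
      apply: vtx_fiber_card => z; rewrite !inE => /orP[/orP[]|/orP[]] /eqP -> //.
      - by case/andP: l3 => /eqP <-.
      - by case/andP: l1 => /eqP <-.
      - by case/andP: l2 => /eqP <-.
    rewrite cardsU (_ : _ :&: _ = set0).
      rewrite cards0 !cards2; case/andP: l3 => _ ->; move: y2S; rewrite !inE eq_sym.
      by case/andP => ->.
    apply/setP => z; rewrite !inE; apply/negP => /andP[/orP[]/eqP ->].
      by move: x3S; rewrite !inE => /and3P[/negPf -> /negPf ->].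
    by move: y3S; rewrite !inE => /and3P[/negPf -> /negPf ->].
  have := lab_det3 l1 l2 l3 n12 n13 n23 hn => hd.
  move/eqP: c0; apply; apply: (det3_neq0_orth hd).
  + exact: orth.
  + by apply: orth => //; apply: inS.
  + by apply: orth => //; apply/inS/sub2.
- move=> x y l; have [i /andP[ix _]] := third_index (vown x) (vown x).
  exists (inl (i, true)), (inl (i, false)); split; first exact: lab_segment.
  by apply: neqset => //; [apply: lab_segment | rewrite eq_sym].
- move=> x y z w l1 l2 ne; set e := cross _ _.
  have t1 (a : R) : dot (a *: e) (pos x) = dot (a *: e) (pos y).
    by apply/eqP; rewrite -subr_eq0 -dotBr dotC dotZr dot_crossl mulr0.
  have t2 (a : R) : dot (a *: e) (pos z) = dot (a *: e) (pos w).
    by apply/eqP; rewrite -subr_eq0 -dotBr dotC dotZr dot_crossr mulr0.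
  have segtop c p q : lab p q -> vown p != None -> dot c (pos p) = dot c (pos q) -> p \in top vown pos c.
    move=> l; case: (lab_cases g t l) => [[i [b [-> -> _]]] _ h|[a [b [-> _ _ _]]]] //.
    by apply/topP => v; rewrite /= => /(fiber_inl b) /set2P[] ->; rewrite ?h.
  suff [a a0 [xt zt]] : exists2 a : R, a != 0 & x \in top vown pos (a *: e) /\ z \in top vown pos (a *: e).
    have yt : y \in top vown pos (a *: e) by apply: top_tie xt _ (t1 a); case/andP: l1 => /eqP.
    have wt : w \in top vown pos (a *: e) by apply: top_tie zt _ (t2 a); case/andP: l2 => /eqP.
    by exists a => //; apply/subsetP => v; rewrite !inE => /orP[/orP[/orP[]|]|] /eqP ->.
  have one0 : (1 : R) != 0 by rewrite oner_eq0.
  (* If a third vertex of the triangle lies above [p] and [q], it lies below them for the opposite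
     functional. *)
  have orient p q : lab p q -> (forall a, dot (a *: e) (pos p) = dot (a *: e) (pos q)) ->
      exists2 a : R, a != 0 & p \in top vown pos (a *: e).
    move=> l ht; have [pn|pn] := eqVneq (vown p) None; last by exists 1 => //; apply: segtop (ht _).
    have [h|/topP h] := boolP (p \in top vown pos (1 *: e)); first by exists 1.
    have [v [ev hv]] : exists v, vown v = vown p /\ dot (1 *: e) (pos p) < dot (1 *: e) (pos v).
      apply: contrapT => hn; apply: h => v ev; rewrite leNgt; apply/negP => hlt.
      by apply: hn; exists v.
    exists (-1); first by rewrite oppr_eq0.
    apply/topP => v' ev'.
    have [->//|np] := eqVneq v' p.
    have [->|nq] := eqVneq v' q; first by rewrite ht.
    have [->|nv] := eqVneq v' v; first by move: hv; rewrite scale1r !dotZl; lra.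
    have np' : p != q by case/andP: l.
    have vp : v != p by apply: contraTneq hv => ->; rewrite ltxx.
    have vq : v != q by apply: contraTneq hv => ->; rewrite ht ltxx.
    have : (#|[set v'; v] :|: [set p; q]| <= 3)%N.
      apply: vtx_fiber_card => s; rewrite !inE => /orP[/orP[]|/orP[]] /eqP -> //.
      - by rewrite ev'.
      - by rewrite ev.
      - by case/andP: l => /eqP <-.
    rewrite cardsU !cards2 nv np' (_ : _ :&: _ = set0) ?cards0 //.
    by apply/setP => s; rewrite !inE; apply/negP => /andP[/orP[]/eqP ->];
      rewrite ?(negPf np) ?(negPf nq) ?(negPf vp) ?(negPf vq).
  have [xn|xn] := eqVneq (vown x) None; last first.
    by have [a a0 zt] := orient _ _ l2 t2; exists a => //; split=> //; apply: segtop (t1 a).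
  have [zn|zn] := eqVneq (vown z) None; last first.
    by have [a a0 xt] := orient _ _ l1 t1; exists a => //; split=> //; apply: segtop (t2 a).
  have yn : vown y = None by case/andP: l1 => /eqP <-.
  have wn : vown w = None by case/andP: l2 => /eqP <-.
  have xy : x != y by case/andP: l1.
  have zw : z != w by case/andP: l2.
  (* Two distinct edges of the triangle share a vertex and cover the triangle, so [e] is constant on
     it. *)
  have meet : exists2 v, v \in [set x; y] & v \in [set z; w].
    apply: contrapT => hn; have : (#|[set x; y] :|: [set z; w]| <= 3)%N.
      by apply: vtx_fiber_card => s; rewrite !inE => /orP[/orP[]|/orP[]] /eqP ->.
    rewrite cardsU !cards2 xy zw (_ : _ :&: _ = set0) ?cards0 //.
    by apply/setP => s; rewrite !inE; apply/negP => /andP[s1 s2]; apply: hn; exists s; rewrite !inE.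
  have cover v : vown v = None -> v \in [set x; y] :|: [set z; w].
    move=> vn; apply: contrapT => /negP hv.
    have : (#|v |: ([set x; y] :|: [set z; w])| <= 3)%N.
      by apply: vtx_fiber_card => s; rewrite !inE => /orP[|/orP[/orP[]|/orP[]]] /eqP ->.
    rewrite cardsU1 hv add1n ltnS leqNgt => /negP; apply.
    have : [set x; y] \proper [set x; y] :|: [set z; w].
      rewrite properE subsetUl /=; apply: contra ne => hs; rewrite eq_sym eqEcard.
      apply/andP; split; first exact: subset_trans (subsetUr _ _) hs.
      by rewrite !cards2 xy zw.
    by move=> /proper_card; rewrite cards2 xy.
  have allx v : vown v = None -> dot (1 *: e) (pos v) = dot (1 *: e) (pos x).
    have [v0 /set2P h1 /set2P h2] := meet.
    have xz : dot (1 *: e) (pos x) = dot (1 *: e) (pos z).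
      have v1 : dot (1 *: e) (pos v0) = dot (1 *: e) (pos x) by case: h1 => ->; rewrite ?t1.
      by rewrite -v1; case: h2 => ->; rewrite ?t2.
    by move=> /cover; rewrite !inE => /orP[/orP[]|/orP[]] /eqP -> //; rewrite ?xz ?t2 // -t1.
  by exists 1 => //; split; apply/topP => v; rewrite ?xn ?zn => /allx ->; rewrite // allx.
Qed.

(* This is 2n for [m = 1] and 2n + 3 for [m = 3]. *)
Lemma card_good_pairs u : u != 0 -> ~ plane_orth_facet (minkowski vown pos) u ->
  #|good_pairs vown pos u| = (n.*2 + m - (m == 1%N))%N.
Proof.
move=> u0 hu.
pose f (p : 'I_n * bool) : vtx * vtx := (inl p, inl (p.1, ~~ p.2)).
pose h (p : 'I_m * 'I_m) : vtx * vtx := (inr p.1, inr p.2).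
pose W := [set p : 'I_m * 'I_m | h p \in good_pairs vown pos u].
have -> : good_pairs vown pos u = [set f p | p in [set: 'I_n * bool]] :|: [set h p | p in W].
  apply/setP => -[x y]; rewrite inE [in RHS]inE; apply/idP/orP.
    move=> hg; have /andP[l _] := hg.
    case: (lab_cases g t l) => [[i [b [ex ey _]]]|[a [b [ex ey ab _]]]].
      by left; apply/imsetP; exists (i, b); rewrite ?inE // /f /= -ex -ey.
    right; apply/imsetP; exists (a, b); last by rewrite /h /= -ex -ey.
    by rewrite inE /h /= -ex -ey inE.
  case=> /imsetP[p].
    case: p => i b _ [-> ->] /=; have [l fib] := segment_inl i b; rewrite l /=.
    apply/topP => z /fib /set2P[] -> //.
    by rewrite (ray_tie pos u (inl (i, b), inl (i, ~~ b))).
  by rewrite inE => hp [-> ->]; move: hp; rewrite inE.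
rewrite cardsU (_ : _ :&: _ = set0); last first.
  by apply/setP => z; rewrite !inE; apply/negP => /andP[/imsetP[p _ ->] /imsetP[q _]].
rewrite cards0 subn0 card_imset; last by move=> [i b] [j c] [-> ->].
rewrite card_imset; last by move=> [a b] [a' b'] [-> ->].
rewrite cardsT card_prod card_ord card_bool muln2 -addnBA; last by case: m13 => ->.
congr (_ + _)%N.
pose N := [set p : 'I_m * 'I_m | p.1 != p.2].
pose sw (p : 'I_m * 'I_m) := (p.2, p.1).
have swK : involutive sw by case.
have WN : W \subset N.
  by apply/subsetP => -[a b]; rewrite !inE /= => /andP[/andP[_ ab] _]; apply: contraNneq ab => ->.
(* Exactly one orientation of each triangle edge is outward, since after projection the third vertex
   is strictly on one side. For segments both orientations count, whence [n.*2]. *)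
have NW : N :\: W = [set sw p | p in W].
  have main a b : a != b -> ((a, b) \in W) = ((b, a) \notin W).
    move=> ab.
    have l1 : lab (inr a) (inr b) by apply/andP; split=> //; apply: contraNneq ab => -[->].
    have l2 : lab (inr b) (inr a) by rewrite lab_sym.
    rewrite !inE /h /= l1 l2 /=.
    have [c /andP[ca cb] fib] : exists2 c : 'I_m, (c != a) && (c != b) & forall z : vtx, vown z = None -> z \in [set inr a; inr b; inr c].
      have m3 := ord_m3 ab.
      have : (0 < #|~: [set a; b]|)%N by rewrite cardsCs setCK card_ord cards2 ab m3.
      rewrite card_gt0 => /set0Pn[c]; rewrite !inE negb_or => hc; exists c => //.
      have full : [set a; b; c] = setT.
        apply/eqP; rewrite eqEcard subsetT cardsT card_ord setUC cardsU1 cards2 ab.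
        by rewrite !inE negb_or hc /=; apply: m_le3.
      case=> [[j d]|j] // _; have : j \in [set a; b; c] by rewrite full inE.
      by rewrite !inE => /orP[/orP[]|] /eqP ->; rewrite eqxx ?orbT.
    have lac : lab (inr a) (inr c) by apply/andP; split=> //; apply: contraNneq ca => -[->].
    have ne : [set (inr a : vtx); inr b] != [set inr a; inr c].
      apply/negP => /eqP e; have : (inr c : vtx) \in [set inr a; inr b] by rewrite e set22.
      by rewrite !inE => /orP[] /eqP -[] /eqP; rewrite ?(negPf ca) ?(negPf cb).
    have := lab_det vown_surj vtx_generic hu l1 lac ne => /= hd.
    have topE x y : (x, y) = (a, b) \/ (x, y) = (b, a) ->
      ((inr x : vtx) \in top vown pos (ray pos u (inr x, inr y))) =
      (dot (ray pos u (inr x, inr y)) (t c) <= dot (ray pos u (inr x, inr y)) (t x)).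
      move=> hxy; have tie := ray_tie pos u (inr x, inr y); rewrite /= in tie.
      apply/topP/idP => [/(_ (inr c) erefl)//|hle z /= /fib].
      case: hxy tie hle => -[-> ->] tie hle.
        by rewrite !inE => /orP[/orP[]|] /eqP -> //=; rewrite tie.
      by rewrite !inE => /orP[/orP[]|] /eqP -> //=; rewrite tie.
    rewrite !topE; [| by right | by left].
    have r2 : ray pos u (inr b, inr a) = - ray pos u (inr a, inr b).
      by rewrite /ray /= -crossNr opprB.
    have tie := ray_tie pos u (inr a, inr b); rewrite /= in tie.
    rewrite r2 !dotNl lerN2 -tie -ltNge le_eqVlt orbC; apply: orb_idr => /eqP e.
    exfalso; move/eqP: hd; apply.
    have -> : det3 u (t a - t b) (t a - t c) = dot (ray pos u (inr a, inr b)) (t a - t c).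
      by rewrite /ray /= /det3 !vecE; ring.
    by rewrite dotBr e subrr.
  apply/setP => -[a b]; rewrite in_setD; apply/andP/imsetP.
    move=> [nW]; rewrite inE /= => ab; exists (b, a) => //.
    by rewrite main // eq_sym.
  move=> [[b' a'] hW [-> ->]]; have := subsetP WN _ hW; rewrite inE /= => ba.
  by split; [rewrite -main | rewrite inE /= eq_sym].
have cW : #|N| = (#|W| + #|W|)%N.
  rewrite -(cardsID W N) (setIidPr WN) NW card_imset //; exact: inv_inj swK.
have cN : #|N| = (m * m - m)%N.
  have -> : N = ~: [set (a, a) | a in [set: 'I_m]].
    apply/setP => -[a b]; rewrite !inE /=; congr (~~ _); apply/eqP/imsetP => [->|[c _ [-> ->]]] //.
    by exists b; rewrite ?inE.
  by rewrite cardsCs setCK card_prod card_ord card_imset ?cardsT ?card_ord // => a b [].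
by move: cW; rewrite cN; move: #|W| => w; case: m13 => ->; clear; lia.
Qed.

Lemma summands_equiprojective : equiprojective (minkowski vown pos) (n.*2 + m - (m == 1%N)).
Proof.
split.
  exists (minkowski_vertices vown pos); split=> //.
  have n2 : (1 < n)%N by apply: ltn_trans n3.
  have n1 : (0 < n)%N by apply: ltn_trans n2.
  pose s : {ffun option 'I_n -> vtx} :=
    [ffun o => if o is Some i then inl (i, false) else inr (Ordinal m_gt0)].
  have hs : sel vown s by apply/selP => -[i|]; rewrite ffunE.
  have hm i : minkowski vown pos (vsum pos (upd vown s (inl (i, true)))).
    by apply/minkowski_vsum/sel_upd.
  have hd i : vsum pos (upd vown s (inl (i, true))) - vsum pos s = g i.
    by rewrite vsum_upd addrC addKr /= ffunE subr0.
  exists (vsum pos s), (vsum pos (upd vown s (inl (Ordinal n1, true)))),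
    (vsum pos (upd vown s (inl (Ordinal n2, true)))),
    (vsum pos (upd vown s (inl (Ordinal n3, true)))).
  split=> //; first exact: minkowski_vsum.
  by apply: aff_indep4_det; rewrite !hd; apply: (config_ggg gc).
move=> u u0 hu; rewrite -(card_good_pairs u0 hu).
exact: (num_vertices_proj vown_surj vtx_generic).
Qed.

End OneConfig.

(** The sign of [dot c (g i)] as two booleans, both true at zero: this form says which ends of the
    segment from 0 to [g i] lie in the face. *)
Definition code (g : 'I_n -> pt) (c : pt) (i : 'I_n) : bool * bool :=
  (dot c (g i) <= 0, 0 <= dot c (g i)).

Lemma code_top g t c i :
  (inl (i, false) \in top vown (vpos g t) c, inl (i, true) \in top vown (vpos g t) c) = code g c i.
Proof.
congr (_, _).
  apply/topP/idP => [/(_ (inl (i, true)) erefl)|h z /(fiber_inl true) /set2P[] ->] /=;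
  by rewrite ?dot0r.
apply/topP/idP => [/(_ (inl (i, false)) erefl)|h z /(fiber_inl true) /set2P[] ->] /=;
by rewrite ?dot0r.
Qed.

Lemma comb_type_face_rel (U I : finType) (own : U -> I) (pos pos' : U -> pt) :
  (forall i, exists x, own x = i) ->
  same_comb_type (minkowski own pos) (minkowski own pos') ->
  exists r, face_rel own pos pos' r.
Proof.
move=> surj [f [f' [hf hf' ff' f'f ord]]].
pose F (p : U -> pt) (c : pt) : set pt := face_of_dir (minkowski own p) c.
have facF (p : U -> pt) c : face (minkowski own p) (F p c) by right; exists c.
have fac0 (p : U -> pt) : face (minkowski own p) classical_sets.set0 by left.
have ne (p : U -> pt) c : F p c <> classical_sets.set0.
  by have [x hx] := face_dir_nonempty surj p c => e; have : F p c x by []; rewrite e.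
(* The empty set is a face too, which [face_rel] leaves out; being the least face, it is
   preserved. *)
have f0 : f classical_sets.set0 = classical_sets.set0.
  have := (ord classical_sets.set0 (f' classical_sets.set0) (fac0 _) (hf' _ (fac0 _))).1.
  rewrite f'f; last exact: fac0.
  by move=> h; apply/seteqP; split=> //; apply: h.
exists (fun c c' => f (F pos c) = F pos' c'); split.
- move=> c; have [e|[c' ->]] := hf _ (facF pos c); last by exists c'.
  case: (ne pos c); rewrite -(ff' (F pos c)) // e -f0 ff' //.
- move=> c'; have [e|[c e]] := hf' _ (facF pos' c').
    case: (ne pos' c'); by rewrite -(f'f (F pos' c')) // e f0.
  by exists c; rewrite -[F pos c]e f'f.
- move=> c1 c1' c2 c2' e1 e2; apply/idP/idP => h.
    apply/(face_dir_subset surj); rewrite -[face_of_dir _ c1']e1 -[face_of_dir _ c2']e2.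
    by apply/(ord _ _ (facF _ _) (facF _ _))/(face_dir_subset surj).
  apply/(face_dir_subset surj)/(ord _ _ (facF _ _) (facF _ _)); rewrite e1 e2.
  by apply/(face_dir_subset surj).
Qed.

Theorem comb_type_codes g t g' t' : generic_config g t -> generic_config g' t' ->
  same_comb_type (minkowski vown (vpos g t)) (minkowski vown (vpos g' t')) ->
  exists D : {ffun 'I_n -> 'I_n * (bool * bool)}, forall X : {ffun 'I_n -> bool * bool},
    (exists c, forall i, X i = code g' c i) <->
    (exists c, forall i, X i = sign_rule (D i).2 (code g c (D i).1)).
Proof.
move=> gc gc' /(comb_type_face_rel vown_surj)[r fr].
have g1 := vtx_generic gc; have g2 := vtx_generic gc'.
have /choice[D hD] : forall i, exists d : 'I_n * (bool * bool), forall c c', r c c' ->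
    code g' c' i = sign_rule d.2 (code g c d.1).
  move=> i; have [x [y [[t1 t2] [sg h]]]] := rel_signs vown_surj g1 g2 fr (segment_inl i false).
  case: (lab_cases g t sg.1) => [[j [b [ex ey _]]]|[a [b [ex ey ab _]]]]; last first.
    exfalso; have m3 := ord_m3 ab.
    have : (0 < #|~: [set a; b]|)%N by rewrite cardsCs setCK card_ord cards2 ab m3.
    rewrite card_gt0 => /set0Pn[c]; rewrite !inE negb_or => /andP[ca cb].
    have [_ /(_ (inr c))] := sg; rewrite ex ey /= => /(_ erefl).
    by rewrite !inE => /orP[] /eqP [] /eqP; rewrite ?(negPf ca) ?(negPf cb).
  (* If [b] holds, [x] is the end [g j], whereas [code] lists the end 0 first. *)
  exists (j, if b then (t2, t1) else (t1, t2)) => c c' rc; rewrite -(code_top g t) -(code_top g' t').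
  rewrite (h _ _ rc) ex ey; have := segment_or vown_surj (vpos g t) c (segment_inl j b).
  by case: b {ex ey h} => /=; case: (inl (j, true) \in _); case: (inl (j, false) \in _).
exists [ffun i => D i] => X; split=> -[c hc].
  have [c0 rc] := rel_onto fr c; exists c0 => i; rewrite hc ffunE; exact: hD.
by have [c1 rc] := rel_total fr c; exists c1 => i; rewrite hc ffunE (hD i _ _ rc).
Qed.

End Summands.

(** * Growing a configuration *)


Section Tree.
Variable R : realType.
Notation pt := 'rV[R]_3.
Implicit Types (s B : seq pt) (a b c d e f p v w : pt).

(** The lowest nonzero coefficient decides the sign for small [t]. *)
Lemma small_pos_sign (x y z : R) : ~ [/\ x = 0, y = 0 & z = 0] ->
  small_pos (fun t => [/\ x + t * y + t ^+ 2 * z != 0,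
    0 < x -> 0 < x + t * y + t ^+ 2 * z & x < 0 -> x + t * y + t ^+ 2 * z < 0]).
Proof.
have neg (x' y' z' : R) t : - x' + t * - y' + t ^+ 2 * - z' = - (x' + t * y' + t ^+ 2 * z') by ring.
move=> h; have [x0|x0|x0] := ltgtP x 0.
- have mx0 : 0 < - x by rewrite oppr_gt0.
  have [e e0 he] := small_pos_quadratic (- y) (- z) mx0.
  exists e => // t t0 te; have := he t t0 te; rewrite neg oppr_gt0 => hl.
  by split=> //; rewrite ?lt_eqF.
- have [e e0 he] := small_pos_quadratic y z x0.
  by exists e => // t t0 te; have hl := he t t0 te; split; rewrite ?gt_eqF.
- have step (y1 z1 : R) : 0 < y1 -> small_pos (fun t => 0 < t * y1 + t ^+ 2 * z1).
    move=> y0; have [e e0 he] := small_pos_quadratic z1 0 y0.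
    exists e => // t t0 te; have := he t t0 te; rewrite mulr0 addr0 => hl.
    by have -> : t * y1 + t ^+ 2 * z1 = t * (y1 + t * z1); [ring | rewrite mulr_gt0].
  suff [e e0 he] : small_pos (fun t => t * y + t ^+ 2 * z != 0).
    by exists e => // t t0 te; rewrite x0 add0r ?ltxx; split=> //; apply: he.
  have [y0|y0|y0] := ltgtP y 0.
  + have y0' : 0 < - y by rewrite oppr_gt0.
    have [e e0 he] := step (- y) (- z) y0'.
    exists e => // t t0 te; have := he t t0 te; rewrite !mulrN -opprD oppr_gt0 => hl.
    by rewrite lt_eqF.
  + have [e e0 he] := step y z y0.
    by exists e => // t t0 te; rewrite gt_eqF ?he.
  + apply: small_posT => t t0; rewrite y0 mulr0 add0r mulf_neq0 //; first by rewrite expf_neq0 // gt_eqF.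
    by apply/eqP => z0; apply: h.
Qed.

(* The point is taken on a parabola-like curve through the crossing [v] of the two lines, so
   that every nonzero linear functional is nonzero on it for small parameters. *)
Lemma near_generic (w1 w2 : pt) (s1 s2 k : R) B : cross w1 w2 != 0 -> s1 != 0 -> s2 != 0 ->
  k != 0 -> let v := k *: cross w1 w2 in
  exists p, [/\ 0 < s1 * dot w1 p, 0 < s2 * dot w2 p,
    forall w, w \in B -> w != 0 -> dot w p != 0,
    forall w, w \in B -> 0 < dot w v -> 0 < dot w p &
    forall w, w \in B -> dot w v < 0 -> dot w p < 0].
Proof.
move=> v00 s10 s20 k0; set v0 := cross w1 w2 => v.
(* On [q] the functionals [w1] and [w2] take the signs of [s1] and [s2], so [q] points from [v] into
   the wanted sector. The later [r] completes [v], [q] to a basis. *)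
pose q := s1 *: cross w2 v0 + s2 *: cross v0 w1.
have N0 := dot_gt0 v00; rewrite -/v0 in N0.
have q1 : dot w1 q = s1 * dot v0 v0.
  by rewrite /q /v0 dotDr !dotZr !vecE; ring.
have q2 : dot w2 q = s2 * dot v0 v0.
  by rewrite /q /v0 dotDr !dotZr !vecE; ring.
have vq : dot v q = 0 by rewrite /v /q dotDr !dotZr !dotZl dot_crossr dot_crossl !mulr0 addr0.
have q0 : q != 0.
  apply/eqP => h; move: q1; rewrite h dot0r => /esym/eqP.
  by rewrite mulf_eq0 (negPf s10) gt_eqF.
have v_neq0 : v != 0 by rewrite scaler_eq0 negb_or k0.
pose r := cross v q.
have hdet : det3 v q r != 0.
  have -> : det3 v q r = dot v v * dot q q - dot v q ^+ 2.
    by rewrite -dot_cross_cross /det3 /r !vecE; ring.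
  by rewrite vq expr0n /= subr0 mulf_neq0 ?dot_eq0.
have v1 : dot w1 v = 0 by rewrite /v dotZr dot_crossl mulr0.
have v2 : dot w2 v = 0 by rewrite /v dotZr dot_crossr mulr0.
pose p t := v + t *: q + t ^+ 2 *: r.
have pE t w : dot w (p t) = dot w v + t * dot w q + t ^+ 2 * dot w r.
  by rewrite /p (dotDr w (v + t *: q)) (dotDr w v) (dotZr t w q) (dotZr (t ^+ 2) w r).
have cond (w : pt) (x : R) : dot w v = 0 -> dot w q = x * dot v0 v0 -> x != 0 ->
    small_pos (fun t => 0 < x * dot w (p t)).
  move=> wv wq x0.
  have h0 : 0 < x * dot w q by rewrite wq mulrA mulr_gt0 // lt_def mulf_neq0 //= -expr2 sqr_ge0.
  have [e e0 he] := small_pos_quadratic (x * dot w r) 0 h0.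
  exists e => // t t0 te; have := he t t0 te; rewrite pE wv add0r mulr0 addr0 => hl.
  have -> : x * (t * dot w q + t ^+ 2 * dot w r) = t * (x * dot w q + t * (x * dot w r)) by ring.
  by rewrite mulr_gt0.
have hB : small_pos (fun t => forall w, w \in [seq w <- B | w != 0] ->
   [/\ dot w (p t) != 0, 0 < dot w v -> 0 < dot w (p t) & dot w v < 0 -> dot w (p t) < 0]).
  apply: small_pos_seq => w; rewrite mem_filter => /andP[w0 _].
  have [|e e0 he] := @small_pos_sign (dot w v) (dot w q) (dot w r).
    move=> [h1 h2 h3]; move/eqP: w0; apply; apply: (det3_neq0_orth hdet); by rewrite dotC.
  by exists e => // t t0 te; rewrite pE; apply: he.
have [t t0 [h1 [h2 h3]]] := small_pos_ex (small_pos_and (cond w1 s1 v1 q1 s10)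
   (small_pos_and (cond w2 s2 v2 q2 s20) hB)).
have hw w : w \in B -> w != 0 -> w \in [seq w <- B | w != 0] by rewrite mem_filter => -> ->.
exists (p t); split=> // w wB.
- by move=> /(hw w wB) /h3[].
- move=> hv; have w0 : w != 0 by apply: contraTneq hv => ->; rewrite dot0l ltxx.
  by have [_ H _] := h3 _ (hw w wB w0); apply: H.
- move=> hv; have w0 : w != 0 by apply: contraTneq hv => ->; rewrite dot0l ltxx.
  by have [_ _ H] := h3 _ (hw w wB w0); apply: H.
Qed.

Lemma avoid B : exists p, forall w, w \in B -> w != 0 -> dot w p != 0.
Proof.
have h : cross (mkv 1 0 0) (mkv 0 1 0 : pt) != 0.
  apply/eqP => /(congr1 (@cz R)); rewrite !vecE => /eqP.
  by rewrite !mulr0 mulr1 subr0 oner_eq0.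
have [p [_ _ hp _ _]] := near_generic B h (oner_neq0 R) (oner_neq0 R) (oner_neq0 R).
by exists p.
Qed.

Definition triple_generic s := forall a b c, a \in s -> b \in s -> c \in s ->
  uniq [:: a; b; c] -> det3 a b c != 0.

Definition lines_generic s := forall a b c d e f,
  a \in s -> b \in s -> c \in s -> d \in s -> e \in s -> f \in s ->
  uniq [:: a; b; c; d; e; f] -> det3 (cross a b) (cross c d) (cross e f) != 0.

Definition connecting s : seq pt := [seq cross a b | a <- s, b <- s].
(** The joining lines, and the lines from a point of [s] to a crossing of two joining lines: a new
    point off all of them keeps both genericity conditions. Degenerate entries are zero vectors,
    which [avoids] skips. *)
Definition to_avoid s : seq pt :=
  connecting s ++
  [seq cross b z | b <- s, z <- [seq cross w w' | w <- connecting s, w' <- connecting s]].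

Lemma connecting_mem s a b : a \in s -> b \in s -> cross a b \in connecting s.
Proof. by move=> *; apply: allpairs_f. Qed.

Definition avoids s p := forall w, w \in to_avoid s -> w != 0 -> dot w p != 0.

Lemma avoids_extend s p : uniq s -> (2 < size s)%N -> triple_generic s -> lines_generic s ->
  avoids s p -> [/\ uniq (p :: s), triple_generic (p :: s) & lines_generic (p :: s)].
Proof.
move=> us s3 hT hL hp.
have other a b : a \in s -> b \in s -> exists2 c, c \in s & (c != a) && (c != b).
  move=> _ _; apply: contrapT => hn.
  have : {subset s <= [:: a; b]}.
    move=> c cs; rewrite !inE; apply: contrapT => /negP hc; apply: hn.
    by exists c => //; rewrite -negb_or.
  by move=> /(uniq_leq_size us) /= h; have := leq_trans s3 h.
have cross0 a b : a \in s -> b \in s -> a != b -> cross a b != 0.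
  move=> ha hb ab; have [c hc /andP[ca cb]] := other a b ha hb.
  apply: (@det3_neq0_crossl _ c); apply: hT => //.
  by rewrite /= !inE negb_or ca cb ab.
have pT a b : a \in s -> b \in s -> a != b -> dot (cross a b) p != 0.
  move=> ha hb ab; apply: hp; last exact: cross0.
  by rewrite mem_cat connecting_mem.
have ps : p \notin s.
  apply/negP => hps; have [c hc /andP[cp _]] := other p p hps hps.
  by have := pT _ _ hc hps cp; rewrite dotC dot_crossr eqxx.
have pL b c d e f : b \in s -> c \in s -> d \in s -> e \in s -> f \in s ->
    uniq [:: b; c; d; e; f] -> det3 (cross p b) (cross c d) (cross e f) != 0.
  move=> hb hc hd he hf hu.
  have -> : det3 (cross p b) (cross c d) (cross e f)
     = dot (cross b (cross (cross c d) (cross e f))) p.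
    by move: (cross c d) (cross e f) => w w'; rewrite /det3 !vecE; ring.
  apply: hp.
    rewrite mem_cat; apply/orP; right; apply: allpairs_f => //.
    by apply: allpairs_f; apply: connecting_mem.
  (* This functional is nonzero because its value at [e] is a product of two nonzero brackets. *)
  apply/eqP => h0.
  have : dot e (cross b (cross (cross c d) (cross e f))) = det3 c d e * det3 b e f.
    by rewrite /det3 !vecE; ring.
  rewrite h0 dot0r => /esym/eqP; rewrite mulf_eq0.
  move: hu; rewrite /= !inE !negb_or.
  move=> /and5P[/and4P[bc bd be bf] /and3P[cd ce cf] /andP[de df] ef _].
  by case/orP; apply/negP; apply: hT => //; rewrite /= !inE negb_or ?cd ?ce ?de ?be ?bf ?ef.
have memP x : x \in p :: s -> x != p -> x \in s by rewrite inE => /orP[/eqP ->|//]; rewrite eqxx.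
split.
- by rewrite /= ps.
- move=> a b c ha hb hc; rewrite /= !inE negb_or andbT => /andP[/andP[ab ac] bc].
  have [ep|ap] := eqVneq a p.
    by subst a; rewrite /det3 dotC; apply: pT => //; apply: memP => //; rewrite eq_sym.
  have [ep|bp] := eqVneq b p.
    subst b; rewrite det3C /det3 dotC; apply: pT; rewrite 1?eq_sym //; apply: memP => //.
    by rewrite eq_sym.
  have [ep|cp] := eqVneq c p.
    by subst c; rewrite -det3C /det3 dotC; apply: pT => //; apply: memP.
  by apply: hT; try exact: memP; rewrite /= !inE negb_or ab ac bc.
- move=> a b c d e f ha hb hc hd he hf hu.
  have flip x y z w : det3 (cross y x) z w != 0 -> det3 (cross x y) z w != 0.
    by rewrite [cross x y]crossN det3Nl oppr_eq0.
  have cyc x y z : det3 x y z != 0 -> det3 y z x != 0 by rewrite det3C.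
  move: (hu); rewrite /= !inE !negb_or.
  move=> /and5P[/and5P[ab ac ad ae af] /and4P[bc bd be bf] /and3P[cd ce cf] /andP[de df] /andP[ef _]].
  have [ep|ap] := eqVneq a p.
    subst a; apply: pL; try (by apply: memP => //; rewrite eq_sym);
    by rewrite /= !inE !negb_or bc bd be bf cd ce cf de df ef.
  have [ep|bp] := eqVneq b p.
    subst b; apply: flip; apply: pL; try (by apply: memP => //; rewrite eq_sym);
    by rewrite /= !inE !negb_or ?ac ?ad ?ae ?af cd ce cf de df ef.
  have [ep|cp] := eqVneq c p.
    subst c; apply: (cyc _ _ _); apply: (cyc _ _ _).
    apply: pL; try (by apply: memP => //; rewrite eq_sym).
    by rewrite /= !inE !negb_or de df ef (eq_sym d) (eq_sym d) ad bd (eq_sym e) ae (eq_sym e) be (eq_sym f) af (eq_sym f) bf ab.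
  have [ep|dp] := eqVneq d p.
    subst d; apply: (cyc _ _ _); apply: (cyc _ _ _); apply: flip.
    apply: pL; try (by apply: memP => //; rewrite eq_sym).
    by rewrite /= !inE !negb_or ce cf ef (eq_sym c) (eq_sym c) ac bc (eq_sym e) ae (eq_sym e) be (eq_sym f) af (eq_sym f) bf ab.
  have [ep|ep] := eqVneq e p.
    subst e; apply: (cyc _ _ _).
    apply: pL; try (by apply: memP => //; rewrite eq_sym).
    by rewrite /= !inE !negb_or (eq_sym f a) (eq_sym f b) (eq_sym f c) (eq_sym f d) af bf cf df ab ac ad bc bd cd.
  have [fp|fp] := eqVneq f p.
    subst f; apply: (cyc _ _ _); apply: flip.
    apply: pL; try (by apply: memP => //; rewrite eq_sym).
    by rewrite /= !inE !negb_or (eq_sym e a) (eq_sym e b) (eq_sym e c) (eq_sym e d) ae be ce de ab ac ad bc bd cd.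
  by apply: hL => //; apply: memP.
Qed.

End Tree.

(** * A large family of configurations *)


Section Family.
Variable R : realType.
Notation pt := 'rV[R]_3.
Implicit Types (s B : seq pt) (p v w : pt).

(** In the chart [cz = 1], [mkv 0 1 0] and [mkv 1 0 0] are the vertical and the horizontal point at
    infinity. Genericity with respect to them says that no line joining two other points is vertical
    and that no crossing of two such disjoint lines lies at infinity, so leftmost points make
    sense. *)
Definition frame : seq pt := [:: mkv 0 0 1; mkv 0 1 0; mkv 1 0 0].

Definition ok s := [/\ uniq s, triple_generic s, lines_generic s & exists r, s = r ++ frame].

Lemma ok_frame : ok frame.
Proof.
have e12 : (mkv 0 0 1 : pt) != mkv 0 1 0.
  by apply/eqP => /(congr1 (@cy R)); rewrite !vecE => /eqP; rewrite eq_sym oner_eq0.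
have e13 : (mkv 0 0 1 : pt) != mkv 1 0 0.
  by apply/eqP => /(congr1 (@cx R)); rewrite !vecE => /eqP; rewrite eq_sym oner_eq0.
have e23 : (mkv 0 1 0 : pt) != mkv 1 0 0.
  by apply/eqP => /(congr1 (@cx R)); rewrite !vecE => /eqP; rewrite eq_sym oner_eq0.
split; last by exists [::].
- by rewrite /= !inE negb_or e12 e13 e23.
- have one x : x = 1 \/ x = -1 -> x != 0 :> R by case=> ->; rewrite ?oppr_eq0 oner_eq0.
  move=> a b c ha hb hc; rewrite /= !inE negb_or andbT => /andP[/andP[ab ac] bc].
  move: ha hb hc ab ac bc; rewrite !inE.
  move=> /or3P[]/eqP -> /or3P[]/eqP -> /or3P[]/eqP -> ab ac bc;
    try (by rewrite eqxx in ab); try (by rewrite eqxx in ac); try (by rewrite eqxx in bc);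
    apply: one; rewrite /det3 !vecE; first [by left; ring | by right; ring].
- move=> a b c d e f ha hb hc hd he hf hu.
  suff sub : {subset [:: a; b; c; d; e; f] <= frame} by have := uniq_leq_size hu sub.
  by apply/allP; rewrite /= ha hb hc hd he hf.
Qed.

(* The four blocks of indices avoid the two points at infinity of [frame], whence [m - 2]; the
   [maxn] covers the small [m] for which the blocks are empty. *)
Definition kids (m : nat) := maxn 1 (((m - 2) %/ 4) ^ 4).

Definition sep s p p' := exists a b, [/\ a \in s, b \in s &
  dot (cross a b) p * dot (cross a b) p' < 0].

Section Indexed.
Variable s : seq pt.
Hypotheses (us : uniq s) (hT : triple_generic s) (hL : lines_generic s).
Notation N := (nth 0 s).

Lemma uniq_nth (l : seq nat) : uniq l -> all (fun i => i < size s)%N l -> uniq (map N l).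
Proof.
move=> ul /allP hl; rewrite map_inj_in_uniq // => i j /hl hi /hl hj /eqP.
by rewrite nth_uniq // => /eqP.
Qed.

Lemma nth_triple (i j k : nat) : (i < size s)%N -> (j < size s)%N -> (k < size s)%N ->
  uniq [:: i; j; k] -> det3 (N i) (N j) (N k) != 0.
Proof.
move=> hi hj hk hu; apply: hT; rewrite ?mem_nth //.
by apply: (uniq_nth hu); rewrite /= hi hj hk.
Qed.

(* Lines through a common point factor the determinant into two brackets. *)
Lemma nth_lines (a b a' b' c d : nat) : uniq [:: a; b; c; d] -> uniq [:: a'; b'; c; d] ->
  a != b' -> b != a' -> (a, b) != (a', b') ->
  all (fun i => i < size s)%N [:: a; b; a'; b'; c; d] ->
  det3 (cross (N a) (N b)) (cross (N a') (N b')) (cross (N c) (N d)) != 0.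
Proof.
rewrite /= !inE !negb_or !andbT xpair_eqE negb_and.
move=> /and3P[/and3P[ab ac ad] /andP[bc bd] cd] /and3P[/and3P[ab' ac' ad'] /andP[bc' bd'] _] anb bna ne.
move=> /and5P[la lb la' lb' /andP[lc ld]].
have [ea|na] := eqVneq a a'.
  subst a'; have nb : b != b' by move: ne; rewrite eqxx.
  have -> : det3 (cross (N a) (N b)) (cross (N a) (N b')) (cross (N c) (N d))
     = det3 (N a) (N b) (N b') * det3 (N a) (N c) (N d).
    by move: (N a) (N b) (N b') (N c) (N d) => *; rewrite /det3 !vecE; ring.
  by rewrite mulf_neq0 //; apply: nth_triple; rewrite //= !inE !negb_or ?ab ?ab' ?nb ?ac ?ad ?cd.
have [eb|nb] := eqVneq b b'.
  subst b'.
  have -> : det3 (cross (N a) (N b)) (cross (N a') (N b)) (cross (N c) (N d))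
     = det3 (N b) (N a) (N a') * det3 (N b) (N c) (N d).
    by move: (N a) (N b) (N a') (N c) (N d) => *; rewrite /det3 !vecE; ring.
  by rewrite mulf_neq0 //; apply: nth_triple; rewrite //= !inE !negb_or ?bna ?bc ?bd ?cd ?na 1?eq_sym ?ab.
apply: hL; rewrite ?mem_nth //.
apply: (uniq_nth (l := [:: a; b; a'; b'; c; d])).
  by rewrite /= !inE !negb_or ab na anb ac ad bna nb bc bd ab' ac' ad' bc' bd' cd.
by rewrite /= la lb la' lb' lc ld.
Qed.

End Indexed.

(** The four ends come from four disjoint blocks of indices, so any two choices fall under
    [nth_lines] and different choices have different crossings. If two of the new points lay in one
    cell, the leftmost points of their cells would coincide. *)
Lemma quad_children (q : nat) s : ok s -> (4 * q <= size s - 2)%N -> (2 < size s)%N ->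
  exists f : ('I_q * 'I_q) * ('I_q * 'I_q) -> pt,
    (forall k, avoids s (f k)) /\ (forall k k', k != k' -> sep s (f k) (f k')).
Proof.
move=> [us hT hL [r sE]] hq s3; set m := size s in hq s3.
pose N i := nth (0 : pt) s i.
have [idx [bnd inj1 inj2]] : exists idx : ('I_q * 'I_q) * ('I_q * 'I_q) -> (nat * nat) * (nat * nat),
  [/\ forall k, [/\ ((idx k).1.1 < q)%N, (q <= (idx k).1.2 < q * 2)%N,
      (q * 2 <= (idx k).2.1 < q * 3)%N & (q * 3 <= (idx k).2.2 < q * 4)%N],
    forall k k', k.1 != k'.1 -> ((idx k).1.1, (idx k).1.2) != ((idx k').1.1, (idx k').1.2) &
    forall k k', k.2 != k'.2 -> ((idx k).2.1, (idx k).2.2) != ((idx k').2.1, (idx k').2.2)].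
  exists (fun k : ('I_q * 'I_q) * ('I_q * 'I_q) => ((k.1.1 : nat, (q + k.1.2)%N), ((q * 2 + k.2.1)%N, (q * 3 + k.2.2)%N))); split.
  - case=> [[i j] [k l]] /=; have := ltn_ord i; have := ltn_ord j; have := ltn_ord k.
    by have := ltn_ord l; move: (i : nat) (j : nat) (k : nat) (l : nat); clear; move=> *; split; lia.
  - move=> [[i j] kl] [[i' j'] kl'] /=; apply: contra.
    by rewrite !xpair_eqE eqn_add2l.
  - move=> [ij [k l]] [ij' [k' l']] /=; apply: contra.
    by rewrite !xpair_eqE !eqn_add2l.
pose w1 k := cross (N (idx k).1.1) (N (idx k).1.2).
pose w2 k := cross (N (idx k).2.1) (N (idx k).2.2).
pose v0 k := cross (w1 k) (w2 k).
have mE : m = (size r + 3)%N by rewrite /m sE size_cat.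
have eyE : N (m - 2)%N = mkv 0 1 0.
  rewrite /N mE sE nth_cat (_ : size r + 3 - 2 = size r + 1)%N; last by clear; lia.
  by rewrite ltnNge leq_addr /= addKn.
have exE : N (m - 1)%N = mkv 1 0 0.
  rewrite /N mE sE nth_cat (_ : size r + 3 - 1 = size r + 2)%N; last by clear; lia.
  by rewrite ltnNge leq_addr /= addKn.
have hlines1 k k' : k.1 != k'.1 -> det3 (w1 k) (w1 k') (w2 k') != 0.
  move=> hne; have [a1 a2 a3 a4] := bnd k; have [b1 b2 b3 b4] := bnd k'.
  have ine := inj1 _ _ hne.
  apply: (nth_lines us hT hL) ine _; rewrite /= ?inE -/m;
    move: a1 a2 a3 a4 b1 b2 b3 b4 hq s3; move: (idx k) (idx k') => [[x1 x2] [x3 x4]] [[z1 z2] [z3 z4]] /=;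
    clear; lia.
have hlines2 k k' : k.2 != k'.2 -> det3 (w2 k) (w2 k') (w1 k') != 0.
  move=> hne; have [a1 a2 a3 a4] := bnd k; have [b1 b2 b3 b4] := bnd k'.
  have ine := inj2 _ _ hne.
  apply: (nth_lines us hT hL) ine _; rewrite /= ?inE -/m;
    move: a1 a2 a3 a4 b1 b2 b3 b4 hq s3; move: (idx k) (idx k') => [[x1 x2] [x3 x4]] [[z1 z2] [z3 z4]] /=;
    clear; lia.
(* The line at infinity joins the last two points of [s], and the crossing is not on it. *)
have hz k : cz (v0 k) != 0.
  have -> : cz (v0 k) = det3 (cross (N (m - 1)%N) (N (m - 2)%N)) (w1 k) (w2 k).
    by rewrite exE eyE /v0 /det3 !vecE; ring.
  have [a1 a2 a3 a4] := bnd k.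
  have hu : uniq [:: (m - 1)%N; (m - 2)%N; (idx k).1.1; (idx k).1.2; (idx k).2.1; (idx k).2.2].
    rewrite /= !inE; move: a1 a2 a3 a4 hq s3; move: (idx k) => [[x1 x2] [x3 x4]] /=.
    by clear; lia.
  have [l1 l2 l3 l4 l5] : [/\ (m - 1 < m)%N, (m - 2 < m)%N, ((idx k).1.1 < m)%N,
     ((idx k).1.2 < m)%N & ((idx k).2.1 < m)%N && ((idx k).2.2 < m)%N].
    move: a1 a2 a3 a4 hq s3; move: (idx k) => [[x1 x2] [x3 x4]] /=.
    by clear; move=> *; split; lia.
  case/andP: l5 => l5 l6; apply: hL; rewrite ?mem_nth //.
  by apply: (uniq_nth us hu); rewrite /= -/m l1 l2 l3 l4 l5 l6.
have hy1 k : cy (w1 k) != 0.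
  have -> : cy (w1 k) = det3 (N (m - 2)%N) (N (idx k).1.1) (N (idx k).1.2).
    by rewrite eyE /w1 /det3 !vecE; ring.
  have [a1 a2 a3 a4] := bnd k.
  apply: (nth_triple us hT); rewrite /= ?inE -?/m; move: a1 a2 a3 a4 hq s3; move: (idx k) => [[x1 x2] [x3 x4]] /=;
    clear; lia.
have hy2 k : cy (w2 k) != 0.
  have -> : cy (w2 k) = det3 (N (m - 2)%N) (N (idx k).2.1) (N (idx k).2.2).
    by rewrite eyE /w2 /det3 !vecE; ring.
  have [a1 a2 a3 a4] := bnd k.
  apply: (nth_triple us hT); rewrite /= ?inE -?/m; move: a1 a2 a3 a4 hq s3; move: (idx k) => [[x1 x2] [x3 x4]] /=;
    clear; lia.
have v00 k : v0 k != 0 by apply: contra_neq (hz k) => ->; rewrite cz0.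
pose v k := (cz (v0 k))^-1 *: v0 k.
pose s1 k := cy (w2 k) / cz (v0 k); pose s2 k := - (cy (w1 k) / cz (v0 k)).
have s10 k : s1 k != 0 by rewrite mulf_neq0 ?invr_eq0.
have s20 k : s2 k != 0 by rewrite oppr_eq0 mulf_neq0 ?invr_eq0.
(* The right-hand side vanishes at [v k] and, with these signs, is positive on the chosen cell:
   [v k] is the leftmost point of its cell. *)
have xiE k x : s1 k * dot (w1 k) x + s2 k * dot (w2 k) x = cx x - cx (v k) * cz x.
  have := hz k; rewrite /s1 /s2 /v /v0; move: (w1 k) (w2 k) => u1 u2.
  by rewrite !vecE => h; field.
have /choice[f hf] : forall k, exists p, [/\ 0 < s1 k * dot (w1 k) p, 0 < s2 k * dot (w2 k) p,
    forall w, w \in to_avoid s -> w != 0 -> dot w p != 0,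
    forall w, w \in to_avoid s -> 0 < dot w (v k) -> 0 < dot w p &
    forall w, w \in to_avoid s -> dot w (v k) < 0 -> dot w p < 0].
  move=> k; have k0 : (cz (v0 k))^-1 != 0 by rewrite invr_eq0.
  exact: (near_generic (to_avoid s) (v00 k) (s10 k) (s20 k) k0).
exists f; split=> [k|k k' ne]; first by have [_ _ h _ _] := hf k.
apply: contrapT => hsep.
have lt_m k0 : [/\ ((idx k0).1.1 < m)%N, ((idx k0).1.2 < m)%N, ((idx k0).2.1 < m)%N & ((idx k0).2.2 < m)%N].
  have [a1 a2 a3 a4] := bnd k0; move: a1 a2 a3 a4 hq s3; move: (idx k0) => [[x1 x2] [x3 x4]] /=.
  by clear; move=> *; split; lia.
have av (i j : nat) : (i < m)%N -> (j < m)%N -> cross (N i) (N j) \in to_avoid s.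
  by move=> hi hj; rewrite mem_cat connecting_mem ?mem_nth.
have same k1 k2 (i j : nat) : (k1, k2) = (k, k') \/ (k1, k2) = (k', k) -> (i < m)%N -> (j < m)%N ->
    0 <= dot (cross (N i) (N j)) (f k1) * dot (cross (N i) (N j)) (f k2).
  move=> hk hi hj; rewrite leNgt; apply/negP => hlt; apply: hsep.
  exists (N i), (N j); split; rewrite ?mem_nth //.
  by case: hk hlt => -[-> ->] //; rewrite mulrC.
(* [v k2] is in the closure of the cell of [f k2]; when no joining line separates [f k1] from
   [f k2], a strict inequality at [f k1] thus holds weakly at [v k2]. *)
have weak k1 k2 (x : R) (i j : nat) : (k1, k2) = (k, k') \/ (k1, k2) = (k', k) ->
    (i < m)%N -> (j < m)%N -> 0 < x * dot (cross (N i) (N j)) (f k1) ->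
    0 <= x * dot (cross (N i) (N j)) (v k2).
  move=> hk hi hj h1; have h2 := same k1 k2 i j hk hi hj.
  have [_ _ _ hp hn] := hf k2; have hp' := hp _ (av i j hi hj); have hn' := hn _ (av i j hi hj).
  move: h1 h2 hp' hn'; move: (dot _ (f k1)) (dot _ (f k2)) (dot _ (v k2)) => F1 F2 V h1 h2 hp' hn'.
  have [V0|V0|->] := ltgtP V 0; last by rewrite mulr0.
    have F20 := hn' V0; have x0 : x <= 0 by nra.
    nra.
  have F20 := hp' V0; have x0 : 0 <= x by nra.
  nra.
have czv k0 : cz (v k0) = 1 by rewrite /v czZ mulVf.
have half k1 k2 : (k1, k2) = (k, k') \/ (k1, k2) = (k', k) ->
   [/\ 0 <= s1 k1 * dot (w1 k1) (v k2), 0 <= s2 k1 * dot (w2 k1) (v k2) & cx (v k1) <= cx (v k2)].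
  move=> hk; have [h1 h2 _ _ _] := hf k1; have [i1 i2 i3 i4] := lt_m k1.
  have g1 := weak k1 k2 _ _ _ hk i1 i2 h1; have g2 := weak k1 k2 _ _ _ hk i3 i4 h2.
  by split=> //; have := xiE k1 (v k2); rewrite czv mulr1 => e; move: (addr_ge0 g1 g2); rewrite e subr_ge0.
have [g1 g2 g3] := half k k' (or_introl erefl).
have [_ _ g3'] := half k' k (or_intror erefl).
(* Neither crossing is to the left of the other, so equality holds and [v k'] lies on both lines of
   [k]. *)
have e0 : s1 k * dot (w1 k) (v k') + s2 k * dot (w2 k) (v k') = 0.
  by rewrite xiE czv mulr1; apply/eqP; rewrite subr_eq0 eq_le g3 g3'.
have z1 : dot (w1 k) (v k') = 0.
  by apply: (mulfI (s10 k)); rewrite mulr0; lra.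
have z2 : dot (w2 k) (v k') = 0.
  by apply: (mulfI (s20 k)); rewrite mulr0; lra.
have h1 : det3 (w1 k) (w1 k') (w2 k') = 0.
  move: z1; rewrite /v dotZr => /eqP; rewrite mulf_eq0 invr_eq0 (negPf (hz k')) /=.
  by move=> /eqP.
have h2 : det3 (w2 k) (w2 k') (w1 k') = 0.
  rewrite det3N; move: z2; rewrite /v dotZr => /eqP; rewrite mulf_eq0 invr_eq0 (negPf (hz k')) /=.
  by move=> /eqP h; rewrite [det3 _ _ _]h oppr0.
have [eq1|n1] := eqVneq k.1 k'.1; last by have := hlines1 _ _ n1; rewrite h1 eqxx.
have [eq2|n2] := eqVneq k.2 k'.2; last by have := hlines2 _ _ n2; rewrite h2 eqxx.
by case/negP: ne; apply/eqP; rewrite (surjective_pairing k) (surjective_pairing k') eq1 eq2.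
Qed.

(** [K] depends only on the length, so all branches grow alike and the family is indexed by a
    product of finite types. *)
Lemma children (m : nat) : (2 < m)%N -> exists K : finType, #|K| = kids m /\
  forall s, ok s -> size s = m -> exists f : K -> pt,
    (forall k, ok (f k :: s)) /\ (forall k k', k != k' -> sep s (f k) (f k')).
Proof.
move=> m3; set q := ((m - 2) %/ 4)%N.
have okc s p : ok s -> size s = m -> avoids s p -> ok (p :: s).
  move=> [us hT hL [r sE]] sm hp.
  have [|h1 h2 h3] := avoids_extend us _ hT hL hp; first by rewrite sm.
  by split=> //; exists (p :: r); rewrite sE.
have [q0|q0] := posnP q.
  exists unit; rewrite card_unit /kids -/q q0; split=> // s os sm.
  have [p hp] := avoid (to_avoid s); exists (fun=> p); split=> [_|[] [] //].
  exact: okc.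
exists (('I_q * 'I_q) * ('I_q * 'I_q))%type; split.
  rewrite !card_prod !card_ord /kids -/q (maxn_idPr _) ?expn_gt0 ?q0 //.
  by rewrite -!mulnA !expnS expn0 muln1.
move=> s os sm; have [||f [h1 h2]] := @quad_children q s os.
- by rewrite sm mulnC leq_trunc_div.
- by rewrite sm.
by exists f; split=> // k; apply: okc.
Qed.

(** New points are put in front, so [t] is the common past. Equal lengths of [r] and [r'] give the
    points of [t], and likewise [p] and [p'], the same indices in both lists. *)
Definition diverge s s' := exists r r' p p' t,
  [/\ s = r ++ p :: t, s' = r' ++ p' :: t, size r = size r', ok t & sep t p p'].

Lemma config_family (m : nat) : exists (J : finType) (L : J -> seq pt),
  [/\ #|J| = \prod_(3 <= i < m + 3) kids i, forall j, ok (L j) /\ size (L j) = (m + 3)%N &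
   forall j j', j != j' -> diverge (L j) (L j')].
Proof.
elim: m => [|m [J [L [cJ okL divL]]]].
  exists unit, (fun=> frame); rewrite card_unit big_geq //; split=> [//|_|[] [] //].
  by split=> //; apply: ok_frame.
have [K [cK hK]] := @children (m + 3)%N (leq_addl _ _).
have /choice[f hf] : forall j, exists f : K -> pt,
    (forall k, ok (f k :: L j)) /\ (forall k k', k != k' -> sep (L j) (f k) (f k')).
  by move=> j; have [o sz] := okL j; apply: hK.
exists (J * K)%type, (fun x => f x.1 x.2 :: L x.1); split.
- by rewrite card_prod cJ cK addSn big_nat_recr //= leq_addl.
- by move=> [j k] /=; have [_ ->] := okL j; split=> //; case: (hf j).
move=> [j k] [j' k'] /=; have [<-|nj _] := eqVneq j j'; last first.
  have [r [r' [p [p' [t [e e' sz ot st]]]]]] := divL _ _ nj.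
  exists (f j k :: r), (f j' k' :: r'), p, p', t; split=> //=; rewrite ?e ?e' //.
  by rewrite sz.
rewrite xpair_eqE eqxx /= => nk.
exists [::], [::], (f j k), (f j k'), (L j); split=> //; first by case: (okL j).
by case: (hf j) => _; apply.
Qed.

End Family.

(** * Counting combinatorial types *)


Section Counting.
Variable R : realType.
Notation pt := 'rV[R]_3.

Lemma sgn_code (x y : R) : (x <= 0, 0 <= x) = (y <= 0, 0 <= y) ->
  (x = 0 -> y = 0) /\ (0 < x * y \/ x = 0).
Proof.
by case: (ltgtP x 0) => hx; case: (ltgtP y 0) => hy //= _; (split; first by move=> h; lra);
  first [by left; nra | by right].
Qed.

(** The sign vector of the separating line [cross a b] on [s] does not occur for [s']: a functional
    realising it vanishes at [a] and [b], so it is a multiple of [cross a b], positive because of a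
    third point [d] of [t]; then [p] and [p'] would be on the same side. *)
Lemma diverge_codes (n : nat) (s s' : seq pt) : diverge s s' -> size s = n -> size s' = n ->
  exists X : {ffun 'I_n -> bool * bool},
    (exists c, forall i, X i = code (fun i : 'I_n => s`_i) c i) /\
    ~ (exists c, forall i, X i = code (fun i : 'I_n => s'`_i) c i).
Proof.
move=> [r [r' [p [p' [t [sE s'E sz [ut hT _ [r0 tE]] [a [b [ha hb hab]]]]]]]]] ss ss'.
have ab : a != b by apply: contraTneq hab => ->; rewrite crossvv !dot0l mul0r ltxx.
have [d hd /andP[da db]] : exists2 d, d \in t & (d != a) && (d != b).
  apply: contrapT => hn; have : {subset t <= [:: a; b]}.
    move=> c ct; rewrite !inE; apply: contrapT => /negP hc; apply: hn.
    by exists c => //; rewrite -negb_or.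
  move=> /(uniq_leq_size ut); rewrite tE size_cat /= addnS; lia.
have det0 : det3 d a b != 0 by apply: hT => //; rewrite /= !inE negb_or da db ab.
have lt_n (i : nat) : (i < size t)%N -> (size r + i.+1 < n)%N.
  by rewrite -ss sE size_cat /= ltn_add2l ltnS.
have at_t (x : pt) : x \in t -> exists i : 'I_n, s`_i = x /\ s'`_i = x.
  move=> xt; have hi := lt_n _ (etrans (index_mem x t) xt); exists (Ordinal hi) => /=.
  rewrite sE s'E !nth_cat -sz ltnNge leq_addr /= addKn /= nth_index //.
have [i0 [ep ep']] : exists i : 'I_n, s`_i = p /\ s'`_i = p'.
  have hi : (size r < n)%N by rewrite -ss sE size_cat /= addnS ltnS leq_addr.
  by exists (Ordinal hi) => /=; rewrite sE s'E !nth_cat -sz ltnn subnn.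
have [ia [ea ea']] := at_t _ ha; have [ib [eb eb']] := at_t _ hb.
have [id [ed ed']] := at_t _ hd.
pose c := cross a b.
exists [ffun i => code (fun i : 'I_n => s`_i) c i]; split; first by exists c => i; rewrite ffunE.
move=> [c' hc'].
have H (i : 'I_n) : (dot c s`_i <= 0, 0 <= dot c s`_i) = (dot c' s'`_i <= 0, 0 <= dot c' s'`_i).
  by have := hc' i; rewrite ffunE.
have c0 : c != 0 := det3_neq0_crossl det0.
have ca : dot c' a = 0.
  have [h _] := sgn_code (H ia); move: h; rewrite ea ea'; apply.
  by rewrite dotC dot_crossl.
have cb : dot c' b = 0.
  have [h _] := sgn_code (H ib); move: h; rewrite eb eb'; apply.
  by rewrite dotC dot_crossr.
have c'E := orth_cross c0 ca cb; set l := (_ / _) in c'E; rewrite -/c in c'E.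
have dn : dot c d != 0 by rewrite dotC.
have [_ [hl|h0]] := sgn_code (H id); last by rewrite ed in h0; rewrite h0 eqxx in dn.
rewrite ed ed' c'E dotZl in hl.
have l0 : 0 < l by have := sqr_ge0 (dot c d); nra.
have [_ [hp|h0]] := sgn_code (H i0); last by rewrite ep in h0; move: hab; rewrite -/c h0 mul0r ltxx.
rewrite ep ep' c'E dotZl mulrCA pmulr_rgt0 // in hp.
by move: hab; rewrite -/c ltNge (ltW hp).
Qed.

Lemma config_point (n : nat) (s : seq pt) : ok s -> size s = n ->
  generic_config (fun i : 'I_n => s`_i) (fun _ : 'I_1 => 0).
Proof.
move=> [us hT _ _] ss; split.
- move=> i j k huijk; have hu' : uniq [seq val x | x <- [:: i; j; k]] by rewrite map_inj_uniq //; apply: val_inj.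
  by apply: (nth_triple us hT); rewrite ?ss.
- by move=> i j a b _; rewrite [a]ord1 [b]ord1 eqxx.
- by move=> i a b a' b'; rewrite [a]ord1 [b]ord1 eqxx.
Qed.

(** The triangle is 0, [a], [a + e d] with [a] and then [d] generic. Its sides have the directions
    [a], [a + e d] and [d], and smallness of [e] keeps the second one generic. *)
Lemma config_triangle (n : nat) (s : seq pt) : ok s -> size s = n -> (1 < n)%N ->
  exists t : 'I_3 -> pt, generic_config (fun i : 'I_n => s`_i) t.
Proof.
move=> os ss n2; have [ggg _ _] := config_point os ss.
case: os => us hT _ [r0 sE].
have cross0 x y : x \in s -> y \in s -> x != y -> cross x y != 0.
  move=> hx hy xy; have [d hd /andP[dx dy]] : exists2 d, d \in s & (d != x) && (d != y).
    apply: contrapT => hn; have : {subset s <= [:: x; y]}.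
      move=> c ct; rewrite !inE; apply: contrapT => /negP hc; apply: hn.
      by exists c => //; rewrite -negb_or.
    move=> /(uniq_leq_size us); rewrite sE size_cat /= addnS; lia.
  by apply: (@det3_neq0_crossl _ d); apply: hT => //; rewrite /= !inE negb_or dx dy xy.
have [a ha] := avoid (connecting s).
have ha' x y : x \in s -> y \in s -> x != y -> dot (cross x y) a != 0.
  by move=> hx hy xy; apply: ha; [apply: connecting_mem | apply: cross0].
have ca x : x \in s -> cross x a != 0.
  move=> hx; have [y hy yx] : exists2 y, y \in s & y != x.
    apply: contrapT => hn; have : {subset s <= [:: x]}.
      by move=> c ct; rewrite !inE; apply: contrapT => /negP hc; apply: hn; exists c.
    move=> /(uniq_leq_size us); rewrite ss /=; lia.
  apply/eqP => h; have := ha' _ _ hy hx yx.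
  by rewrite dotC -/(det3 a y x) det3C /det3 h dot0r eqxx.
have [d hd] := avoid (connecting s ++ [seq cross x a | x <- s]).
have hd1 x y : x \in s -> y \in s -> x != y -> dot (cross x y) d != 0.
  by move=> hx hy xy; apply: hd; [rewrite mem_cat connecting_mem | apply: cross0].
have hd2 x : x \in s -> dot (cross x a) d != 0.
  move=> hx; apply: hd; last exact: ca.
  by rewrite mem_cat; apply/orP; right; apply: map_f.
have [e e0 he] : exists2 e, 0 < e & forall w, w \in connecting s -> dot w a != 0 -> dot w (a + e *: d) != 0.
  apply: small_pos_ex; apply: small_pos_seq => w _.
  have [h|h] := eqVneq (dot w a) 0; first exact: small_posT.
  have [|f f0 hf] := @small_pos_sign R (dot w a) (dot w d) 0; first by case=> /eqP; rewrite (negPf h).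
  by exists f => // t t0 tf _; have [] := hf t t0 tf; rewrite mulr0 addr0 dotDr dotZr.
pose b := a + e *: d.
have en : e != 0 by rewrite gt_eqF.
have gE i j : i != j -> s`_(i : 'I_n) != s`_(j : 'I_n).
  by move=> ij; rewrite nth_uniq ?ss.
have gs (i : 'I_n) : s`_i \in s by rewrite mem_nth ?ss.
exists (fun k => nth 0 [:: 0; a; b] k); split=> //.
- move=> i j x y ij xy.
  have D (v : pt) : det3 s`_i s`_j v = dot (cross s`_i s`_j) v.
    by rewrite /det3 !vecE; ring.
  have Da : dot (cross s`_i s`_j) a != 0 by apply: ha'; rewrite ?gs ?gE.
  have Db : dot (cross s`_i s`_j) b != 0 by apply: he => //; apply: connecting_mem.
  have Dd : dot (cross s`_i s`_j) b - dot (cross s`_i s`_j) a != 0.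
    by rewrite /b dotDr dotZr addrC addKr mulf_neq0 // hd1 ?gs ?gE.
  rewrite D dotBr; move: Da Db Dd.
  case: x xy => [[|[|[|//]]] hx]; case: y => [[|[|[|//]]] hy] //= _ Da Db Dd;
    rewrite ?dot0r ?subr0 ?sub0r ?oppr_eq0 //.
  by rewrite -oppr_eq0 opprB.
- move=> i x y x' y' xy xy' ne.
  have Dab : det3 s`_i a b != 0.
    have -> : det3 s`_i a b = e * dot (cross s`_i a) d by rewrite /b /det3 !vecE; ring.
    by rewrite mulf_neq0 // hd2.
  have B (v w z u : pt) : det3 s`_i (v - w) (z - u) = det3 s`_i v z - det3 s`_i v u - det3 s`_i w z + det3 s`_i w u.
    by rewrite /det3 !vecE; ring.
  have D0l v : det3 s`_i 0 v = 0 by rewrite /det3 !vecE; ring.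
  have D0r v : det3 s`_i v 0 = 0 by rewrite /det3 !vecE; ring.
  have Dv v : det3 s`_i v v = 0 by rewrite /det3 !vecE; ring.
  have Dba : det3 s`_i b a = - det3 s`_i a b by rewrite det3N.
  rewrite B; move: Dab Dba D0l D0r Dv => Dab Dba D0l D0r Dv.
  case: x xy ne => [[|[|[|//]]] hx]; case: y => [[|[|[|//]]] hy] //= _;
  case: x' xy' => [[|[|[|//]]] hx']; case: y' => [[|[|[|//]]] hy'] //= _ ne;
  try (by exfalso; case/negP: ne; apply/eqP/setP => z; rewrite !inE -!val_eqE //= orbC);
  rewrite ?D0l ?D0r ?Dv ?Dba; apply/eqP => h; case/eqP: Dab; lra.
Qed.

Lemma same_comb_sym (P Q : set pt) : same_comb_type P Q -> same_comb_type Q P.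
Proof.
move=> [f [g [hf hg gf fg ord]]]; exists g, f; split=> // G G' hG hG'.
by rewrite (ord (g G) (g G')) ?fg //; apply: hg.
Qed.

Lemma same_comb_refl (P : set pt) : same_comb_type P P.
Proof. by exists id, id; split. Qed.

(** A maximal set of pairwise inequivalent members meets the class of every index, so the classes of
    its elements, each of size at most [B], cover [J]. *)
Lemma greedy_types (J : finType) (P : J -> set pt) (k B : nat) :
  (forall j, equiprojective (P j) k) ->
  (forall j0, (#|[set j | `[< same_comb_type (P j0) (P j) >]]| <= B)%N) ->
  exists N, at_least_types R k N /\ (#|J| <= N * B)%N.
Proof.
move=> hP hB; pose e i j := `[< same_comb_type (P i) (P j) >].
pose indep (S : {set J}) := [forall i in S, forall j in S, (i != j) ==> ~~ e i j].
have i0 : indep set0 by apply/forallP => i; rewrite inE.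
have [A /maxsetP[iA mA] _] := maxset_exists i0.
have esym i j : e i j = e j i by apply/asboolP/asboolP; apply: same_comb_sym.
have cov j : exists i, (i \in A) && e i j.
  apply: contrapT => hn.
  have hne i : i \in A -> ~~ e i j by move=> iA'; apply/negP => h; apply: hn; exists i; rewrite iA'.
  have jA : j \notin A by apply/negP => /hne/negP; apply; apply/asboolP/same_comb_refl.
  have : j |: A = A.
    apply: mA; last exact: subsetUr.
    apply/forallP => a; apply/implyP; rewrite !inE => ha.
    apply/forallP => b; apply/implyP; rewrite !inE => hb; apply/implyP => ab.
    case/orP: ha => [/eqP ea|ha]; case/orP: hb => [/eqP eb|hb].
    - by rewrite ea eb eqxx in ab.
    - by rewrite ea esym hne.
    - by rewrite eb hne.
    - by move/forallP/(_ a): iA; rewrite ha => /forallP/(_ b); rewrite hb ab.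
  by move=> h; move: jA; rewrite -h !inE eqxx.
exists #|A|; split.
  exists (fun i => P (enum_val i)); split=> [i|i j ij]; first exact: hP.
  move=> hs; have ne : enum_val i != enum_val j by apply: contra_neq ij; apply: enum_val_inj.
  move/forallP/(_ (enum_val i)): iA; rewrite enum_valP => /forallP/(_ (enum_val j)).
  by rewrite enum_valP ne /= => /asboolP; apply.
pose phi j := xchoose (cov j).
have hphi j : (phi j \in A) && e (phi j) j := xchooseP (cov j).
rewrite -[#|J|]sum1_card (partition_big phi (mem A)) /=; last by move=> j _; case/andP: (hphi j).
rewrite -sum_nat_const; apply: leq_sum => i iA'; rewrite sum1_card; apply: leq_trans (hB i).
apply: subset_leq_card; apply/subsetP => j; rewrite !inE => /eqP <-.
by case/andP: (hphi j).
Qed.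

Lemma types_lower (n m : nat) : (3 <= n)%N -> m = 1%N \/ m = 3%N ->
  exists N, at_least_types R (n.*2 + m - (m == 1%N)) N /\
    (\prod_(3 <= i < n) kids i <= N * (n * 4) ^ n)%N.
Proof.
(* The frame already supplies three of the [n] vectors. *)
move=> n3 m13; have [J [L [cJ okL divL]]] := config_family R (n - 3).
rewrite subnK // in cJ okL.
have /choice[t ht] : forall j, exists t : 'I_m -> pt, generic_config (fun i : 'I_n => (L j)`_i) t.
  move=> j; have [o sz] := okL j; case: m13 => ->.
    by exists (fun=> 0); apply: config_point.
  by apply: config_triangle => //; apply: ltn_trans n3.
pose g j := fun i : 'I_n => (L j)`_i.
pose P j := minkowski (@vown n m) (vpos (g j) (t j)).
rewrite -cJ; apply: (@greedy_types J P) => j0; first exact: (summands_equiprojective n3 m13 (ht j0)).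
have /choice[D hD] : forall j, exists D : {ffun 'I_n -> 'I_n * (bool * bool)},
    same_comb_type (P j0) (P j) -> forall X : {ffun 'I_n -> bool * bool},
    (exists c, forall i, X i = code (g j) c i) <->
    (exists c, forall i, X i = sign_rule (D i).2 (code (g j0) c (D i).1)).
  move=> j; have [h|h] := pselect (same_comb_type (P j0) (P j)); last first.
    have n1 : (0 < n)%N by apply: leq_trans n3.
    by exists [ffun=> (Ordinal n1, (true, true))] => /h.
  by have [D hD] := comb_type_codes n3 m13 (ht j0) (ht j) h; exists D.
have inj : {in [set j | `[< same_comb_type (P j0) (P j) >]] &, injective D}.
  move=> j j'; rewrite !inE => /asboolP h /asboolP h' eD; apply: contrapT => /eqP ne.
  have [X [hX nX]] := diverge_codes (divL _ _ ne) (okL j).2 (okL j').2.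
  by apply: nX; apply/(hD _ h'); rewrite -eD; apply/(hD _ h).
rewrite -(card_in_imset inj); apply: leq_trans (max_card _) _.
by rewrite card_ffun !card_prod !card_ord card_bool.
Qed.

End Counting.

(** * Asymptotics *)


Section Asymptotics.
Variable R : realType.

Lemma natr_pos (n : nat) : (0 < n)%N -> (n%:R : R) \is Num.pos.
Proof. by rewrite posrE ltr0n. Qed.

Lemma ln_natM (a b : nat) : (0 < a)%N -> (0 < b)%N ->
  ln ((a * b)%:R : R) = ln a%:R + ln b%:R.
Proof. by move=> a0 b0; rewrite natrM lnM ?natr_pos. Qed.

Lemma ln_nat_le (a b : nat) : (0 < a)%N -> (a <= b)%N -> ln (a%:R : R) <= ln b%:R.
Proof. by move=> a0 ab; rewrite ler_ln ?natr_pos ?ler_nat // (leq_trans a0). Qed.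

Lemma ln_nat_lt (a : nat) : (0 < a)%N -> ln (a%:R : R) <= a%:R - 1.
Proof.
move=> a0; have -> : (a%:R : R) = 1 + (a%:R - 1) by rewrite addrC subrK.
have : (1 : R) <= a%:R by rewrite ler1n.
by move=> h; apply: le_trans (le_ln1Dx _) _; lra.
Qed.

Lemma kids_gt0 i : (0 < kids i)%N.
Proof. by rewrite leq_max. Qed.

Lemma ln_kids (i : nat) : (0 < i)%N -> 4 * ln (i%:R : R) - 32 <= ln (kids i)%:R.
Proof.
move=> i0; pose M := maxn 1 ((i - 2) %/ 4).
have M0 : (0 < M)%N by rewrite leq_max.
have kE : kids i = (M ^ 4)%N.
  rewrite /kids /M; case: ((i - 2) %/ 4)%N => [//|q].
  by rewrite !(maxn_idPr _) ?expn_gt0.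
(* [i - 2] is at most [4 * M + 3], and [M] is at least 1. The 32 is four times the bound 8 for
   [ln 9]. *)
have iM : (i <= 9 * M)%N.
  by have := divn_eq (i - 2) 4; have := ltn_pmod (i - 2) (isT : 0 < 4)%N; rewrite /M; lia.
have h1 : ln (i%:R : R) <= ln 9%:R + ln M%:R by rewrite -ln_natM //; apply: ln_nat_le.
have h9 : ln (9%:R : R) <= 8 by apply: le_trans (ln_nat_lt _) _ => //; lra.
rewrite kE natrX lnXn ?ltr0n // -mulr_natl; lra.
Qed.

Lemma prod_kids_gt0 n : (0 < \prod_(3 <= i < n) kids i)%N.
Proof. by apply: prodn_gt0 => i; apply: kids_gt0. Qed.

(** Each induction step loses 32 through [ln_kids], and the increment of [4 n ln n] exceeds [4 ln n]
    by at most 8; together this is 40. *)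
Lemma ln_prod_kids (n : nat) : (3 <= n)%N ->
  4 * (n%:R * ln (n%:R : R)) - 40 * n%:R <= ln (\prod_(3 <= i < n) kids i)%N%:R.
Proof.
elim: n => // n ih; rewrite leq_eqVlt => /orP[/eqP <-|].
  rewrite big_geq // ln1.
  have := ln_nat_lt (isT : (0 < 3)%N); move: (ln 3%:R) => x; rewrite (_ : 3%:R = 3 :> R) //; lra.
rewrite ltnS => n3; have {}ih := ih n3.
have n0 : (0 < n)%N by apply: leq_trans n3.
rewrite big_nat_recr //= ln_natM ?prod_kids_gt0 ?kids_gt0 //.
have hk := ln_kids n0.
have nR : 0 < (n%:R : R) by rewrite ltr0n.
have nR1 : 1 <= (n%:R : R) by rewrite ler1n.
have hstep : ln (n.+1%:R : R) <= ln n%:R + n%:R^-1.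
  have -> : (n.+1%:R : R) = n%:R * (1 + n%:R^-1).
    by rewrite mulrDr mulr1 divff ?gt_eqF // -natr1.
  rewrite lnM ?posrE //; last by rewrite addr_gt0 ?invr_gt0.
  rewrite lerD2l; apply: le_ln1Dx.
  by apply: lt_trans (_ : 0 < _); rewrite ?invr_gt0 // oppr_lt0.
have hmul : n.+1%:R * ln (n.+1%:R : R) <= n.+1%:R * ln n%:R + 2.
  have : n.+1%:R * ln (n.+1%:R : R) <= n.+1%:R * (ln n%:R + n%:R^-1) by rewrite ler_wpM2l.
  have : (n.+1%:R : R) * n%:R^-1 <= 2 by rewrite ler_pdivrMr // -natr1; lra.
  rewrite mulrDr; lra.
have e : (n.+1%:R : R) * ln n%:R = n%:R * ln n%:R + ln n%:R by rewrite -natr1 mulrDl mul1r.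
have e' : (n.+1%:R : R) = n%:R + 1 by rewrite natr1.
rewrite e in hmul; move: hmul ih hk.
move: (n.+1%:R * ln n.+1%:R) (n%:R * ln n%:R) => P Q; rewrite e'; lra.
Qed.

(** Dividing by [(4n)^n] leaves [3 n ln n] of the [4 n ln n], and [n] is [k / 2] up to a constant.
    The linear losses add up to less than [60 k]. *)
Lemma ln_types (n k N : nat) : (3 <= n)%N -> (n.*2 <= k)%N -> (k <= n.*2 + 3)%N ->
  (\prod_(3 <= i < n) kids i <= N * (n * 4) ^ n)%N ->
  (0 < N)%N /\ 3 / 2 * (k%:R * ln k%:R) - 60 * k%:R <= ln (N%:R : R).
Proof.
move=> n3 k1 k2 hN.
have n0 : (0 < n)%N by apply: leq_trans n3.
have N0 : (0 < N)%N.
  by rewrite lt0n; apply: contraTneq hN => ->; rewrite mul0n leqn0 -lt0n prod_kids_gt0.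
split=> //.
have k0 : (0 < k)%N by apply: leq_trans k1; rewrite double_gt0.
have e4 : (0 < (n * 4) ^ n)%N by rewrite expn_gt0 muln_gt0 n0.
have h1 : ln ((\prod_(3 <= i < n) kids i)%N%:R : R) <= ln N%:R + n%:R * (ln n%:R + ln 4%:R).
  apply: le_trans (ln_nat_le (prod_kids_gt0 n) hN) _.
  by rewrite ln_natM // natrX lnXn ?ltr0n ?muln_gt0 ?n0 // ln_natM // -[X in _ + X <= _]mulr_natl.
have h2 := ln_prod_kids n3.
have l4 : ln (4%:R : R) <= 3 by apply: le_trans (ln_nat_lt _) _ => //; lra.
have l5 : ln (5%:R : R) <= 4 by apply: le_trans (ln_nat_lt _) _ => //; lra.
have lk : ln (k%:R : R) <= ln n%:R + 4.
  have : ln (k%:R : R) <= ln (n * 5)%:R by apply: ln_nat_le => //; lia.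
  by rewrite ln_natM //; lra.
have lkk : ln (k%:R : R) <= k%:R by apply: le_trans (ln_nat_lt _) _ => //; lra.
have lk0 : 0 <= ln (k%:R : R) by apply: ln_ge0; rewrite ler1n.
have kR1 : 2 * (n%:R : R) <= k%:R by rewrite -natrM ler_nat mul2n.
have kR2 : (k%:R : R) <= 2 * n%:R + 3 by rewrite -natrM -natrD ler_nat mul2n.
have nR : 0 <= (n%:R : R) by rewrite ler0n.
have m1 : k%:R * ln (k%:R : R) <= 2 * (n%:R * ln k%:R) + 3 * ln k%:R.
  have : k%:R * ln (k%:R : R) <= (2 * n%:R + 3) * ln k%:R by rewrite ler_wpM2r.
  by rewrite mulrDl mulrA.
have m2 : n%:R * ln (k%:R : R) <= n%:R * ln n%:R + 4 * n%:R.
  have : n%:R * ln (k%:R : R) <= n%:R * (ln n%:R + 4) by rewrite ler_wpM2l.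
  by rewrite mulrDr [_ * 4]mulrC.
have m3 : n%:R * (ln (n%:R : R) + ln 4%:R) <= n%:R * ln n%:R + 3 * n%:R.
  apply: (@le_trans _ _ (n%:R * (ln n%:R + 3))); first by rewrite ler_wpM2l // lerD2l.
  by rewrite mulrDr [_ * 3]mulrC.
move: h1 h2 m1 m2 m3 lkk kR1 kR2 nR lk0; clear.
move: (n%:R * (ln n%:R + ln 4%:R)) (k%:R * ln k%:R) (n%:R * ln k%:R) (n%:R * ln n%:R) => A B C D.
lra.
Qed.

End Asymptotics.

Theorem theorem1p1 (R : realType) :
  exists g : nat -> R,
    (exists (C : R) (K0 : nat), forall k : nat, (K0 <= k)%N ->
        `|g k| <= C / ln (k%:R)) /\
    (exists K1 : nat, forall k : nat, (K1 <= k)%N ->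
        exists N : nat,
          (k%:R `^ (k%:R * (3 / 2 + g k)) <= N%:R) /\ at_least_types R k N).
Proof.
(* A loss of [60 k] in [ln N] is a loss of [k * (60 / ln k)] in the exponent of [k]. *)
exists (fun k => - (60 / ln k%:R)); split.
  exists 60, 2%N => k k2; rewrite normrN ger0_norm // divr_ge0 //.
  by apply: ln_ge0; rewrite ler1n; apply: ltn_trans k2.
(* For odd [k] there are [(k - 3) / 2] segments, and at least three are required. *)
exists 9%N => k k9.
have [n [m [n3 m13 kE]]] : exists n m, [/\ (3 <= n)%N, m = 1%N \/ m = 3%N & k = (n.*2 + m - (m == 1%N))%N].
  have [ok|ek] := boolP (odd k).
    by exists ((k - 3)./2), 3%N; split; [| right |]; move: k9 ok; clear; lia.
  by exists (k./2), 1%N; split; [| left |]; move: k9 ek; clear; lia.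
have [N [hN hc]] := types_lower R n3 m13.
exists N; split; last by rewrite kE.
have k1 : (n.*2 <= k)%N by rewrite kE; case: m13 => ->; clear; lia.
have k2 : (k <= n.*2 + 3)%N by rewrite kE; case: m13 => ->; clear; lia.
have [N0 hl] := ln_types R n3 k1 k2 hc.
have k0 : (0 < k)%N by apply: leq_trans k9.
have lnk : 0 < ln (k%:R : R) by apply: ln_gt0; rewrite ltr1n; apply: leq_trans k9.
rewrite -[X in _ <= X]lnK ?natr_pos // /powR pnatr_eq0 gtn_eqF // ler_expR.
apply: le_trans hl; rewrite le_eqVlt; apply/orP; left; apply/eqP.
by field; rewrite gt_eqF.
Qed.
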